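(* Suppose the Markov chain $\Xi$ on $\mathbb X\subseteq\mathbb R_+$ satisfies $(\mathrm T_{\alpha,\beta,c})$ and $(\mathrm D_{\gamma,b})$, and let $q>0$. Then for all $a$ sufficiently large and all $x>a$: (i) if $\gamma>\alpha-1$, then $\mathbb E_x[\tau_a^q]<\infty$ for $q<1/\alpha$ and $\mathbb E_x[\tau_a^q]=\infty$ for $q>1/\alpha$; (ii) if $\gamma=\alpha-1$ and $b<c\pi|\csc(\pi\alpha)|$, then $\mathbb E_x[\tau_a^q]<\infty$ for $q<\nu^\star/\alpha$ and $\mathbb E_x[\tau_a^q]=\infty$ for $q>\nu^\star/\alpha$, where $\nu^\star=\nu^\star(\alpha,b,c)$ is the unique solution in $(0,\alpha)$ of $$\frac bc=(\nu^\star-1)\frac{\Gamma(1-\alpha)\Gamma(\alpha-\nu^\star)}{\Gamma(2-\nu^\star)};$$ (iii) if $\gamma<\alpha-1$ and $b<0$, then $\mathbb E_x[\tau_a^q]<\infty$ for $q<\frac{\alpha}{\gamma+1}$ and $\mathbb E_x[\tau_a^q]=\infty$ for $q\ge\frac{\alpha}{\gamma+1}$.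
   Context: $\Xi=(\xi_n)_{n\ge0}$ is a time-homogeneous Markov chain on an infinite, unbounded, measurable $\mathbb X\subseteq\mathbb R_+$. $\mathbb P_x,\mathbb E_x$ refer to the chain started at $x$; $\theta:=\xi_1-\xi_0$; $y_+:=y\mathbf 1\{y\ge0\}$, $y_-:=-y\mathbf 1\{y<0\}$; $\mu(x):=\mathbb E_x[\theta]$; $\tau_a:=\min\{n\ge0:\xi_n\le a\}$. $\Gamma$ is the Euler gamma function. Condition $(\mathrm T_{\alpha,\beta,c})$: there exist constants $\alpha\in(1,2)$, $\beta>\alpha$, $c>0$, $x_0\in\mathbb R_+$ with $\lim_{y\to\infty}\sup_{x\ge x_0}|y^\alpha\mathbb P_x[\theta_+>y]-c|=0$ and $\sup_{x\ge x_0}\mathbb E_x[\theta_-^\beta]<\infty$. Condition $(\mathrm D_{\gamma,b})$: there exist constants $\gamma\ge0$, $b\in\mathbb R$ with $\lim_{x\to\infty}x^\gamma\mu(x)=b$. *)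

(* Defs.v *)
(* The state space X is a measurable
   subset of an abstract real type R (Borel sigma-algebra on R); the
   time-homogeneous Markov chain is given by its transition (probability)
   kernel K : R.-pker R ~> R, so that P_x[xi_1 \in A] = K x A. *)
From mathcomp Require Import all_boot all_order all_algebra.
From mathcomp Require Import all_classical all_reals all_analysis.
Set Implicit Arguments. Unset Strict Implicit. Unset Printing Implicit Defensive.
Import Order.TTheory GRing.Theory Num.Theory.
Local Open Scope classical_set_scope.
Local Open Scope ring_scope.

Definition pos_part (R : realType) (y : R) : R := if 0 <= y then y else 0.
Definition neg_part (R : realType) (y : R) : R := if y < 0 then - y else 0.

Definition drift (R : realType) (K : R.-pker R ~> R) (x : R) : R :=
  fine (\int[K x]_z (z - x)%:E)%E.

Definition jump_tail (R : realType) (K : R.-pker R ~> R) (x y : R) : R :=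
  fine (K x [set z : R | y < pos_part (z - x)]).

Definition neg_jump_moment (R : realType) (K : R.-pker R ~> R) (beta x : R)
  : \bar R :=
  (\int[K x]_z (neg_part (z - x) `^ beta)%:E)%E.

(* surv K a n x = P_x[tau_a > n] = P_x[xi_0 > a, ..., xi_n > a],
   where tau_a = min{n >= 0 : xi_n <= a}. *)
Fixpoint surv (R : realType) (K : R.-pker R ~> R) (a : R) (n : nat) (x : R)
  : \bar R :=
  match n with
  | 0 => if a < x then 1%E else 0%E
  | m.+1 => if a < x then (\int[K x]_y surv K a m y)%E else 0%E
  end.

Definition hit_prob (R : realType) (K : R.-pker R ~> R) (a : R) (n : nat)
  (x : R) : \bar R :=
  match n with
  | 0 => (1 - surv K a 0 x)%E
  | m.+1 => (surv K a m x - surv K a n x)%E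
  end.

Definition never_hit_prob (R : realType) (K : R.-pker R ~> R) (a x : R)
  : \bar R := limn (fun n => surv K a n x).

(* E_x[tau_a^q] for q > 0, as the expectation of the [0,+oo]-valued random
   variable tau_a^q (with +oo^q = +oo):
   sum_n n^q P_x[tau_a = n] + (+oo) * P_x[tau_a = +oo]. *)
Definition hit_moment (R : realType) (K : R.-pker R ~> R) (a q x : R)
  : \bar R :=
  ((\sum_(0 <= n <oo) ((n%:R : R) `^ q)%:E * hit_prob K a n x)
   + +oo * never_hit_prob K a x)%E.

(* Euler Gamma function.  For s > 0 the integral
   int_0^oo t^(s-1) e^(-t) dt; for s <= 0 (non-integer) the analytic
   continuation Gamma(s) = Gamma(s+k) / (s (s+1) ... (s+k-1)), with k such
   that s + k > 0.  (Junk value 0 at the poles 0,-1,-2,...) *)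
Definition Gamma_pos (R : realType) (s : R) : R :=
  fine (\int[@lebesgue_measure R]_(t in `]0%R, +oo[) (t `^ (s - 1) * expR (- t))%:E)%E.

Definition Gamma_shift (R : realType) (s : R) : nat :=
  if 0 < s then 0%N else (`|Num.floor (- s)|%N).+1.

Definition Gamma (R : realType) (s : R) : R :=
  Gamma_pos (s + (Gamma_shift s)%:R) / \prod_(i < Gamma_shift s) (s + i%:R).

Definition cond_T (R : realType) (X : set R) (K : R.-pker R ~> R)
  (alpha beta c : R) : Prop :=
  [/\ 1 < alpha < 2, alpha < beta, 0 < c &
  exists x0 : R, 0 <= x0 /\
    (forall e : R, 0 < e -> exists Y : R, forall y : R, Y <= y ->
       forall x, X x -> x0 <= x -> `| y `^ alpha * jump_tail K x y - c | <= e)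
    /\ (exists M : R, forall x, X x -> x0 <= x ->
          (neg_jump_moment K beta x <= M%:E)%E)].

Definition cond_D (R : realType) (X : set R) (K : R.-pker R ~> R)
  (gamma b : R) : Prop :=
  0 <= gamma /\
  (forall e : R, 0 < e -> exists M : R, forall x, X x -> M <= x ->
     `| x `^ gamma * drift K x - b | <= e).

Definition nu_star_eq (R : realType) (alpha b c nu : R) : Prop :=
  0 < nu < alpha /\
  b / c = (nu - 1) * (Gamma (1 - alpha) * Gamma (alpha - nu)) / Gamma (2 - nu).

(* Main.v *)
(* Lyapunov functions [x ^ nu] with [0 < nu < alpha].  A layer-cake computation gives
     E_x[xi_1 ^ nu] - x ^ nu
       = nu x ^ (nu - 1) mu(x) + x ^ (nu - alpha) (c nu J(nu) + o(1)),
   where [J(nu) = int_0^oo ((1 + u) ^ (nu - 1) - 1) u ^ (- alpha) du] is increasing and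
   continuous.  By the Beta integral, [nu_star] is the solution of [b / c = - J(nu)]; it
   exists because [J(0) = - pi |csc (pi alpha)|] (the reflection formula) and
   [J(nu) -> oo] as [nu -> alpha].  In case (i) the drift is negligible and
   [nu_star = 1]; in case (iii) it dominates, with time scale [x ^ (gamma + 1)].

   Upper bounds: if [x ^ nu] has drift at most [- e x ^ (nu - r)] above [a], an induction on
   [n] gives [P_x[tau_a > n] <= C n ^ (- nu / r)].  Lower bounds: from [B] the chain
   needs time of order [B ^ p] to come down to [a] (a one-step drift bound for a
   truncated quadratic function); it reaches such a [B] either by a single jump, or, when
   [x ^ nu] is submartingale-like, by optional stopping with controlled overshoot,
   which here is an induction on [n] for a truncated Lyapunov function. *)

Require Import Defs.
From HB Require Import structures.
From mathcomp Require Import all_boot all_order all_algebra.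
From mathcomp Require Import all_classical all_reals all_analysis.
From mathcomp Require Import measurable_realfun ring lra.
Import Order.TTheory GRing.Theory Num.Theory.
Import numFieldNormedType.Exports.
Set Implicit Arguments.
Unset Strict Implicit.
Unset Printing Implicit Defensive.
Local Open Scope classical_set_scope.
Local Open Scope ring_scope.

(** * Power inequalities *)

Section powR_inequalities.
Context {R : realType}.
Implicit Types (r u v x y t nu : R).

(** No path space is built: each probabilistic step is an inequality about [surv], proved from
    one-step kernel integrals. Since [alpha < 2] the jumps have infinite variance, so the Lyapunov
    functions cannot be expanded to second order. The Taylor remainder over upward jumps is
    integrated against the tail itself, and the scaling t = x u turns it into J; downward jumps have
    a moment of order above [alpha] and enter only the error. The remainder has the constant sign of
    [nu - 1], so Tonelli runs on nonnegative integrands and the sign is restored at the end. A slow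
    descent from B, taking time of order B^p, is derived from an absolute jump moment of order p,
    which forces p < [alpha]. In case (iii) the natural scale p = [gamma + 1] lies below [alpha], so
    the endpoint exponent is reached; in cases (i) and (ii) p can only approach [alpha], and
    equality stays out of reach. The value J(0) comes from Herglotz' trick: the integral and pi /
    sin satisfy one tripling formula and have the same poles. Cubing fits because 1 + v^3 is
    divisible by 1 + v, which 1 + v^2 is not. *)

Lemma powR_expR_ln r x : 0 < x -> x `^ r = expR (r * ln x).
Proof. by move=> x0; rewrite /powR gt_eqF. Qed.

Lemma powRD_gt0 x p r : 0 < x -> x `^ (p + r) = x `^ p * x `^ r.
Proof. by move=> x0; rewrite powRD//; apply/implyP => _; rewrite gt_eqF. Qed.

Lemma powR_ge1 x p : 1 <= x -> 0 <= p -> 1 <= x `^ p.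
Proof. by move=> x1 p0; apply: (@le_trans _ _ (x `^ 0)); [rewrite powRr0|exact: ler_powR]. Qed.

(** With L = ln (1 + u), the bound 1 + y <= exp y is used at y = (1 - r) L and at y = - r L.
    Weighting the two results by r and 1 - r cancels L. *)
Lemma bernoulli_le r u : 0 <= r <= 1 -> -1 < u -> (1 + u) `^ r <= 1 + r * u.
Proof.
move=> /andP[r0 r1] u1.
have u0 : 0 < 1 + u by lra.
rewrite powR_expR_ln//; set L := ln (1 + u).
have e0 := expR_gt0 (r * L).
have h1 : expR L = 1 + u by rewrite lnK.
have t1 : expR (r * L) * (1 + (1 - r) * L) <= 1 + u.
  rewrite -h1 [leRHS](_ : _ = expR (r * L) * expR ((1 - r) * L)).
    by rewrite ler_pM2l// expR_ge1Dx.
  by rewrite -expRD; congr expR; ring.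
have t2 : expR (r * L) * (1 + - r * L) <= 1.
  rewrite -[leRHS](_ : expR (r * L) * expR (- r * L) = 1).
    by rewrite ler_pM2l// expR_ge1Dx.
  by rewrite -expRD mulNr subrr expR0.
nra.
Qed.

Lemma bernoulli_ge_neg r u : r <= 0 -> -1 < u -> 1 + r * u <= (1 + u) `^ r.
Proof.
move=> r0 u1; rewrite powR_expR_ln; last by lra.
apply: le_trans (expR_ge1Dx _); rewrite lerD2l.
by apply: ler_wnM2l => //; exact: le_ln1Dx.
Qed.

(** The negative-exponent case, with exponent 1 - r at the point 1 / (1 + u), bounds (1 + u)^(r - 1)
    from below; multiplying by 1 + u gives the claim. *)
Lemma bernoulli_ge r u : 1 <= r -> -1 < u -> 1 + r * u <= (1 + u) `^ r.
Proof.
move=> r1 u1; have u0 : 0 < 1 + u by lra.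
have := @bernoulli_ge_neg (1 - r) (- u / (1 + u)).
have -> : 1 + - u / (1 + u) = (1 + u)^-1 by field; lra.
move=> /(_ _ _)/wrap[].
  lra.
  by rewrite mulNr ltrNl opprK ltr_pdivrMr//; lra.
have -> : (1 + u)^-1 `^ (1 - r) = (1 + u) `^ (r - 1).
  rewrite -powR_inv1; last lra.
  by rewrite -powRrM; congr (_ `^ _); ring.
move=> h; rewrite -(@mulr_powRB1 _ _ r); [|lra..].
have := ler_wpM2l (ltW u0) h; apply: le_trans.
by rewrite le_eqVlt; apply/orP; left; apply/eqP; field; lra.
Qed.

(** One side is Bernoulli for the exponent [nu]; the other is Bernoulli for [nu - 1] multiplied by 1
    - v, which leaves an error |1 - nu| v^2 <= v^2. The two sides swap roles at [nu = 1]. *)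
Lemma powR1B_quad nu v : 0 <= nu <= 2 -> 0 <= v <= 1 ->
  `|(1 - v) `^ nu - 1 + nu * v| <= v ^+ 2.
Proof.
move=> /andP[n0 n2] /andP[v0 v1].
have [->|nn0] := eqVneq nu 0.
  by rewrite powRr0 subrr mul0r addr0 normr0 sqr_ge0.
move: v1; rewrite le_eqVlt => /predU1P[->|v1].
  by rewrite subrr powR0// ler_norml; apply/andP; split; lra.
have e : (1 - v) `^ nu = (1 - v) * (1 - v) `^ (nu - 1).
  by rewrite mulr_powRB1//; lra.
rewrite ler_norml; have [n1|n1] := leP nu 1.
- have := @bernoulli_ge_neg (nu - 1) (- v).
  have := @bernoulli_le nu (- v).
  move=> /(_ _ _)/wrap[]; [lra|lra|move=> h1].
  move=> /(_ _ _)/wrap[]; [lra|lra|move=> h2].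
  by apply/andP; split; [rewrite e; nra | nra].
- have := @bernoulli_le (nu - 1) (- v).
  have := @bernoulli_ge nu (- v).
  move=> /(_ _ _)/wrap[]; [lra|lra|move=> h1].
  move=> /(_ _ _)/wrap[]; [lra|lra|move=> h2].
  by apply/andP; split; [nra | rewrite e; nra].
Qed.

End powR_inequalities.

(** * Integrals over half-lines *)

Section power_integrals.
Context {R : realType}.
Let mu : {measure set _ -> \bar R} := @lebesgue_measure R.

Lemma continuous_powR_pt (p x : R) : 0 < x -> {for x, continuous (@powR R ^~ p)}.
Proof.
move=> x0; apply: differentiable_continuous; apply/derivable1_diffP.
by apply: derivable_powR; rewrite in_itv/= x0.
Qed.

Lemma powR_inv_ge0 (p x : R) : 0 <= x -> x^-1 `^ p = x `^ (- p).
Proof. by move=> x0; rewrite -powR_inv1// -powRrM mulN1r. Qed.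

Lemma integral_FTC_itv (f F : R -> R) (a b : R) : a < b ->
  (forall x, a <= x <= b -> is_derive x 1 F (f x)) ->
  (forall x, a <= x <= b -> {for x, continuous f}) ->
  (\int[mu]_(x in `[a, b]) (f x)%:E = (F b - F a)%:E)%E.
Proof.
move=> ab dF cf.
have cF x : a <= x <= b -> {for x, continuous F}.
  move=> xab; apply: differentiable_continuous; apply/derivable1_diffP.
  by have [] := dF x xab.
rewrite (@continuous_FTC2 _ _ F)//.
- apply/continuous_within_itvP => //; split.
  + by move=> x /itvP xi; apply: cf; rewrite !xi.
  + by apply: cvg_at_right_filter; apply: cf; rewrite lexx ltW.
  + by apply: cvg_at_left_filter; apply: cf; rewrite lexx ltW.
- split.
  + by move=> x /itvP xi; have [] := dF x; rewrite ?xi.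
  + by apply: cvg_at_right_filter; apply: cF; rewrite lexx ltW.
  + by apply: cvg_at_left_filter; apply: cF; rewrite lexx ltW.
- move=> x /itvP xi; rewrite derive1E.
  by have [|_ ->] := dF x; rewrite ?xi.
Qed.

Lemma cvgy_ln : (@ln R) x @[x --> +oo] --> +oo.
Proof.
apply/cvgryPge => A; near=> x; rewrite -[leLHS]expRK.
rewrite ler_ln ?posrE ?expR_gt0//; near: x; exact: nbhs_pinfty_ge.
Unshelve. all: end_near. Qed.

Lemma cvg_powR_neg (p : R) : p < 0 -> x `^ p @[x --> +oo] --> (0 : R).
Proof.
move=> p0.
apply: (@cvg_trans _ ((expR (- (ln x * - p))) @[x --> +oo])).
  apply: near_eq_cvg; near=> x; rewrite /powR gt_eqF//; congr expR; ring.
apply: (@cvg_comp _ _ _ (fun x : R => ln x * - p) (fun y => expR (- y)) _ (pinfty_nbhs R)).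
  by apply: gt0_cvgMly; [rewrite oppr_gt0|exact: cvgy_ln].
exact: cvgr_expR.
Unshelve. all: end_near. Qed.

Lemma is_derive_powR_prim (p x : R) : 0 < x -> p + 1 != 0 ->
  is_derive x 1 (fun t => t `^ (p + 1) / (p + 1)) (x `^ p).
Proof.
move=> x0 p1.
rewrite (_ : (fun t : R => _) = (p + 1)^-1 \*: (@powR R ^~ (p + 1))); last first.
  by apply/funext => t /=; rewrite mulrC.
have d := is_derive1_powR (p + 1) x0.
apply: is_derive_eq.
by rewrite addrK /GRing.scale/= mulrA mulVf// mul1r.
Qed.

Lemma integral_powR_itv (p a b : R) : 0 < a < b -> p + 1 != 0 ->
  (\int[mu]_(x in `[a, b]) (x `^ p)%:E
    = (b `^ (p + 1) / (p + 1) - a `^ (p + 1) / (p + 1))%:E)%E.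
Proof.
move=> /andP[a0 ab] p1.
apply: (@integral_FTC_itv _ (fun t => t `^ (p + 1) / (p + 1)) _ _ ab).
- by move=> x /andP[ax _]; apply: is_derive_powR_prim => //; exact: lt_le_trans ax.
- by move=> x /andP[ax _]; apply: continuous_powR_pt; exact: lt_le_trans ax.
Qed.

Lemma integral_powR_y (p a : R) : 0 < a -> p < -1 ->
  (\int[mu]_(x in `[a, +oo[) (x `^ p)%:E = (a `^ (p + 1) / - (p + 1))%:E)%E.
Proof.
move=> a0 p1.
have p10 : p + 1 != 0 by apply/eqP; lra.
rewrite (@ge0_continuous_FTC2y _ _ (fun t => t `^ (p + 1) / (p + 1)) a 0).
- by rewrite sub0e -EFinN; congr EFin; rewrite invrN mulrN.
- by move=> x _; exact: powR_ge0.
- apply/continuous_within_itvcyP; split.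
  + move=> x; rewrite in_itv/= andbT => ax; apply: continuous_powR_pt; exact: lt_trans ax.
  + by apply: cvg_at_right_filter; exact: continuous_powR_pt.
- rewrite -[X in _ --> X](mul0r (p + 1)^-1).
  by apply: cvgMl; apply: cvg_powR_neg; lra.
- by move=> x ax; have [] := is_derive_powR_prim (lt_trans a0 ax) p10.
- apply: cvg_at_right_filter; apply: cvgMl; exact: continuous_powR_pt.
- move=> x; rewrite in_itv/= andbT => ax; rewrite derive1E.
  by have [_ ->] := is_derive_powR_prim (lt_trans a0 ax) p10.
Qed.

Lemma bigcup_itv_0c (a : R) : 0 < a ->
  \bigcup_n `[a / n.+2%:R, a]%classic = `]0, a]%classic.
Proof.
move=> a0; apply/seteqP; split => x.
  move=> [n _] /=; rewrite !in_itv/= => /andP[h ->]; rewrite andbT.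
  by apply: lt_le_trans h; rewrite divr_gt0.
rewrite /= in_itv/= => /andP[x0 xa].
have [n hn] : exists n : nat, a / x < n.+2%:R.
  exists (Num.truncn (a / x)).
  have := truncnS_gt (a / x) => /lt_le_trans; apply.
  by rewrite ler_nat.
exists n => //=; rewrite in_itv/= xa andbT.
by rewrite ler_pdivrMr// mulrC -ler_pdivrMr// ltW.
Qed.

Lemma integral_powR_0 (p a : R) : 0 < a -> -1 < p ->
  (\int[mu]_(x in `]0%R, a]) (x `^ p)%:E = (a `^ (p + 1) / (p + 1))%:E)%E.
Proof.
move=> a0 p1.
have p10 : p + 1 != 0 by apply/eqP; lra.
(* The integrand may blow up at 0, so the fundamental theorem is used on compact pieces and monotone
   convergence does the rest. The shift [n.+2] keeps every left end strictly below [a]. *)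
pose F n := `[a / n.+2%:R, a]%classic.
rewrite -bigcup_itv_0c//.
have ndF : nondecreasing_seq F.
  apply/nondecreasing_seqP => n; apply/subsetPset => x; rewrite /F/=.
  rewrite !in_itv/= => /andP[h ->]; rewrite andbT; apply: le_trans h.
  by rewrite ler_pM2l// lef_pV2 ?posrE// ler_nat.
have h := @ge0_nondecreasing_set_cvg_integral _ (measurableTypeR R) _ F (fun x => (x `^ p)%:E) mu ndF.
have {h} := h _ _ _ => /(_ _ _ _)/wrap[].
- by move=> i; exact: measurable_itv.
- move=> i; apply/measurable_EFinP; apply: measurable_funTS; exact: measurable_powR.
- by move=> *; rewrite lee_fin powR_ge0.
move=> h.
have {}h2 : (\int[mu]_(x in F i) (x `^ p)%:E @[i --> \oo] -->
    (a `^ (p + 1) / (p + 1))%:E)%E.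
  apply: (@cvg_trans _ ((a `^ (p + 1) / (p + 1) - (a / n.+2%:R) `^ (p + 1) / (p + 1))%:E @[n --> \oo])).
    apply: near_eq_cvg; near=> n; rewrite integral_powR_itv//.
    by rewrite divr_gt0//= gtr_pMr// invf_lt1// ltr1n.
  apply: cvg_EFin; first by near=> n.
  rewrite -[X in _ --> X]subr0 -(mul0r (p + 1)^-1).
  apply: cvgB; first exact: cvg_cst.
  apply: cvgMl.
  apply: (@cvg_trans _ ((a `^ (p + 1) * (n.+2%:R `^ (- (p + 1)) )) @[n --> \oo])).
    apply: near_eq_cvg; near=> n.
    by rewrite powRM// ?invr_ge0// ?ltW// powR_inv_ge0.
  rewrite [X in _ `=>` nbhs X](_ : 0 = a `^ (p + 1) * 0); last by rewrite mulr0.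
  apply: cvgMr.
  apply: (@cvg_comp _ _ _ (fun n : nat => n.+2%:R : R) (fun y => y `^ (- (p + 1))) _ (pinfty_nbhs R)).
    apply/cvgryPge => A; near=> n.
    apply: (@le_trans _ _ n%:R); last by rewrite ler_nat -addn2 leq_addr.
    by near: n; exact: nbhs_infty_ger.
  by apply: cvg_powR_neg; lra.
exact: (cvg_unique _ h h2).
Unshelve. all: end_near. Qed.

Lemma bigcup_itv_0y (u v : nat -> R) : (forall n, 0 < u n) ->
  (forall x : R, 0 < x -> exists n, u n <= x <= v n) ->
  \bigcup_n `[u n, v n]%classic = `]0, +oo[%classic.
Proof.
move=> u0 uv; apply/seteqP; split => x.
  move=> [n _] /=; rewrite !in_itv/= => /andP[h _]; rewrite andbT.
  exact: lt_le_trans h.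
rewrite /= in_itv/= andbT => x0.
by have [n un] := uv x x0; exists n => //=; rewrite in_itv/=.
Qed.

Lemma nat_inv_le (x : R) : 0 < x -> exists n : nat, n.+1%:R^-1 <= x <= n.+1%:R.
Proof.
move=> x0; pose n := maxn (Num.truncn x) (Num.truncn x^-1).
exists n; apply/andP; split.
  rewrite -[leRHS]invrK lef_pV2 ?posrE ?invr_gt0//.
  by apply: le_trans (ltW (truncnS_gt _)) _; rewrite ler_nat ltnS leq_maxr.
by apply: le_trans (ltW (truncnS_gt _)) _; rewrite ler_nat ltnS leq_maxl.
Qed.

(** One substitution rule for two uses: [m = 0] is the scaling x -> k x, and [k = 1], [m = 2] is the
    cubing behind the tripling formula. It is transferred from compact intervals by exhaustion on
    both sides. *)
Lemma integral_subst_monomial (k : R) (m : nat) (G : R -> R) : 0 < k ->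
  (forall x : R, 0 < x -> {for x, continuous G}) -> (forall x : R, 0 < x -> 0 <= G x) ->
  (\int[mu]_(x in `]0%R, +oo[) (G x)%:E =
   \int[mu]_(x in `]0%R, +oo[) (G (k * x ^+ m.+1) * (k * m.+1%:R * x ^+ m))%:E)%E.
Proof.
move=> k0 cG G0.
pose F (x : R) := k * x ^+ m.+1.
pose f (x : R) := k * m.+1%:R * x ^+ m.
have dF (x : R) : is_derive x 1 F (f x).
  have -> : f x = k *: (m.+1%:R *: x ^+ m) by rewrite /f /GRing.scale/= mulrA.
  have d : is_derive x 1 (@GRing.exp R ^~ m.+1) (m.+1%:R *: x ^+ m).
    by apply: DeriveDef; [exact: exprn_derivable|rewrite exp_derive /= [_ *: 1]mulr1].
  exact: (is_deriveZ (f := @GRing.exp R ^~ m.+1)).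
have cf : continuous f.
  move=> x; apply: cvgM; first exact: cvg_cst.
  exact: exprn_continuous.
have F'E : (F^`())%classic = f by apply/funext => x; rewrite derive1E; have [] := dF x.
have cF : continuous F.
  move=> x; apply: differentiable_continuous; apply/derivable1_diffP.
  by have [] := dF x.
have F0 (x : R) : 0 < x -> 0 < F x by move=> x0; rewrite /F mulr_gt0// exprn_gt0.
have Fmono (x y : R) : 0 <= x -> x < y -> F x < F y.
  move=> x0 xy; rewrite /F ltr_pM2l// ltrXn2r//.
pose u n : R := n.+1%:R^-1.
pose v n : R := n.+1%:R.
have u0 n : 0 < u n by rewrite invr_gt0.
have uv n : u n <= v n.
  by rewrite /u /v; apply: (@le_trans _ _ 1); rewrite ?invf_le1 ?ler1n.
have uS n : u n.+1 <= u n by rewrite /u lef_pV2 ?posrE ?ler_nat.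
have vS n : v n <= v n.+1 by rewrite /v ler_nat.
have FW (x y : R) : 0 <= x -> x <= y -> F x <= F y.
  move=> x0; rewrite le_eqVlt => /predU1P[->//|xy]; exact/ltW/Fmono.
pose A n := `[F (u n), F (v n)]%classic.
pose B n := `[u n, v n]%classic.
have UB : \bigcup_n B n = `]0, +oo[%classic by apply: bigcup_itv_0y => // x x0; exact: nat_inv_le.
have UA : \bigcup_n A n = `]0, +oo[%classic.
  apply: bigcup_itv_0y => [n|x x0]; first exact/F0/u0.
  (* A point below 1 satisfies F y <= k y, and a point above 1 satisfies k z <= F z. Truncating x /
     k at 1 from above and from below thus gives points whose images enclose x, with no inverse of
     [F]. *)
  pose y := Num.min 1 (x / k); have y0 : 0 < y by rewrite lt_min ltr01 divr_gt0.
  pose z := Num.max 1 (x / k).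
  have [n /andP[n1 _]] := nat_inv_le y0.
  have zp : 0 < z by rewrite lt_max ltr01.
  have [n' /andP[_ n2]] := nat_inv_le zp.
  exists (maxn n n'); apply/andP; split.
    have h1 : u (maxn n n') <= y.
      by apply: le_trans n1; rewrite /u lef_pV2 ?posrE ?ler_nat// ltnS leq_maxl.
    apply: (le_trans (FW _ _ (ltW (u0 _)) h1)).
    rewrite /F exprS mulrCA.
    have : y * (k * y ^+ m) <= x / k * (k * 1).
      apply: ler_pM; rewrite ?(ltW y0)//; [|by rewrite ge_min lexx orbT|].
        by rewrite mulr_ge0 ?exprn_ge0 ?ltW.
      by rewrite ler_pM2l// exprn_ile1 ?(ltW y0)// ge_min lexx.
    by rewrite mulr1 divfK ?gt_eqF.
  have h2 : z <= v (maxn n n').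
    by apply: (le_trans n2); rewrite /v ler_nat ltnS leq_maxr.
  have z0 : 0 <= z by rewrite le_max ler01.
  apply: le_trans (FW _ _ z0 h2).
  have : x / k * (k * 1) <= z * (k * z ^+ m).
    apply: ler_pM; rewrite ?mulr1 ?(ltW k0) ?divr_ge0 ?(ltW x0) ?(ltW k0)//.
      by rewrite le_max lexx orbT.
    by rewrite -[leLHS]mulr1 ler_pM2l// exprn_ege1// le_max lexx.
  by rewrite mulr1 divfK ?gt_eqF// /F exprS mulrCA.
have mG : measurable_fun (`]0%R, +oo[%classic : set (measurableTypeR R)) G.
  apply: open_continuous_measurable_fun; first exact: interval_open.
  by move=> x; rewrite inE/= in_itv/= andbT => x0; exact: cG.
have hA := @ge0_nondecreasing_set_cvg_integral _ (measurableTypeR R) _ A (EFin \o G) mu.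
have hB := @ge0_nondecreasing_set_cvg_integral _ (measurableTypeR R) _ B
  (fun x => (G (F x) * f x)%:E) mu.
rewrite -{1}UA -UB.
have {}hA : (\int[mu]_(x in A n) (G x)%:E)%E @[n --> \oo] --> (\int[mu]_(x in \bigcup_n A n) (G x)%:E)%E.
  apply: hA.
  - apply/nondecreasing_seqP => n; apply/subsetPset => x; rewrite /A/=.
    rewrite !in_itv/= => /andP[h1 h2]; apply/andP; split.
      by apply: le_trans h1; apply: FW => //; exact: ltW.
    by apply: (le_trans h2); apply: FW => //; exact: ltW.
  - by move=> i; exact: measurable_itv.
  - move=> i; apply/measurable_EFinP; apply: measurable_funS mG; first exact: measurable_itv.
    by rewrite -UA; exact: bigcup_sup.
  - move=> i x; rewrite /A/= in_itv/= => /andP[h _]; rewrite lee_fin; apply: G0.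
    by apply: lt_le_trans h; exact: F0.
have {}hB : (\int[mu]_(x in B n) (G (F x) * f x)%:E)%E @[n --> \oo] --> (\int[mu]_(x in \bigcup_n B n) (G (F x) * f x)%:E)%E.
  apply: hB.
  - apply/nondecreasing_seqP => n; apply/subsetPset => x; rewrite /B/=.
    rewrite !in_itv/= => /andP[h1 h2]; apply/andP; split.
      exact: le_trans h1.
    exact: (le_trans h2).
  - by move=> i; exact: measurable_itv.
  - move=> i; apply/measurable_EFinP.
    apply: (@measurable_funS _ _ (measurableTypeR R) _ `]0%R, +oo[%classic).
    + exact: measurable_itv.
    + by rewrite -UB; exact: bigcup_sup.
    + apply: open_continuous_measurable_fun; first exact: interval_open.
      move=> x; rewrite inE/= in_itv/= andbT => x0.
      apply: cvgM; last exact: cf.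
      by apply: (@continuous_comp _ _ _ F G); [exact: cF|exact/cG/F0].
  - move=> i x; rewrite /B/= in_itv/= => /andP[h _]; rewrite lee_fin.
    have x0 := lt_le_trans (u0 i) h.
    by rewrite mulr_ge0 ?G0 ?F0// /f !mulr_ge0 ?exprn_ge0 ?ltW.
rewrite (_ : (fun n => _) = (fun n => (\int[mu]_(x in A n) (G x)%:E)%E)) in hB.
  exact: (cvg_unique _ hA hB).
apply/funext => n; rewrite /A /B.
rewrite (@integration_by_substitution_increasing _ F G (u n) (v n))//.
- by apply: eq_integral => x _; rewrite F'E.
- move=> x y; rewrite !in_itv/= => /andP[ux _] _; apply: Fmono.
  by apply: le_trans ux; exact: ltW.
- by move=> x _; rewrite F'E; exact: cf.
- by rewrite F'E; apply/cvg_ex; exists (f (u n)); apply: cvg_at_right_filter; exact: cf.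
- by rewrite F'E; apply/cvg_ex; exists (f (v n)); apply: cvg_at_left_filter; exact: cf.
- split.
  + by move=> x _; have [] := dF x.
  + by apply: cvg_at_right_filter; exact: cF.
  + by apply: cvg_at_left_filter; exact: cF.
- apply: continuous_in_subspaceT => x; rewrite inE/= in_itv/= => /andP[h _].
  by apply: cG; apply: lt_le_trans h; exact: F0.
Qed.

End power_integrals.

(** * Layer-cake formula with a density *)

Section tonelli_tail.
Context d (T : measurableType d) {R : realType} (m : {sigma_finite_measure set T -> \bar R}).
Let mu : {measure set _ -> \bar R} := @lebesgue_measure R.

(** Tonelli on the region 0 < t < g z. With Lebesgue measure it plays the part of integration by
    parts for J; with the law of one step of the chain it turns moments into tail integrals. *)
Lemma tonelli_tail (k g : T -> R) (w : R -> R) :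
  measurable_fun setT k -> measurable_fun setT g -> measurable_fun setT w ->
  (forall z, 0 <= k z) -> (forall t, 0 <= w t) ->
  (\int[m]_z ((k z)%:E * \int[mu]_(t in `]0%R, g z[) (w t)%:E) =
   \int[mu]_(t in `]0%R, +oo[) ((w t)%:E * \int[m]_(z in [set z | (t < g z)%R]) (k z)%:E))%E.
Proof.
move=> mk mg mw k0 w0.
pose GR := measurableTypeR R.
pose A : set (T * GR) := [set p | 0 < p.2 /\ p.2 < g p.1].
have mA : measurable A.
  pose f1 (p : T * GR) := (0 < p.2)%R.
  pose f2 (p : T * GR) := (p.2 < g p.1)%R.
  rewrite [X in measurable X](_ : _ = f1 @^-1` [set true] `&` f2 @^-1` [set true]); last first.
    by apply/seteqP; split => p.
  apply: measurableI.
  - have : measurable_fun setT f1 by exact: measurable_fun_ltr.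
    by move=> /(_ measurableT [set true]); rewrite setTI; exact.
  - have : measurable_fun setT f2.
      apply: measurable_fun_ltr => //; exact: measurableT_comp.
    by move=> /(_ measurableT [set true]); rewrite setTI; exact.
pose f (p : T * GR) := (k p.1 * w p.2 * \1_A p)%:E.
have f0 p : (0 <= f p)%E by rewrite lee_fin !mulr_ge0.
have mf : measurable_fun setT f.
  apply/measurable_EFinP; apply: measurable_funM => //.
  apply: measurable_funM; exact: measurableT_comp.
have := @fubini_tonelli _ _ T GR R m mu f mf f0.
have -> : (\int[m]_x \int[mu]_y f (x, y) = \int[m]_z ((k z)%:E * \int[mu]_(t in `]0%R, g z[) (w t)%:E))%E.
  apply: eq_integral => z _.
  rewrite -ge0_integralZl_EFin//; last 2 first.
    by move=> t _; rewrite lee_fin.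
    by apply/measurable_EFinP; exact: measurable_funTS.
  rewrite [RHS]integral_mkcond; apply: eq_integral => t _.
  rewrite /f patchE/= indicE.
  have -> : ((z, t) \in A) = (t \in `]0%R, g z[%classic).
    by apply/idP/idP; rewrite !inE /A/= in_itv/= => /andP.
  by case: ifPn => _; rewrite ?mulr1 ?mulr0 -?EFinM.
move=> ->.
rewrite [RHS]integral_mkcond; apply: eq_integral => t _.
rewrite patchE; case: ifPn => [|]; rewrite ?inE ?notin_setE/= in_itv/= andbT => t0.
  rewrite -ge0_integralZl_EFin//; last 3 first.
  - rewrite [X in measurable X](_ : _ = (fun z => t < g z) @^-1` [set true]); last first.
      by apply/seteqP; split.
    have : measurable_fun setT (fun z => t < g z) by exact: measurable_fun_ltr.
    by move=> /(_ measurableT [set true]); rewrite setTI; exact.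
  - by move=> z _; rewrite lee_fin.
  - by apply/measurable_EFinP; exact: measurable_funTS.
  rewrite [RHS]integral_mkcond; apply: eq_integral => z _.
  rewrite /f patchE/= indicE.
  have -> : ((z, t) \in A) = (z \in [set z | t < g z]).
    by apply/idP/idP; rewrite !inE /A/=; [case|].
  by case: ifPn => _; rewrite ?mulr1 ?mulr0 -?EFinM 1?mulrC.
apply: integral0_eq => z _; rewrite /f indicE memNset ?mulr0//=.
by move=> [].
Qed.

End tonelli_tail.

(** * The exponent function J *)

Section halfline_integrals.
Context {R : realType}.
Let mu : {measure set _ -> \bar R} := @lebesgue_measure R.

Lemma measurable_powRD (x p : R) : measurable_fun setT (fun t : R => (x + t) `^ p).
Proof.
apply: (@measurableT_comp _ _ _ _ _ _ (@powR R ^~ p)); first exact: measurable_powR.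
exact: measurable_funD.
Qed.

Lemma integral_FTC_oo (f F : R -> R) (a b : R) : a < b ->
  measurable_fun setT f ->
  (forall x, a <= x <= b -> is_derive x 1 F (f x)) ->
  (forall x, a <= x <= b -> {for x, continuous f}) ->
  (\int[mu]_(x in `]a, b[) (f x)%:E = (F b - F a)%:E)%E.
Proof.
move=> ab mf dF cf; rewrite -(integral_FTC_itv ab dF cf) [RHS]integral_itv_bndoo//.
by apply/measurable_EFinP; exact: measurable_funTS.
Qed.

Lemma integral_0y_split (f : R -> \bar R) (a : R) : 0 < a -> measurable_fun setT f ->
  (forall t, 0 <= f t)%E ->
  (\int[mu]_(t in `]0%R, +oo[) f t =
   \int[mu]_(t in `]0%R, a]) f t + \int[mu]_(t in `[a, +oo[) f t)%E.
Proof.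
move=> a0 mf f0.
rewrite -integral_itv_obnd_cbnd; last exact: measurable_funTS.
rewrite -ge0_integral_setU//=.
- congr (integral _ _ _); apply/seteqP; split => t /=; rewrite !in_itv/= !andbT.
    by move=> t0; have [ta|ta] := leP t a; [left; rewrite t0|right].
  by case=> [/andP[]//|]; exact: lt_trans.
- exact: measurable_funTS.
- apply/disj_setPS => t /=; rewrite !in_itv/= andbT => -[/andP[_ h1] h2].
  by move: (lt_le_trans h2 h1); rewrite ltxx.
Qed.

Lemma is_derive_powRD (x p t : R) : 0 < x + t ->
  is_derive t 1 (fun t => (x + t) `^ p) (p * (x + t) `^ (p - 1)).
Proof.
move=> xt.
have d := is_derive1_powR p xt.
have ds : is_derive t 1 (fun t => x + t) 1.
  by rewrite -[X in is_derive _ _ _ X]add0r; apply: (is_deriveD (f := cst x) (g := id)).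
rewrite -[X in is_derive _ _ _ X]mulr1; exact: (is_derive1_comp (f := @powR R ^~ p)).
Qed.

Lemma continuous_powRD (x p t : R) : 0 < x + t ->
  {for t, continuous (fun t => (x + t) `^ p)}.
Proof.
move=> xt; apply: differentiable_continuous; apply/derivable1_diffP.
by have [] := is_derive_powRD p xt.
Qed.

(** The difference has the sign of [p] for every u >= 0. Signed integrals can therefore be computed
    through absolute values and one global sign. *)
Lemma sgr_powR1D_sub1 (p u : R) : 0 <= u ->
  Num.sg p * ((1 + u) `^ p - 1) = `|(1 + u) `^ p - 1|.
Proof.
move=> u0; have u1 : 1 <= 1 + u by rewrite lerDl.
have [->|p0|p0] := sgrP p.
- by rewrite powRr0 subrr mulr0 normr0.
- rewrite mul1r ger0_norm// subr_ge0 -[leLHS](powRr0 (1 + u)).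
  by apply: ler_powR => //; exact: ltW.
- rewrite mulN1r ler0_norm// subr_le0 -[leRHS](powRr0 (1 + u)).
  by apply: ler_powR => //; exact: ltW.
Qed.

Lemma integral_powR1D (p u : R) : 0 <= u ->
  (\int[mu]_(t in `]0%R, u[) (`|p| * (1 + t) `^ (p - 1))%:E
    = (`|(1 + u) `^ p - 1|)%:E)%E.
Proof.
rewrite le_eqVlt => /predU1P[<-|u0].
  by rewrite set_itvoo0 integral_set0 addr0 powR1 subrr normr0.
rewrite -(sgr_powR1D_sub1 p (ltW u0)) mulrBr.
have -> : Num.sg p * 1 = Num.sg p * (1 + 0 : R) `^ p by rewrite addr0 powR1.
apply: (@integral_FTC_oo _ (fun t => Num.sg p * (1 + t) `^ p)) => //.
- apply: measurable_funM => //; exact: measurable_powRD.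
- move=> x /andP[x0 _].
  have x1 : 0 < 1 + x by rewrite ltr_pwDl.
  have d := is_derive_powRD p x1.
  have -> : `|p| * (1 + x) `^ (p - 1) = Num.sg p *: (p * (1 + x) `^ (p - 1)).
    by rewrite [RHS]mulrA normrEsg.
  exact: (@is_deriveZ _ _ _ (fun t : R => (1 + t) `^ p)).
- move=> x /andP[x0 _].
  have x1 : 0 < 1 + x by rewrite ltr_pwDl.
  by apply: cvgMr; exact: continuous_powRD.
Qed.

Variables (alpha : R).
Hypothesis alpha12 : 1 < alpha < 2.

(** The half-line form of the Beta integral B(2 - alpha, alpha - nu). *)
Definition betaI (nu : R) : \bar R :=
  (\int[mu]_(s in `]0%R, +oo[) ((1 + s) `^ (nu - 2) * s `^ (1 - alpha))%:E)%E.

Lemma measurable_betaI_integrand nu :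
  measurable_fun setT (fun s : R => ((1 + s) `^ (nu - 2) * s `^ (1 - alpha))).
Proof.
apply: measurable_funM; first exact: measurable_powRD.
exact: measurable_powR.
Qed.

Lemma betaI_ge0 nu : (0 <= betaI nu)%E.
Proof. by apply: integral_ge0 => s _; rewrite lee_fin mulr_ge0 ?powR_ge0. Qed.

Lemma le_powR_neg (p x y : R) : p <= 0 -> 0 < x -> x <= y -> y `^ p <= x `^ p.
Proof.
move=> p0 x0 xy; have y0 := lt_le_trans x0 xy.
rewrite !powR_expR_ln// ler_expR ler_wnM2l// ler_ln//.
Qed.

Lemma betaI_lty nu : nu < alpha -> (betaI nu < +oo)%E.
Proof.
move: alpha12 => /andP[al1 al2] nual.
rewrite /betaI (@integral_0y_split _ 1)//; last 2 first.
- by apply/measurable_EFinP; exact: measurable_betaI_integrand.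
- by move=> t; rewrite lee_fin mulr_ge0 ?powR_ge0.
apply: lte_add_pinfty.
  apply: (@le_lt_trans _ _ (\int[mu]_(x in `]0%R, 1%R]) (x `^ (1 - alpha))%:E)%E); last first.
    by rewrite integral_powR_0 ?ltry//; lra.
  apply: ge0_le_integral => //.
  - by move=> x _; rewrite lee_fin mulr_ge0 ?powR_ge0.
  - by apply/measurable_EFinP; apply: measurable_funTS; exact: measurable_betaI_integrand.
  - by apply/measurable_EFinP; apply: measurable_funTS; exact: measurable_powR.
  - move=> x; rewrite /= in_itv/= => /andP[x0 x1]; rewrite lee_fin ler_piMl ?powR_ge0//.
    apply: (@le_trans _ _ (1 `^ (nu - 2))); last by rewrite powR1.
    by apply: le_powR_neg; lra.
apply: (@le_lt_trans _ _ (\int[mu]_(x in `[1%R, +oo[) (x `^ (nu - 1 - alpha))%:E)%E); last first.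
  by rewrite integral_powR_y ?ltry//; lra.
apply: ge0_le_integral => //.
- by move=> x _; rewrite lee_fin mulr_ge0 ?powR_ge0.
- by apply/measurable_EFinP; apply: measurable_funTS; exact: measurable_betaI_integrand.
- by apply/measurable_EFinP; apply: measurable_funTS; exact: measurable_powR.
- move=> x; rewrite /= in_itv/= andbT => x1; rewrite lee_fin.
  have x0 : 0 < x by lra.
  have -> : nu - 1 - alpha = (nu - 2) + (1 - alpha) by ring.
  rewrite [leRHS]powRD_gt0// ler_wpM2r ?powR_ge0//.
  by apply: le_powR_neg; lra.
Qed.

(** The function J after integration by parts: (1 + u)^(nu - 1) - 1 is differentiated and u^(-
    alpha) integrated. [integral_betaJ] recovers the integral form. *)
Definition betaJ (nu : R) : R := (nu - 1) / (alpha - 1) * fine (betaI nu).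

Lemma betaIE nu : nu < alpha -> betaI nu = (fine (betaI nu))%:E.
Proof. by move=> na; rewrite fineK// ge0_fin_numE ?betaI_lty// betaI_ge0. Qed.

(** The integration by parts, done as an exchange of integrals: the difference is an integral over
    (0, u), and the tail of u^(- alpha) beyond t is t^(1 - alpha) / (alpha - 1). Absolute values
    keep everything nonnegative. *)
Lemma integral_norm_powR1D_sub1 nu : nu < alpha ->
  (\int[mu]_(u in `]0%R, +oo[) (`|(1 + u) `^ (nu - 1) - 1| * u `^ (- alpha))%:E
    = (`|betaJ nu|)%:E)%E.
Proof.
move: alpha12 => /andP[al1 al2] nual.
pose k (u : R) := if 0 < u then u `^ (- alpha) else 0.
have k0 u : 0 <= k u by rewrite /k; case: ifP => // _; exact: powR_ge0.
have mk : measurable_fun setT k.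
  apply: measurable_fun_ifT => //; exact: measurable_fun_ltr.
pose w (t : R) := `|nu - 1| * (1 + t) `^ (nu - 2).
have w0 t : 0 <= w t by rewrite mulr_ge0 ?powR_ge0.
have mw : measurable_fun setT w.
  by apply: measurable_funM => //; exact: measurable_powRD.
have := @tonelli_tail _ (measurableTypeR R) R (@lebesgue_measure R) k id w mk
  (@measurable_id _ _ _) mw k0 w0.
have -> : (\int[mu]_z ((k z)%:E * \int[mu]_(t in `]0%R, z[) (w t)%:E))%E =
  (\int[mu]_(u in `]0%R, +oo[) (`|(1 + u) `^ (nu - 1) - 1| * u `^ (- alpha))%:E)%E.
  rewrite [RHS]integral_mkcond; apply: eq_integral => u _.
  rewrite patchE; case: ifPn => [|]; rewrite ?inE ?notin_setE/= in_itv/= andbT.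
    move=> u0; rewrite /k u0 mulrC EFinM; congr (_ * _)%E.
    rewrite -(integral_powR1D (nu - 1) (ltW u0)).
    by apply: eq_integral => t _; rewrite /w; congr (_ * _ `^ _)%:E; ring.
  by move/negP/negbTE => u0; rewrite /k u0 mul0e.
move=> ->.
transitivity (\int[mu]_(t in `]0%R, +oo[)
   ((`|nu - 1| / (alpha - 1))%:E * ((1 + t) `^ (nu - 2) * t `^ (1 - alpha))%:E))%E.
  apply: eq_integral => t; rewrite inE/= in_itv/= andbT => t0.
  have -> : (\int[mu]_(z in [set z | (t < z)%R]) (k z)%:E = (t `^ (1 - alpha) / (alpha - 1))%:E)%E.
    rewrite (_ : [set z | t < z] = `]t, +oo[%classic); last by rewrite set_itvoy.
    rewrite integral_itv_obnd_cbnd; last by apply/measurable_EFinP; exact: measurable_funTS.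
    have -> : t `^ (1 - alpha) / (alpha - 1) = t `^ (- alpha + 1) / - (- alpha + 1).
      by congr (_ `^ _ / _); ring.
    rewrite -integral_powR_y//; last lra.
    apply: eq_integral => z; rewrite inE/= in_itv/= andbT => tz.
    by rewrite /k (lt_le_trans t0 tz).
  by rewrite -!EFinM /w; congr EFin; ring.
rewrite ge0_integralZl_EFin//; last 3 first.
- by move=> t _; rewrite lee_fin mulr_ge0 ?powR_ge0.
- by apply/measurable_EFinP; apply: measurable_funTS; exact: measurable_betaI_integrand.
- by rewrite divr_ge0//; lra.
rewrite -/(betaI nu) betaIE// -EFinM; congr EFin.
rewrite /betaJ !normrM normfV (ger0_norm (_ : 0 <= alpha - 1)); last lra.
by rewrite (ger0_norm (_ : 0 <= fine _))//; apply: fine_ge0; exact: betaI_ge0.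
Qed.

Lemma sgr_betaJ nu : nu < alpha -> Num.sg (nu - 1) * `|betaJ nu| = betaJ nu.
Proof.
move: alpha12 => /andP[al1 al2] nual.
rewrite /betaJ !normrM normfV (ger0_norm (_ : 0 <= alpha - 1)); last lra.
rewrite (ger0_norm (_ : 0 <= fine _)); last by apply: fine_ge0; exact: betaI_ge0.
by rewrite !mulrA -numEsg.
Qed.

End halfline_integrals.

(** * Monotonicity, continuity and range of J *)

Section betaJ_properties.
Context {R : realType} (alpha : R).
Hypothesis alpha12 : 1 < alpha < 2.
Let mu : {measure set _ -> \bar R} := @lebesgue_measure R.
Let f (nu u : R) : R := ((1 + u) `^ (nu - 1) - 1) * u `^ (- alpha).
Local Notation J := (betaJ alpha).

Let mf nu : measurable_fun setT (f nu).
Proof.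
apply: measurable_funM; last exact: measurable_powR.
by apply: measurable_funB => //; exact: measurable_powRD.
Qed.

Let normf nu : nu < alpha ->
  (\int[mu]_(u in `]0%R, +oo[) (`|f nu u|)%:E = (`|J nu|)%:E)%E.
Proof.
move=> na; rewrite -integral_norm_powR1D_sub1//.
by apply: eq_integral => u _; rewrite normrM (ger0_norm (powR_ge0 _ _)).
Qed.

Lemma betaJ_integrable nu : nu < alpha -> mu.-integrable `]0, +oo[ (EFin \o f nu).
Proof.
move=> na; apply/integrableP; split.
  by apply/measurable_EFinP; apply: measurable_funTS; exact: mf.
rewrite (_ : (\int[_]_(_ in _) _)%E = (`|J nu|)%:E) ?ltry//.
by rewrite -normf//; apply: eq_integral.
Qed.

Lemma integral_betaJ nu : nu < alpha ->
  (\int[mu]_(u in `]0%R, +oo[) (f nu u)%:E = (J nu)%:E)%E.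
Proof.
move=> na; rewrite -[in RHS]sgr_betaJ// EFinM -normf//.
rewrite -integralZl//; last first.
  by have := integrable_abse (betaJ_integrable na).
apply: eq_integral => u; rewrite inE/= in_itv/= andbT => u0.
rewrite -EFinM; congr EFin.
rewrite /f normrM (ger0_norm (powR_ge0 u _)) mulrA -(sgr_powR1D_sub1 _ (ltW u0)) mulrA.
have [->|n1] := eqVneq (nu - 1) 0; first by rewrite powRr0 subrr mulr0.
by rewrite -expr2 sqr_sg n1 mul1r.
Qed.

Lemma betaJ_lt nu nu' : nu' < nu -> nu < alpha -> J nu' < J nu.
Proof.
move=> n'n na; have n'a := lt_trans n'n na.
(* A lower bound on [1, 2] for the difference of the integrands, which is nonnegative everywhere.
   There 1 + u lies in [2, 3], so each factor is bounded separately; the interval has length 1. *)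
pose kap : R := 3 `^ (- `|nu' - 1|) * (2 `^ (nu - nu') - 1) * 2 `^ (- alpha).
have l2 : 0 < ln (2 : R) by rewrite ln_gt0// ltr1n.
have kap0 : 0 < kap.
  rewrite /kap !mulr_gt0 ?powR_gt0// subr_gt0 powR_expR_ln// -[ltLHS]expR0 ltr_expR.
  by rewrite mulr_gt0// subr_gt0.
have fE (u : R) : 0 < u -> f nu u - f nu' u
    = (1 + u) `^ (nu' - 1) * ((1 + u) `^ (nu - nu') - 1) * u `^ (- alpha).
  move=> u0; rewrite /f -mulrBl; congr (_ * _).
  have u1 : 0 < 1 + u by lra.
  rewrite mulrBr mulr1 -powRD_gt0//.
  have -> : nu' - 1 + (nu - nu') = nu - 1 by ring.
  ring.
have one_le (u : R) : 0 < u -> 1 <= (1 + u) `^ (nu - nu').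
  move=> u0; apply: (@le_trans _ _ ((1 + u) `^ 0)); first by rewrite powRr0.
  by apply: ler_powR; lra.
have fge0 (u : R) : 0 < u -> 0 <= f nu u - f nu' u.
  by move=> u0; rewrite fE// !mulr_ge0 ?powR_ge0// subr_ge0 one_le.
rewrite -subr_gt0; apply: (lt_le_trans kap0).
rewrite -lee_fin EFinB -!integral_betaJ// -integralB//; [|exact: betaJ_integrable..].
have m1 : measurable_fun setT (fun u => f nu u - f nu' u) by exact: measurable_funB.
apply: (@le_trans _ _ (\int[mu]_(u in `[1%R, 2%R]) (f nu u - f nu' u)%:E)%E); last first.
  apply: ge0_subset_integral => //.
  - by apply/measurable_EFinP; exact: measurable_funTS.
  - by move=> u; rewrite /= in_itv/= andbT => u0; rewrite lee_fin fge0.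
  - by move=> u; rewrite /= !in_itv/= andbT => /andP[u1 _]; lra.
have -> : kap%:E = (\int[mu]_(u in `[1%R, 2%R]) (cst kap%:E u))%E.
  rewrite integral_cst// [X in (_ * X)%E]lebesgue_measure_itv/= lte_fin ltr1n -EFinB -EFinM.
  by congr EFin; ring.
apply: ge0_le_integral => //.
- by move=> *; rewrite lee_fin ltW.
- by apply/measurable_EFinP; exact: measurable_funTS.
- move=> u; rewrite /= in_itv/= => /andP[u1 u2]; rewrite lee_fin fE; last lra.
  rewrite /kap; apply: ler_pM; rewrite ?powR_ge0//.
  + by rewrite mulr_ge0 ?powR_ge0// ltW// subr_gt0 powR_expR_ln// -[ltLHS]expR0 ltr_expR mulr_gt0// subr_gt0.
  + apply: ler_pM; rewrite ?powR_ge0//.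
    * by rewrite ltW// subr_gt0 powR_expR_ln// -[ltLHS]expR0 ltr_expR mulr_gt0// subr_gt0.
    * rewrite !powR_expR_ln; [|lra..]; rewrite ler_expR.
      have h1 : 0 <= ln (1 + u) by rewrite ln_ge0//; lra.
      have h2 : ln (1 + u) <= ln 3 by rewrite ler_ln ?posrE; lra.
      have h3 : - `|nu' - 1| <= nu' - 1 by rewrite lerNl -normrN ler_norm.
      have h4 := normr_ge0 (nu' - 1).
      nra.
    * rewrite lerB//; apply: ge0_ler_powR; rewrite ?nnegrE; lra.
  + by have a1 := alpha12; apply: le_powR_neg; lra.
Qed.

(** The integrand increases with the exponent, hence lies between its values at the ends of the
    interval, and the sum of their absolute values dominates. The left end -1 makes 0 an interior
    point. *)
Lemma betaJ_continuous (v : R) : v < alpha -> {in `](-1), v[, continuous J}.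
Proof.
move=> va.
pose g u := `|f (-1) u| + `|f v u|.
have vv (x : R) : x \in `](-1), v[ -> x < alpha by move=> /itvP xi; rewrite (lt_trans _ va) ?xi.
have ab (x u : R) : x \in `](-1), v[ -> 0 < u -> `|f x u| <= g u.
  move=> /[dup] xi /itvP xv u0.
  have a1 := alpha12; have mono (p r : R) : p <= r -> f p u <= f r u.
    move=> pr; rewrite /f ler_wpM2r ?powR_ge0// lerB//; apply: ler_powR; lra.
  have h1 : f (-1) u <= f x u by apply: mono; rewrite ltW ?xv.
  have h2 : f x u <= f v u by apply: mono; rewrite ltW ?xv.
  rewrite /g ler_norml; apply/andP; split.
    have := ler_norm (- f (-1) u); rewrite normrN; have := normr_ge0 (f v u); lra.
  have := ler_norm (f v u); have := normr_ge0 (f (-1) u); lra.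
have h := @continuity_under_integral R _ (measurableTypeR R) mu (fun x u => f x u)
  `]0, +oo[%classic (measurable_itv _) (-1) v _ _ g _ _.
have {}h : {in (`](-1), v[%classic : set R), continuous (fun l => \int[mu]_(x in `]0, +oo[) f l x)}.
  apply: h.
  - by move=> x xv; apply: betaJ_integrable; exact: vv.
  - apply: aeW => u; rewrite /= in_itv/= andbT => u0 x _.
    apply: cvgM; last exact: cvg_cst.
    apply: cvgB; last exact: cvg_cst.
    have c : {for x, continuous (fun y : R => expR ((y - 1) * ln (1 + u)))}.
      apply: continuous_comp; last exact: continuous_expR.
      apply: cvgM; last exact: cvg_cst.
      by apply: cvgB; [exact: cvg_id|exact: cvg_cst].
    have e (y : R) : (1 + u) `^ (y - 1) = expR ((y - 1) * ln (1 + u)).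
      by rewrite powR_expR_ln//; lra.
    by rewrite e; under eq_fun do rewrite e.
  - rewrite /g; apply: (@eq_integrable _ _ _ mu _ _ (fun u => (abse \o (EFin \o f (-1))) u + (abse \o (EFin \o f v)) u)%E) => //.
    have a1 := alpha12.
    apply: integrableD => //; apply: integrable_abse; apply: betaJ_integrable => //; lra.
  - move=> x xv; apply: aeW => u; rewrite /= in_itv/= andbT => u0; exact: ab.
move=> x xv.
have h1 := h x; rewrite inE/= in h1; have {}h1 := h1 xv.
have eJ (y : R) : y \in `](-1), v[ -> J y = \int[mu]_(x in `]0, +oo[) f y x.
  by move=> yv; rewrite /Rintegral integral_betaJ//; exact: vv.
rewrite /continuous_at (eJ x xv).
apply: cvg_trans h1; apply: near_eq_cvg; near=> y; apply/esym/eJ.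
near: y; exact: near_in_itvoo.
Unshelve. all: end_near. Qed.

(** For s >= 1 one has 1 + s <= 2 s, which costs a factor 2^(nu - 2) >= 1/4; the remaining power
    integral is 1 / (alpha - nu). This is the blow-up at [alpha]. *)
Lemma betaI_ge nu : 0 <= nu < alpha -> (((alpha - nu)^-1 / 4)%:E <= betaI alpha nu)%E.
Proof.
move=> /andP[n0 na]; have a1 := alpha12.
apply: (@le_trans _ _ (\int[mu]_(x in `[1%R, +oo[) (4^-1%:E * (x `^ (nu - 1 - alpha))%:E))%E); last first.
  apply: (@le_trans _ _ (\int[mu]_(s in `[1%R, +oo[) ((1 + s) `^ (nu - 2) * s `^ (1 - alpha))%:E)%E); last first.
    apply: ge0_subset_integral => //.
    - by apply/measurable_EFinP; apply: measurable_funTS; exact: measurable_betaI_integrand.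
    - by move=> u _; rewrite lee_fin mulr_ge0 ?powR_ge0.
    - by move=> u; rewrite /= !in_itv/= !andbT => u1; lra.
  apply: ge0_le_integral => //.
  - by move=> u _; rewrite -EFinM lee_fin mulr_ge0 ?powR_ge0// invr_ge0.
  - apply/measurable_EFinP; apply: measurable_funTS; apply: measurable_funM => //; exact: measurable_powR.
  - by apply/measurable_EFinP; apply: measurable_funTS; exact: measurable_betaI_integrand.
  - move=> x; rewrite /= in_itv/= andbT => x1; rewrite -EFinM lee_fin.
    have x0 : 0 < x by lra.
    have -> : nu - 1 - alpha = (nu - 2) + (1 - alpha) by ring.
    rewrite [x `^ (_ + _)]powRD_gt0// mulrA ler_wpM2r ?powR_ge0//.
    apply: (@le_trans _ _ ((2 * x) `^ (nu - 2))); last by apply: le_powR_neg; lra.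
    rewrite powRM; [|lra..]; rewrite ler_wpM2r ?powR_ge0//.
    have -> : 4^-1 = 2 `^ (- 2) :> R by rewrite powRN powR_mulrn//; congr (_^-1); ring.
    by apply: ler_powR; lra.
rewrite ge0_integralZl_EFin//; last 2 first.
  by move=> x _; rewrite lee_fin powR_ge0.
  by apply/measurable_EFinP; apply: measurable_funTS; exact: measurable_powR.
rewrite integral_powR_y//; last lra.
rewrite powR1 -EFinM lee_fin le_eqVlt; apply/orP; left; apply/eqP; field; lra.
Qed.

Lemma betaJ_surj (y : R) : J 0 < y -> exists2 nu, 0 < nu < alpha & J nu = y.
Proof.
move=> J0; have a1 := alpha12.
(* At v = alpha - dl the first bound makes (v - 1) / (alpha - 1) at least 1/2, and the second makes
   the Beta integral at least 2 (|y| + 1). Hence J v exceeds y. *)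
pose dl := Num.min ((alpha - 1) / 2) ((`|y| + 1)^-1 / 8).
have y1 : 0 < `|y| + 1 by rewrite ltr_wpDl.
have dl0 : 0 < dl by rewrite lt_min !divr_gt0 ?invr_gt0//; lra.
have dl1 : dl <= (alpha - 1) / 2 by rewrite ge_min lexx.
have dl2 : dl <= (`|y| + 1)^-1 / 8 by rewrite ge_min lexx orbT.
pose v := alpha - dl.
have va : v < alpha by rewrite /v; lra.
have v0 : 0 <= v by rewrite /v; lra.
have Jv : y < J v.
  have := @betaI_ge v; rewrite betaIE// lee_fin => /(_ _)/wrap[].
    by apply/andP; split => //; rewrite /v; lra.
  have -> : alpha - v = dl by rewrite /v; ring.
  move=> hI.
  have h1 : 2 * (`|y| + 1) <= dl^-1 / 4.
    rewrite ler_pdivlMr// -[leRHS]mul1r ler_pdivlMr//.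
    have : dl * (`|y| + 1) <= (`|y| + 1)^-1 / 8 * (`|y| + 1) by rewrite ler_wpM2r// ltW.
    rewrite mulrAC mulVf ?gt_eqF//; lra.
  have h2 : 2^-1 <= (v - 1) / (alpha - 1) by rewrite ler_pdivlMr /v; lra.
  rewrite /betaJ.
  have h3 : 2^-1 * (2 * (`|y| + 1)) <= (v - 1) / (alpha - 1) * fine (betaI alpha v).
    by apply: ler_pM => //; rewrite ?invr_ge0 ?mulr_ge0 ?(ltW y1)//; exact: le_trans hI.
  have := ler_norm y; lra.
have [w vw wa] : exists2 w, v < w & w < alpha by exists ((v + alpha) / 2); rewrite midf_lt.
have cJ : {within `[0, v], continuous J}.
  apply: continuous_in_subspaceT => x; rewrite inE/= in_itv/= => /andP[x0 xv].
  by apply: (betaJ_continuous wa); rewrite in_itv/= (lt_le_trans _ x0) ?ltrN10// (le_lt_trans xv).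
have [|nu] := @IVT R J 0 v y v0 cJ.
  by rewrite minEle maxEle (le_trans (ltW J0) (ltW Jv)) (ltW J0) (ltW Jv).
rewrite in_itv/= => /andP[n0 nv] Jnu; exists nu => //.
apply/andP; split; last exact: le_lt_trans va.
rewrite lt_neqAle n0 andbT; apply/eqP => n00; move: J0; rewrite n00 Jnu ltxx//.
Qed.

End betaJ_properties.

(** * The reflection formula *)

Section sine_estimates.
Context {R : realType}.
Implicit Types (x y s : R).

Lemma sin_le_id x : 0 <= x -> sin x <= x.
Proof.
rewrite le_eqVlt => /predU1P[<-|x0]; first by rewrite sin0.
have [|z _] := @MVT R (@sin R) (@cos R) 0 x x0.
  by apply: continuous_subspaceT => z; exact: continuous_sin.
rewrite sin0 !subr0 => ->; rewrite ler_piMl ?(ltW x0)//; exact: cos_le1.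
Qed.

Lemma cos_ge_quad x : 0 <= x -> 1 - x ^+ 2 / 2 <= cos x.
Proof.
move=> x0; have -> : cos x = 1 - 2 * sin (x / 2) ^+ 2.
  have {1}-> : x = (x / 2) *+ 2 by rewrite mulr2n; field.
  by rewrite cos_mulr2n cos2sin2; ring.
have x20 : 0 <= x / 2 by rewrite divr_ge0.
have h := sin_le_id x20.
have : sin (x / 2) ^+ 2 <= (x / 2) ^+ 2.
  have [s0|s0] := leP 0 (sin (x / 2)); first by rewrite ler_sqr.
  have [x1|x1] := leP (x / 2) 1.
    have : 0 <= sin (x / 2).
      have [->|xn0] := eqVneq (x / 2) 0; first by rewrite sin0.
      apply/ltW/sin2_gt0; apply/andP; split; last lra.
      by rewrite lt_neqAle eq_sym xn0.
    lra.
  have := sin_geN1 (x / 2) => s1.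
  by rewrite -[sin (x / 2) ^+ 2]sqrrN ler_sqr ?nnegrE; lra.
have -> : (x / 2) ^+ 2 = x ^+ 2 / 4 by field.
lra.
Qed.

Lemma sin_ge_cubic x : 0 <= x -> x * (1 - x ^+ 2 / 2) <= sin x.
Proof.
rewrite le_eqVlt => /predU1P[<-|x0]; first by rewrite sin0 mul0r.
have [|z zx] := @MVT R (@sin R) (@cos R) 0 x x0.
  by apply: continuous_subspaceT => z; exact: continuous_sin.
rewrite sin0 !subr0 => ->; rewrite mulrC; apply: ler_wpM2r; first exact: ltW.
move: zx; rewrite in_itv/= => /andP[z0 zx].
apply: le_trans (cos_ge_quad (ltW z0)).
rewrite lerD2l lerN2 ler_pM2r ?invr_gt0//.
by rewrite ler_sqr ?nnegrE; lra.
Qed.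

Lemma inv_sin_bounds x : 0 < x <= 1 -> 0 <= (sin x)^-1 - x^-1 <= x.
Proof.
move=> /andP[x0 x1].
have h1 := sin_le_id (ltW x0); have h2 := sin_ge_cubic (ltW x0).
have h3 : x / 2 <= sin x.
  apply: le_trans h2; rewrite ler_pM2l//.
  by have : x ^+ 2 <= 1 := exprn_ile1 _ (ltW x0) x1; lra.
have s0 : 0 < sin x by lra.
have -> : (sin x)^-1 - x^-1 = (x - sin x) / (x * sin x) by field; rewrite !gt_eqF.
apply/andP; split; first by rewrite divr_ge0 ?subr_ge0// mulr_ge0 ?ltW.
rewrite ler_pdivrMr ?mulr_gt0//.
have : x * (x / 2) <= x * sin x by rewrite ler_pM2l.
nra.
Qed.

Definition csc_pi s : R := pi / sin (pi * s).

Lemma csc_pi_sym s : csc_pi (1 - s) = csc_pi s.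
Proof.
rewrite /csc_pi; have -> : pi * (1 - s) = - (pi * s) + pi by ring.
by rewrite sinDpi sinN opprK.
Qed.

Lemma csc_pi_near0 s : 0 < s -> pi * s <= 1 -> `|csc_pi s - s^-1| <= pi ^+ 2 * s.
Proof.
move=> s0 ps; have p0 : 0 < pi :> R by exact: pi_gt0.
have ps0 : 0 < pi * s by rewrite mulr_gt0.
have := @inv_sin_bounds (pi * s); rewrite ps0 ps => /(_ isT) /andP[h1 h2].
have -> : csc_pi s - s^-1 = pi * ((sin (pi * s))^-1 - (pi * s)^-1).
  by rewrite /csc_pi mulrBr invfM mulrA mulfV ?gt_eqF// mul1r.
by rewrite normrM (gtr0_norm p0) ger0_norm// expr2 -mulrA ler_pM2l.
Qed.

(** The symmetry s -> 1 - s reduces to s <= 1/2, where only the pole at 0 matters. If pi s > 1, then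
    sin (pi s) >= sin 1 >= 1/2 and all three terms are bounded. The constant is crude; only
    boundedness is used. *)
Lemma csc_pi_bounded s : 0 < s < 1 ->
  `|csc_pi s - s^-1 - (1 - s)^-1| <= 3 * pi + 2.
Proof.
wlog s12 : s / s <= 1 / 2.
  move=> H /andP[s0 s1]; have [h|h] := leP s (1 / 2); first by apply: H; rewrite ?s0.
  have := H (1 - s); rewrite csc_pi_sym opprB addrCA subrr addr0.
  have -> : csc_pi s - (1 - s)^-1 - s^-1 = csc_pi s - s^-1 - (1 - s)^-1 by ring.
  by apply; [lra|rewrite subr_gt0 s1/=; lra].
move=> /andP[s0 s1]; have p0 : 0 < pi :> R by exact: pi_gt0.
have p2 : 2 <= pi :> R by exact: pi_ge2.
have i1 : 0 <= (1 - s)^-1 <= 2.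
  by rewrite invr_ge0 subr_ge0 ltW//= -[leRHS]invrK lef_pV2 ?posrE ?invr_gt0//; lra.
have [ps|ps] := leP (pi * s) 1.
  have h := csc_pi_near0 s0 ps.
  have : pi ^+ 2 * s <= pi by rewrite expr2 -mulrA -[leRHS]mulr1 ler_pM2l.
  move=> h2; apply: (le_trans (ler_normB _ _)).
  by rewrite (ger0_norm (_ : 0 <= (1 - s)^-1)); lra.
have i2 : 0 < s^-1 <= pi.
  by rewrite invr_gt0 s0/= -[leLHS]mul1r ler_pdivrMr// ltW.
have sh : 1 / 2 <= sin (pi * s).
  have h := @sin_ge_cubic 1 ler01.
  have {}h : 1 / 2 <= sin (1 : R) by rewrite expr1n in h; lra.
  apply: (le_trans h).
  have := @ltr_sin R 1 (pi * s); rewrite !in_itv/= => h2; apply: ltW; rewrite h2 //.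
  - have := @pihalf_ge1 R; lra.
  - apply/andP; split; first lra.
    by apply: ler_wpM2l; [exact: ltW|lra].
have i3 : 0 <= csc_pi s <= 2 * pi.
  rewrite /csc_pi; apply/andP; split; first by rewrite divr_ge0//; lra.
  rewrite ler_pdivrMr; last lra.
  by nra.
rewrite ler_norml; lra.
Qed.

(** Doubling the angle gives 2 c^2 - 1 = - c, that is (2 c - 1) (c + 1) = 0, and c > 0. *)
Lemma cos_pi3 : cos (pi / 3) = 1 / 2 :> R.
Proof.
have p0 : 0 < pi :> R by exact: pi_gt0.
pose c := cos (pi / 3) : R.
have c0 : 0 < c by apply: cos_gt0_pihalf; apply/andP; split; lra.
have h : cos ((pi / 3) *+ 2) = - c.
  have -> : (pi / 3) *+ 2 = - (pi / 3) + pi :> R by rewrite mulr2n; field.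
  by rewrite cosDpi cosN.
move: h; rewrite cos_mulr2n -/c => h.
have : (2 * c - 1) * (c + 1) = 0 by rewrite -mulr_natr in h; lra.
move=> /eqP; rewrite mulf_eq0 => /orP[/eqP h2|/eqP h2]; rewrite -/c; lra.
Qed.

(** With y = pi s / 3, this is the factorisation sin 3y = 4 sin y sin (pi/3 - y) sin (pi/3 + y)
    after clearing denominators. *)
Lemma csc_pi_triple s : 0 < s < 1 ->
  csc_pi (s / 3) + csc_pi ((s + 2) / 3) = 3 * csc_pi s + csc_pi ((s + 1) / 3).
Proof.
move=> /andP[s0 s1]; have p0 : 0 < pi :> R by exact: pi_gt0.
rewrite /csc_pi; pose y := pi * (s / 3).
have -> : pi * ((s + 2) / 3) = (y - pi / 3) + pi by rewrite /y; field.
have -> : pi * ((s + 1) / 3) = y + pi / 3 by rewrite /y; field.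
have -> : pi * s = y *+ 2 + y by rewrite mulr2n /y; field.
rewrite -/y sinDpi (sinB y (pi / 3)) (sinD y (pi / 3)) (sinD (y *+ 2) y) cos_mulr2n sin_mulr2n cos_pi3.
have y0 : 0 < y by rewrite mulr_gt0// divr_gt0.
have yp : y < pi / 3.
  by rewrite /y ltr_pM2l//; lra.
pose a := sin y; pose b := cos y; pose t := sin (pi / 3) : R.
have ab : b ^+ 2 = 1 - a ^+ 2 by exact: cos2sin2.
have t2 : t ^+ 2 = 3 / 4 by rewrite /t sin2cos2 cos_pi3; field.
have a0 : 0 < a by apply: sin_gt0_pi; lra.
have t0 : 0 < t by apply: sin_gt0_pi; lra.
have b0 : 0 < b by apply: cos_gt0_pihalf; lra.
have at3 : a < t.
  by rewrite /a /t ltr_sin// in_itv/=; lra.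
have r0 : 0 < 3 / 4 - a ^+ 2.
  have : a ^+ 2 < t ^+ 2 by rewrite ltr_sqr ?nnegrE ?ltW.
  by lra.
rewrite -/a -/b -/t.
have q0 : 0 < a * (1 / 2) + b * t by rewrite addr_gt0 ?mulr_gt0// ?divr_gt0.
have qr : (a * (1 / 2) + b * t) * (b * t - a * (1 / 2)) = 3 / 4 - a ^+ 2.
  have -> : (a * (1 / 2) + b * t) * (b * t - a * (1 / 2)) = b ^+ 2 * t ^+ 2 - a ^+ 2 / 4 by field.
  by rewrite ab t2; field.
have rr0 : 0 < b * t - a * (1 / 2) by move: r0; rewrite -qr pmulr_rgt0.
have e3 : b * a *+ 2 * b + (b ^+ 2 *+ 2 - 1) * a = 4 * a * (3 / 4 - a ^+ 2).
  have -> : b * a *+ 2 * b + (b ^+ 2 *+ 2 - 1) * a = (4 * b ^+ 2 - 1) * a.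
    by rewrite !mulr2n; ring.
  by rewrite ab; field.
rewrite e3 -qr.
have -> : - (a * (1 / 2) - b * t) = b * t - a * (1 / 2) by ring.
apply/eqP; rewrite -subr_eq0; apply/eqP.
(* Here q = sin (pi/3 + y) and r = sin (pi/3 - y), so q - r = a and q r = 3/4 - a^2. These two
   relations make the numerator 4 q r + 4 a (q - r) - 3 vanish. *)
set q := a * (1 / 2) + b * t in q0 qr *; set r := b * t - a * (1 / 2) in rr0 qr *.
have qra : q - r = a by rewrite /q /r; field.
have -> : pi / a + pi / r - (3 * (pi / (4 * a * (q * r))) + pi / q)
  = pi * (4 * q * r + 4 * a * (q - r) - 3) / (4 * a * (q * r)).
  by field; rewrite !gt_eqF.
have -> : 4 * q * r + 4 * a * (q - r) - 3 = 0.
  by rewrite qra -[4 * q * r]mulrA qr; field.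
by rewrite mulr0 mul0r.
Qed.

End sine_estimates.

(** * The Mellin transform of 1 / (1 + u) and Herglotz' trick *)

Section reflection.
Context {R : realType}.
Implicit Types (D : set R) (p s u : R).
Let mu : {measure set _ -> \bar R} := @lebesgue_measure R.

(** The Mellin integrand of 1 / (1 + u), restricted to [D]. The exponent is spelled [1 - 2] so that
    the integral over the half-line is literally [betaI] at exponent 1, whose finiteness is
    reused. *)
Definition mellin D p : \bar R :=
  (\int[mu]_(u in D) ((1 + u) `^ (1 - 2) * u `^ p)%:E)%E.

Arguments mellin D%_classic p%_R.

Lemma measurable_mellin D p :
  measurable_fun D (fun u : R => ((1 + u) `^ (1 - 2) * u `^ p)%:E).
Proof.
apply/measurable_EFinP; apply: measurable_funTS.
by apply: measurable_funM; [exact: measurable_powRD|exact: measurable_powR].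
Qed.

Lemma mellin_ge0 D p : (0 <= mellin D p)%E.
Proof. by apply: integral_ge0 => s _; rewrite lee_fin mulr_ge0 ?powR_ge0. Qed.

Lemma powR1D_inv u : 0 <= u -> (1 + u) `^ (1 - 2) = (1 + u)^-1.
Proof. by move=> u0; rewrite (_ : 1 - 2 = -1); [rewrite powR_inv1//; lra|lra]. Qed.

(** The factor 1 / (1 + u) cancels against u^p + u^(p + 1). The elementary integral left on the
    right carries the poles. *)
Lemma mellin_shift D p : measurable D -> D `<=` [set u | 0 < u] ->
  (mellin D p + mellin D (p + 1) = \int[mu]_(u in D) (u `^ p)%:E)%E.
Proof.
move=> mD D0; rewrite -ge0_integralD//; last 4 first.
- by move=> u _; rewrite lee_fin mulr_ge0 ?powR_ge0.
- exact: measurable_mellin.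
- by move=> u _; rewrite lee_fin mulr_ge0 ?powR_ge0.
- exact: measurable_mellin.
apply: eq_integral => u; rewrite inE => /D0/= u0; rewrite -EFinD; congr EFin.
rewrite powR1D_inv ?ltW// powRD_gt0// powRr1 ?ltW//.
by field; rewrite gt_eqF//; lra.
Qed.

Lemma mellin_01_shift p : -1 < p ->
  (mellin `]0%R, 1%R] p + mellin `]0%R, 1%R] (p + 1) = ((p + 1)^-1)%:E)%E.
Proof.
move=> p1; rewrite mellin_shift//; last by move=> u; rewrite /= in_itv/= => /andP[].
by rewrite integral_powR_0// powR1 div1r.
Qed.

Lemma mellin_1y_shift p : p < -1 ->
  (mellin `[1%R, +oo[ p + mellin `[1%R, +oo[ (p + 1) = ((- (p + 1))^-1)%:E)%E.
Proof.
move=> p1; rewrite mellin_shift//; last first.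
  by move=> u; rewrite /= in_itv/= andbT; exact: lt_le_trans.
by rewrite integral_powR_y// powR1 div1r.
Qed.

Lemma mellin_01_anti p s : p <= s -> (mellin `]0%R, 1%R] s <= mellin `]0%R, 1%R] p)%E.
Proof.
move=> ps; apply: ge0_le_integral => //.
- by move=> u _; rewrite lee_fin mulr_ge0 ?powR_ge0.
- exact: measurable_mellin.
- exact: measurable_mellin.
- move=> u; rewrite /= in_itv/= => /andP[u0 u1]; rewrite lee_fin ler_wpM2l ?powR_ge0//.
  by rewrite !powR_expR_ln// ler_expR ler_wnM2r// ln_le0.
Qed.

Lemma mellin_1y_mono p s : p <= s -> (mellin `[1%R, +oo[ p <= mellin `[1%R, +oo[ s)%E.
Proof.
move=> ps; apply: ge0_le_integral => //.
- by move=> u _; rewrite lee_fin mulr_ge0 ?powR_ge0.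
- exact: measurable_mellin.
- exact: measurable_mellin.
- move=> u; rewrite /= in_itv/= andbT => u1; rewrite lee_fin ler_wpM2l ?powR_ge0//.
  by rewrite ler_powR.
Qed.

Lemma is_derive_lnD (x t : R) : 0 < x + t ->
  is_derive t 1 (fun t => ln (x + t)) (x + t)^-1.
Proof.
move=> xt; have d := is_derive1_ln xt.
have ds : is_derive t 1 (fun t => x + t) 1.
  by rewrite -[X in is_derive _ _ _ X]add0r; apply: (is_deriveD (f := cst x) (g := id)).
by rewrite -[X in is_derive _ _ _ X]mulr1; exact: (is_derive1_comp (f := @ln R)).
Qed.

Lemma continuous_inv1D (x : R) : 0 < 1 + x -> {for x, continuous (fun u : R => (1 + u)^-1)}.
Proof.
move=> x0; apply: (@cvgV _ _ _ _ (fun u : R => 1 + u)); first by rewrite gt_eqF.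
by apply: cvgD; [exact: cvg_cst|exact: cvg_id].
Qed.

Lemma mellin_01_0 : mellin `]0%R, 1%R] 0 = (ln 2)%:E.
Proof.
rewrite /mellin integral_itv_obnd_cbnd; last exact: measurable_mellin.
transitivity (\int[mu]_(u in `[0%R, 1%R]) ((1 + u)^-1)%:E)%E.
  apply: eq_integral => u; rewrite inE/= in_itv/= => /andP[u0 _].
  by rewrite powRr0 mulr1 powR1D_inv.
rewrite (_ : ln 2 = ln (1 + 1) - ln (1 + 0)); last by rewrite addr0 ln1 subr0.
apply: (@integral_FTC_itv _ (fun u : R => (1 + u)^-1) (fun u : R => ln (1 + u)) 0 1 ltr01).
- by move=> x /andP[x0 _]; apply: is_derive_lnD; lra.
- by move=> x /andP[x0 _]; apply: continuous_inv1D; lra.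
Qed.

Lemma mellin_1y_m1 : mellin `[1%R, +oo[ (-1) = (ln 2)%:E.
Proof.
transitivity (\int[mu]_(u in `[1%R, +oo[) (u^-1 - (1 + u)^-1)%:E)%E.
  apply: eq_integral => u; rewrite inE/= in_itv/= andbT => u1.
  rewrite powR_inv1 ?powR1D_inv; [|lra|lra]; congr EFin; field.
  by rewrite !gt_eqF//; lra.
have cl (x : R) : 1 <= x -> {for x, continuous (fun u : R => ln u - ln (1 + u))}.
  move=> x1; apply: cvgB; first by apply: continuous_ln; lra.
  apply: (@continuous_comp _ _ _ (fun u : R => 1 + u) (@ln R)).
    by apply: cvgD; [exact: cvg_cst|exact: cvg_id].
  by apply: continuous_ln; lra.
have ci (x : R) : 1 <= x -> {for x, continuous (fun u : R => u^-1 - (1 + u)^-1)}.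
  move=> x1; apply: cvgB; last by apply: continuous_inv1D; lra.
  by apply: cvgV; [rewrite gt_eqF//; lra|exact: cvg_id].
have dl (x : R) : 1 <= x -> is_derive x 1 (fun u : R => ln u - ln (1 + u)) (x^-1 - (1 + x)^-1).
  move=> x1; apply: is_deriveB; first by apply: is_derive1_ln; lra.
  by apply: is_derive_lnD; lra.
rewrite (@ge0_continuous_FTC2y _ _ (fun u : R => ln u - ln (1 + u)) 1 0).
- by rewrite ln1 sub0r sub0e -EFinN opprK.
- move=> x x1; rewrite subr_ge0 lef_pV2 ?posrE; lra.
- apply/continuous_within_itvcyP; split.
  + by move=> x; rewrite in_itv/= andbT => /ltW; exact: ci.
  + by apply: cvg_at_right_filter; exact: ci.
- apply: (@cvg_trans _ (- ln (1 + x^-1) @[x --> +oo])).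
    apply: near_eq_cvg; near=> x.
    have x0 : 0 < x by near: x; exact: nbhs_pinfty_gt.
    have -> : 1 + x = x * (1 + x^-1) by field; rewrite gt_eqF.
    rewrite lnM ?posrE//; first by rewrite opprD addNKr.
    by rewrite addr_gt0// invr_gt0.
  rewrite [X in _ `=>` nbhs X](_ : 0 = - ln (1 + 0)); last by rewrite addr0 ln1 oppr0.
  apply: cvgN.
  apply: (@cvg_comp _ _ _ (fun x : R => 1 + x^-1) (@ln R) _ (nbhs (1 + 0 : R))).
    apply: cvgD; first exact: cvg_cst.
    apply: (@cvg_trans _ (x `^ (-1) @[x --> +oo])); last by apply: cvg_powR_neg; lra.
    apply: near_eq_cvg; near=> x.
    have x0 : 0 <= x by near: x; exact: nbhs_pinfty_ge.
    by rewrite powR_inv1.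
  by rewrite addr0; apply: continuous_ln.
- by move=> x x1; have [] := dl x (ltW x1).
- by apply: cvg_at_right_filter; exact: cl.
- move=> x; rewrite in_itv/= andbT => x1; rewrite derive1E.
  by have [_ ->] := dl x (ltW x1).
Unshelve. all: end_near. Qed.

Definition mellinF s : R := fine (mellin `]0%R, +oo[ (s - 1)).

Lemma mellin_fin s : 0 < s < 1 -> mellin `]0%R, +oo[ (s - 1) = (mellinF s)%:E.
Proof.
move=> /andP[s0 s1]; rewrite fineK// ge0_fin_numE ?mellin_ge0//.
have al12 : 1 < 2 - s < 2 by lra.
have := @betaI_lty _ _ al12 1; rewrite /betaI -/mu /mellin.
have -> : 1 - (2 - s) = s - 1 by ring.
by apply; lra.
Qed.

(* Both error terms are controlled by monotonicity alone, since the halves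
   over ]0,1] and [1,+oo[ tend to the same limit ln 2. *)
Lemma mellinF_bounds s : 0 < s < 1 ->
  0 <= mellinF s - s^-1 <= s + s / (1 - s) /\
  `|mellinF s - s^-1 - (1 - s)^-1| <= 2.
Proof.
move=> s01; have /andP[s0 s1] := s01.
have e0 : (mellin `]0%R, +oo[ (s - 1) = mellin `]0%R, 1%R] (s - 1) + mellin `[1%R, +oo[ (s - 1))%E.
  rewrite /mellin (@integral_0y_split _ _ 1)//; first exact: measurable_mellin.
  by move=> t; rewrite lee_fin mulr_ge0 ?powR_ge0.
rewrite mellin_fin// in e0.
have e1 : (mellin `]0%R, 1%R] (s - 1) + mellin `]0%R, 1%R] s = (s^-1)%:E)%E.
  by have := @mellin_01_shift (s - 1); rewrite subrK; apply; lra.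
have e2 : (mellin `]0%R, 1%R] s + mellin `]0%R, 1%R] (s + 1) = ((s + 1)^-1)%:E)%E.
  by apply: mellin_01_shift; lra.
have e3 : (mellin `]0%R, 1%R] 0 + mellin `]0%R, 1%R] 1 = 1%:E)%E.
  by have := @mellin_01_shift 0; rewrite add0r invr1; apply; lra.
have e4 : (mellin `[1%R, +oo[ (s - 2) + mellin `[1%R, +oo[ (s - 1) = ((1 - s)^-1)%:E)%E.
  have := @mellin_1y_shift (s - 2).
  have -> : s - 2 + 1 = s - 1 by ring.
  by rewrite opprB; apply; lra.
have e5 : (mellin `[1%R, +oo[ (-2) + mellin `[1%R, +oo[ (-1) = 1%:E)%E.
  have := @mellin_1y_shift (-2).
  have -> : -2 + 1 = -1 :> R by ring.
  by rewrite opprK invr1; apply; lra.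
rewrite mellin_01_0 in e3; rewrite mellin_1y_m1 in e5.
have i1 := @mellin_01_anti 0 s (ltW s0); rewrite mellin_01_0 in i1.
have i2 : (mellin `]0%R, 1%R] (s + 1) <= mellin `]0%R, 1%R] 1)%E by apply: mellin_01_anti; lra.
have i3 : (mellin `[1%R, +oo[ (-1) <= mellin `[1%R, +oo[ (s - 1))%E by apply: mellin_1y_mono; lra.
rewrite mellin_1y_m1 in i3.
have i4 : (mellin `[1%R, +oo[ (-2) <= mellin `[1%R, +oo[ (s - 2))%E by apply: mellin_1y_mono; lra.
have i5 : (mellin `[1%R, +oo[ (s - 2) <= mellin `[1%R, +oo[ (-1))%E by apply: mellin_1y_mono; lra.
rewrite mellin_1y_m1 in i5.
have fin (x y : \bar R) z : (0 <= x)%E -> (0 <= y)%E -> (x + y = z%:E)%E ->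
    exists2 r, x = r%:E & 0 <= r /\ y = (z - r)%:E.
  case: x => [r||]//; case: y => [t||]//; rewrite !lee_fin => r0 t0 [<-].
  by exists r => //; split => //; rewrite addrAC subrr add0r.
have [a1 ea1 [a10 ea2]] := fin _ _ _ (mellin_ge0 _ _) (mellin_ge0 _ _) e1.
have [a2 ea3 [a20 ea4]] := fin _ _ _ (mellin_ge0 _ _) (mellin_ge0 _ _) e2.
have [d1 ed1 [d10 ed2]] := fin _ _ _ (mellin_ge0 _ _) (mellin_ge0 _ _) e4.
have a30 := @mellin_ge0 `]0%R, 1%R] (s + 1).
have a40 := @mellin_ge0 `]0%R, 1%R] 1.
have d30 := @mellin_ge0 `[1%R, +oo[ (-2).
have d20 := @mellin_ge0 `[1%R, +oo[ (s - 1).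
move: e3 e5 i1 i2 i3 i4 i5 e0 a30 a40 d30 d20.
rewrite ea1 ea4 ed1 ed2 ea3.
case: (mellin `]0%R, 1%R] 1) => [a4||]//; case: (mellin `[1%R, +oo[ (-2)) => [d4||]//.
rewrite -!EFinD => -[e3] -[e5]; rewrite !lee_fin => i1 i2 i3 i4 i5 [e0] a30 a40 d30 d20.
rewrite ea3 in ea2; case: ea2 => ea2.
have j1 : s * (s + 1)^-1 <= s by rewrite ger_pMr// invf_le1; lra.
have j2 : 1 - (s + 1)^-1 = s * (s + 1)^-1 by field; rewrite gt_eqF//; lra.
have j3 : s / (1 - s) = (1 - s)^-1 - 1 by field; rewrite gt_eqF//; lra.
split; first by apply/andP; split; lra.
have j4 : (s + 1)^-1 <= 1 by rewrite invf_le1; lra.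
by rewrite ler_norml; apply/andP; split; lra.
Qed.

Let triple_aux (u v w z : R) : u / 3 + v / 3 = w + z / 3 -> u + v = 3 * w + z.
Proof. lra. Qed.

Let triple_sub (u v w z u' v' w' z' : R) : u + v = 3 * w + z -> u' + v' = 3 * w' + z' ->
  3 * (w - w') = (u - u') - (z - z') + (v - v').
Proof. by move=> ? ?; lra. Qed.

(** Substituting u = v^3 turns the three values at thirds into integrals of v^(s - 1), v^s and v^(s
    + 1) against 1 / (1 + v^3). Since 1 + v^3 = (1 + v) (1 - v + v^2), their alternating sum is the
    integral at s itself. *)
Lemma mellinF_triple s : 0 < s < 1 ->
  mellinF (s / 3) + mellinF ((s + 2) / 3) = 3 * mellinF s + mellinF ((s + 1) / 3).
Proof.
move=> /andP[s0 s1].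
pose c (v : R) := (1 + v ^+ 3)^-1.
pose g p (v : R) := c v * v `^ p.
have c0 (v : R) : 0 < v -> 0 < c v by move=> v0; rewrite invr_gt0 addr_gt0// exprn_gt0.
have mc : measurable_fun (`]0%R, +oo[ : set R) c.
  apply: open_continuous_measurable_fun; first exact: interval_open.
  move=> v; rewrite inE/= in_itv/= andbT => v0.
  apply: (@cvgV _ _ _ _ (fun v : R => 1 + v ^+ 3)).
    by rewrite gt_eqF// addr_gt0// exprn_gt0.
  by apply: cvgD; [exact: cvg_cst|exact: exprn_continuous].
have mg p : measurable_fun (`]0%R, +oo[ : set R) (EFin \o g p).
  apply/measurable_EFinP; apply: measurable_funM => //.
  by apply: measurable_funTS; exact: measurable_powR.
have g0 p (v : R) : `]0%R, +oo[%classic v -> (0 <= (g p v)%:E)%E.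
  rewrite /= in_itv/= andbT => v0; rewrite lee_fin mulr_ge0 ?powR_ge0//.
  exact/ltW/c0.
have E (t : R) : 0 < t < 1 -> (\int[mu]_(v in `]0%R, +oo[) (3 * g (3 * t - 1) v)%:E = (mellinF t)%:E)%E.
  move=> t01; rewrite -mellin_fin//.
  rewrite /mellin (@integral_subst_monomial _ 1 2 (fun u => (1 + u) `^ (1 - 2) * u `^ (t - 1)))//.
  - apply: eq_integral => v; rewrite inE/= in_itv/= andbT => v0; congr EFin.
    have v30 : 0 < v ^+ 3 by rewrite exprn_gt0.
    rewrite !mul1r powR1D_inv ?ltW// -/(c v).
    have -> : (v ^+ 3) `^ (t - 1) = v `^ (3 * (t - 1)) by rewrite -powR_mulrn ?ltW// -powRrM.
    have -> : v ^+ 2 = v `^ 2 by rewrite powR_mulrn ?ltW.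
    have -> : 3 * t - 1 = 3 * (t - 1) + 2 by ring.
    by rewrite /g powRD_gt0//; ring.
  - move=> x x0; apply: cvgM; last exact: continuous_powR_pt.
    by apply: continuous_powRD; lra.
  - by move=> x _; rewrite mulr_ge0 ?powR_ge0.
have E' (t p : R) : 0 < t < 1 -> p = 3 * t - 1 ->
    (\int[mu]_(v in `]0%R, +oo[) (g p v)%:E = (mellinF t / 3)%:E)%E.
  move=> t01 ->; have h : (3%:E * \int[mu]_(v in `]0%R, +oo[) (g (3 * t - 1) v)%:E = (mellinF t)%:E)%E.
    by rewrite -E// -ge0_integralZl_EFin//; [exact: g0|exact: mg].
  have : (0 <= \int[mu]_(v in `]0%R, +oo[) (g (3 * t - 1) v)%:E)%E.
    by apply: integral_ge0 => v; exact: g0.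
  move: h; case: (\int[mu]_(v in _) _)%E => [r||]//.
    by move=> [<-] _; congr EFin; field.
  by rewrite mulry gtr0_sg// mul1e.
have Es : mellin `]0%R, +oo[ (s - 1) = (mellinF s)%:E by apply: mellin_fin; lra.
have : (\int[mu]_(v in `]0%R, +oo[) (g (s - 1) v)%:E + \int[mu]_(v in `]0%R, +oo[) (g (s + 1) v)%:E
   = mellin `]0%R, +oo[ (s - 1) + \int[mu]_(v in `]0%R, +oo[) (g s v)%:E)%E.
  have mI : measurable (`]0, +oo[ : set R) by exact: measurable_itv.
  have m0 (u : R) : `]0, +oo[%classic u -> (0 <= ((1 + u) `^ (1 - 2) * u `^ (s - 1))%:E)%E.
    by move=> _; rewrite lee_fin mulr_ge0 ?powR_ge0.
  have eL := @ge0_integralD _ _ _ mu _ mI _ _ (g0 (s - 1)) (mg (s - 1)) (g0 (s + 1)) (mg (s + 1)).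
  have eR := @ge0_integralD _ _ _ mu _ mI _ _ m0 (@measurable_mellin _ _) (g0 s) (mg s).
  apply: etrans (etrans (esym eL) _) eR.
  apply: eq_integral => v; rewrite inE/= in_itv/= andbT => v0; rewrite -!EFinD; congr EFin.
  have vs : v `^ s = v `^ (s - 1) * v by rewrite -{3}(powRr1 (ltW v0)) -powRD_gt0// subrK.
  have vs1 : v `^ (s + 1) = v `^ (s - 1) * v ^+ 2.
    by rewrite powRD_gt0// powRr1 ?ltW// vs -mulrA -expr2.
  rewrite powR1D_inv ?ltW// /g vs vs1 /c.
  have v3 : 1 + v ^+ 3 != 0 by rewrite gt_eqF// addr_gt0// exprn_gt0.
  have v1 : 1 + v != 0 by rewrite gt_eqF// addr_gt0.
  by field; rewrite v1 v3.
rewrite (E' (s / 3) (s - 1)); [|lra|by field].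
rewrite (E' ((s + 2) / 3) (s + 1)); [|lra|by field].
rewrite (E' ((s + 1) / 3) s); [|lra|by field].
by rewrite Es -!EFinD => -[]; exact: triple_aux.
Qed.

(* Herglotz' trick for the tripling formula shared by both sides. *)
Lemma mellinF_csc s : 0 < s < 1 -> mellinF s = csc_pi s.
Proof.
pose h (t : R) := mellinF t - csc_pi t.
have hb : exists2 M, 0 <= M & forall t : R, 0 < t < 1 -> `|h t| <= M.
  exists (3 * pi + 4); first by have := pi_ge0 R; lra.
  move=> t t01; have [_ h1] := mellinF_bounds t01; have h2 := csc_pi_bounded t01.
  have -> : h t = (mellinF t - t^-1 - (1 - t)^-1) - (csc_pi t - t^-1 - (1 - t)^-1).
    by rewrite /h; ring.
  by apply: (le_trans (ler_normB _ _)); lra.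
have h0 : exists2 C, 0 < C & forall t : R, 0 < t -> t <= 1 / 4 -> `|h t| <= C * t.
  exists (3 + pi ^+ 2); first by have := sqr_ge0 (pi : R); lra.
  move=> t t0 t4; have p4 : pi <= 4 :> R by have := @pihalf_lt2 R; lra.
  have [|/andP[h1 h1'] _] := @mellinF_bounds t; first lra.
  have h2 : `|csc_pi t - t^-1| <= pi ^+ 2 * t.
    apply: csc_pi_near0 => //; have : pi * t <= 4 * (1 / 4) by apply: ler_pM => //; [exact: pi_ge0|exact: ltW].
    by lra.
  have h3 : t / (1 - t) <= 2 * t.
    by rewrite ler_pdivrMr; [nra|lra].
  have -> : h t = (mellinF t - t^-1) - (csc_pi t - t^-1) by rewrite /h; ring.
  apply: (le_trans (ler_normB _ _)); rewrite (ger0_norm h1); lra.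
have h3 (t : R) : 0 < t < 1 -> `|h t| <= (`|h (t / 3)| + `|h ((t + 1) / 3)| + `|h ((t + 2) / 3)|) / 3.
  move=> t01; have f1 := mellinF_triple t01; have f2 := csc_pi_triple t01.
  have e : 3 * h t = h (t / 3) - h ((t + 1) / 3) + h ((t + 2) / 3) := triple_sub f1 f2.
  rewrite ler_pdivlMr// mulrC -[X in X * _ <= _](gtr0_norm (ltr0n R 3)) -normrM e.
  apply: (le_trans (ler_normD _ _)); rewrite lerD2r.
  exact: ler_normB.
move=> s01; apply/eqP; rewrite -subr_eq0 -/(h s) -normr_le0.
case: hb => M0 M00 hM0; case: h0 => C C0 h0.
pose S := [set `|h t| | t in [set t : R | 0 < t < 1]].
have Sub : has_sup S.
  split; first by exists `|h s|, s.
  by exists M0 => _ [t t01 <-]; exact: hM0.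
pose M := sup S.
have hM (t : R) : 0 < t < 1 -> `|h t| <= M.
  by move=> t01; apply: sup_ubound; [exact: Sub.2|exists t].
apply: (le_trans (hM s s01)); rewrite leNgt; apply/negP => M_gt0.
have [k kC k4] : exists2 k : nat, C * 3^-1 ^+ k <= M / 2 & 3^-1 ^+ k <= 1 / 4 :> R.
  have a1 (e : R) : 0 < e -> \forall k \near \oo, 3^-1 ^+ k <= e.
    move=> e0; have /cvgr0Pnorm_le : (GRing.exp (3^-1 : R)) @ \oo --> (0 : R).
      by apply: cvg_expr; rewrite ger0_norm ?invr_ge0//; lra.
    move=> /(_ _ e0); apply: filterS => k; by rewrite ger0_norm// exprn_ge0// invr_ge0.
  have [k _ hk] : \forall k \near \oo, 3^-1 ^+ k <= M / 2 / C /\ 3^-1 ^+ k <= 1 / 4 :> R.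
    near=> k; split; near: k; apply: a1; rewrite ?divr_gt0//.
  exists k; last by have [] := hk k (leqnn _).
  by have [+ _] := hk k (leqnn _); rewrite ler_pdivlMr// mulrC.
(* The supremum [M] need not be attained, so the trick is made quantitative. Near 0 the bound C t
   gives |h| <= M / 2; each tripling averages one improved value with two values at most M, dividing
   the gain by 3. After [k] triplings all of (0, 1) is covered, and [M] falls below itself. *)
have P j (t : R) : 0 < t -> t < 1 -> t * 3^-1 ^+ j <= 3^-1 ^+ k -> `|h t| <= (1 - 3^-1 ^+ j / 2) * M.
  elim: j t => [|j IH] t t0 t1.
    rewrite expr0 mulr1 => tk.
    have := h0 t t0 (le_trans tk k4); have : C * t <= C * 3^-1 ^+ k by rewrite ler_pM2l.
    lra.
  move=> tk; have b1 : `|h (t / 3)| <= (1 - 3^-1 ^+ j / 2) * M.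
    apply: IH; [lra|lra|]; move: tk; rewrite exprS.
    by rewrite [t * _]mulrCA [in X in X -> _]mulrC [in X in X -> _]mulrAC -!mulrA [3^-1 * _]mulrC.
  have b2 : `|h ((t + 1) / 3)| <= M by apply: hM; lra.
  have b3 : `|h ((t + 2) / 3)| <= M by apply: hM; lra.
  have b4 : `|h t| <= _ := h3 t _.
  have {}b4 := b4 ltac:(by rewrite t0).
  rewrite exprS; lra.
have : M <= (1 - 3^-1 ^+ k / 2) * M.
  apply: ge_sup; first exact: Sub.1.
  move=> _ [t /andP[t0 t1] <-]; apply: P => //.
  by rewrite ger_pMl ?ltW// exprn_gt0// invr_gt0.
apply/negP; rewrite -ltNge gtr_pMl// ltrBlDr ltrDl divr_gt0// exprn_gt0// invr_gt0.
Unshelve. all: end_near. Qed.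

(** At exponent 0 the integrand of J has absolute value u^(1 - alpha) / (1 + u), the Mellin
    integrand at s = 2 - alpha in (0, 1). *)
Lemma betaJ0 (alpha : R) : 1 < alpha < 2 ->
  betaJ alpha 0 = - (pi * `|(sin (pi * alpha))^-1|).
Proof.
move=> al12; have /andP[al1 al2] := al12.
have p0 : 0 < pi :> R by exact: pi_gt0.
have s0 : 0 < sin (pi * (2 - alpha)).
  by apply: sin_gt0_pi; rewrite mulr_gt0/=; [rewrite gtr_pMr//; lra|lra|lra].
have e : sin (pi * alpha) = - sin (pi * (2 - alpha)).
  have -> : pi * (2 - alpha) = - (pi * alpha) + pi + pi by ring.
  by rewrite !sinDpi opprK sinN opprK.
have : `|betaJ alpha 0| = mellinF (2 - alpha).
  have al0 : 0 < alpha by lra.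
  apply: EFin_inj; rewrite -(integral_norm_powR1D_sub1 al12 al0) -mellin_fin; last lra.
  apply: eq_integral => u; rewrite inE/= in_itv/= andbT => u0; congr EFin.
  rewrite sub0r powR_inv1 ?powR1D_inv; [|lra|lra].
  have -> : 2 - alpha - 1 = - alpha + 1 by ring.
  rewrite powRD_gt0// powRr1 ?ltW//.
  have -> : (1 + u)^-1 - 1 = - (u / (1 + u)) by field; rewrite gt_eqF//; lra.
  rewrite normrN ger0_norm; last by rewrite divr_ge0//; lra.
  by ring.
move=> h; rewrite -(@sgr_betaJ _ _ al12); last lra.
rewrite h mellinF_csc; last lra.
rewrite sub0r sgrN sgr1 mulN1r e invrN normrN gtr0_norm ?invr_gt0//.
Qed.

End reflection.

(** * Gamma and Beta integrals *)

Section gamma_beta.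
Context {R : realType}.
Implicit Types (p q s t : R).
Let mu : {measure set _ -> \bar R} := @lebesgue_measure R.

Lemma tonelli_square (D : set R) (f : R -> R -> R) : measurable D ->
  measurable_fun setT (fun z : measurableTypeR R * measurableTypeR R => f z.1 z.2) ->
  (forall x y, 0 <= f x y) ->
  (\int[mu]_(x in D) \int[mu]_(y in D) (f x y)%:E =
   \int[mu]_(y in D) \int[mu]_(x in D) (f x y)%:E)%E.
Proof.
move=> mD mf f0; pose GR := measurableTypeR R.
pose g (z : GR * GR) := (f z.1 z.2 * (\1_D z.1 * \1_D z.2))%:E.
have mg : measurable_fun setT g.
  apply/measurable_EFinP; apply: measurable_funM; first exact: mf.
  by apply: measurable_funM; apply: measurableT_comp => //; exact: measurable_indic.
have g0 z : (0 <= g z)%E by rewrite lee_fin !mulr_ge0.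
have := @fubini_tonelli _ _ GR GR R mu mu g mg g0.
have -> : (\int[mu]_x \int[mu]_y g (x, y) = \int[mu]_(x in D) \int[mu]_(y in D) (f x y)%:E)%E.
  rewrite [RHS]integral_mkcond; apply: eq_integral => x _; rewrite patchE.
  case: ifPn => xD.
    rewrite [RHS]integral_mkcond; apply: eq_integral => y _.
    by rewrite patchE /g/= !indicE xD mul1r; case: ifPn => _; rewrite ?mulr1 ?mulr0.
  by apply: integral0_eq => y _; rewrite /g/= !indicE (negbTE xD) mul0r mulr0.
move=> ->; rewrite [RHS]integral_mkcond; apply: eq_integral => y _; rewrite patchE.
case: ifPn => yD.
  rewrite [RHS]integral_mkcond; apply: eq_integral => x _.
  by rewrite patchE /g/= !indicE yD mulr1; case: ifPn => _; rewrite ?mulr1 ?mulr0.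
by apply: integral0_eq => x _; rewrite /g/= !indicE (negbTE yD) !mulr0.
Qed.

Definition gammaI s : \bar R :=
  (\int[mu]_(t in `]0%R, +oo[) (t `^ (s - 1) * expR (- t))%:E)%E.

Lemma measurable_gammaI (D : set R) s :
  measurable_fun D (fun t : R => (t `^ (s - 1) * expR (- t))%:E).
Proof.
apply/measurable_EFinP; apply: measurable_funTS.
apply: measurable_funM; first exact: measurable_powR.
by apply: measurableT_comp.
Qed.

Lemma gamma_integrand_ge0 s t : (0 <= (t `^ (s - 1) * expR (- t))%:E)%E.
Proof. by rewrite lee_fin mulr_ge0 ?powR_ge0 ?expR_ge0. Qed.

Lemma gammaI_ge0 s : (0 <= gammaI s)%E.
Proof. by apply: integral_ge0 => t _; exact: gamma_integrand_ge0. Qed.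

(** From ln y < y at y = t / k. Taking k = s + 1 bounds the Gamma integrand at infinity by a
    multiple of t^(-2). *)
Lemma expRN_le_powR k t : 0 < k -> 0 < t -> expR (- t) <= (t / k) `^ (- k).
Proof.
move=> k0 t0; rewrite powR_expR_ln ?divr_gt0// ler_expR mulNr lerN2.
have := ltW (ln_sublinear (divr_gt0 t0 k0)).
by rewrite ler_pdivlMr// mulrC.
Qed.

Lemma gammaI_lty s : 0 < s -> (gammaI s < +oo)%E.
Proof.
move=> s0; rewrite /gammaI (@integral_0y_split _ _ 1)//; last 2 first.
- exact: measurable_gammaI.
- by move=> t; exact: gamma_integrand_ge0.
apply: lte_add_pinfty.
  apply: (@le_lt_trans _ _ (\int[mu]_(x in `]0%R, 1%R]) (x `^ (s - 1))%:E)%E); last first.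
    by rewrite integral_powR_0 ?ltry//; lra.
  apply: ge0_le_integral => //.
  - by move=> t _; exact: gamma_integrand_ge0.
  - exact: measurable_gammaI.
  - by apply/measurable_EFinP; apply: measurable_funTS; exact: measurable_powR.
  - move=> x; rewrite /= in_itv/= => /andP[x0 x1]; rewrite lee_fin ler_piMr ?powR_ge0//.
    by rewrite -expR0 ler_expR oppr_le0 ltW.
have k0 : 0 < (s + 1) `^ (s + 1) by rewrite powR_gt0; lra.
apply: (@le_lt_trans _ _ (((s + 1) `^ (s + 1))%:E * \int[mu]_(x in `[1%R, +oo[) (x `^ (- 2))%:E)%E); last first.
  by rewrite integral_powR_y//; [rewrite -EFinM ltry|lra].
rewrite -ge0_integralZl_EFin//; last 3 first.
- by move=> x _; rewrite lee_fin powR_ge0.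
- by apply/measurable_EFinP; apply: measurable_funTS; exact: measurable_powR.
- exact: ltW.
apply: ge0_le_integral => //.
- by move=> t _; exact: gamma_integrand_ge0.
- exact: measurable_gammaI.
- apply/measurable_EFinP; apply: measurable_funTS.
  by apply: measurable_funM => //; exact: measurable_powR.
- move=> x; rewrite /= in_itv/= andbT => x1; rewrite -EFinM lee_fin.
  have x0 : 0 < x by lra.
  have s1 : 0 < s + 1 by lra.
  apply: (@le_trans _ _ (x `^ (s - 1) * (x / (s + 1)) `^ (- (s + 1)))).
    by apply: ler_wpM2l; [exact: powR_ge0|exact: expRN_le_powR].
  have x0' := ltW x0; have s1' := ltW s1.
  rewrite powRM ?invr_ge0// powR_inv_ge0// opprK mulrA.
  rewrite -powRD_gt0// mulrC.
  by have -> : s - 1 - (s + 1) = -2 by ring.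
Qed.

Lemma gammaI_gt0 s : 0 < s -> (0 < gammaI s)%E.
Proof.
move=> s0; rewrite /gammaI (@integral_0y_split _ _ 1)//; last 2 first.
- exact: measurable_gammaI.
- by move=> t; exact: gamma_integrand_ge0.
apply: (@lt_le_trans _ _ ((expR (-1))%:E * \int[mu]_(x in `]0%R, 1%R]) (x `^ (s - 1))%:E)%E).
  rewrite integral_powR_0//; last lra.
  by rewrite -EFinM lte_fin powR1 subrK mulr_gt0 ?expR_gt0// divr_gt0.
rewrite -[leLHS]adde0; apply: leeD; last first.
  by apply: integral_ge0 => t _; exact: gamma_integrand_ge0.
rewrite -ge0_integralZl_EFin//; last 2 first.
- by move=> x _; rewrite lee_fin powR_ge0.
- by apply/measurable_EFinP; apply: measurable_funTS; exact: measurable_powR.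
apply: ge0_le_integral => //.
- by move=> x _; rewrite -EFinM lee_fin mulr_ge0 ?expR_ge0 ?powR_ge0.
- apply/measurable_EFinP; apply: measurable_funTS.
  by apply: measurable_funM => //; exact: measurable_powR.
- exact: measurable_gammaI.
- move=> x; rewrite /= in_itv/= => /andP[x0 x1]; rewrite -EFinM lee_fin mulrC.
  by apply: ler_wpM2l; [exact: powR_ge0|rewrite ler_expR lerN2].
Qed.

Lemma gammaI_scale s k : 0 < k ->
  gammaI s = ((k `^ s)%:E * \int[mu]_(t in `]0%R, +oo[) (t `^ (s - 1) * expR (- (k * t)))%:E)%E.
Proof.
move=> k0; rewrite -ge0_integralZl_EFin//; last 3 first.
- by move=> t _; rewrite lee_fin mulr_ge0 ?powR_ge0 ?expR_ge0.
- apply/measurable_EFinP; apply: measurable_funTS.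
  apply: measurable_funM; first exact: measurable_powR.
  by apply: measurableT_comp => //; apply: measurableT_comp => //; exact: measurable_funM.
- exact: powR_ge0.
rewrite /gammaI (@integral_subst_monomial _ k 0 (fun t => t `^ (s - 1) * expR (- t)))//.
- apply: eq_integral => t; rewrite inE/= in_itv/= andbT => t0; rewrite -EFinM; congr EFin.
  rewrite expr1 expr0 !mulr1 powRM ?ltW//.
  have -> : k `^ s = k `^ (s - 1) * k by rewrite -{3}(powRr1 (ltW k0)) -powRD_gt0// subrK.
  by ring.
- move=> x x0; apply: cvgM; first exact: continuous_powR_pt.
  apply: (@continuous_comp _ _ _ (fun x : R => - x) expR); last exact: continuous_expR.
  by apply: cvgN; exact: cvg_id.
- by move=> x _; rewrite mulr_ge0 ?powR_ge0 ?expR_ge0.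
Qed.

(* Both sides equal the double integral of s^(p-1) t^(p+q-1) exp(-(1+s)t). *)
Lemma gammaI_beta p q : 0 < p -> 0 < q ->
  (gammaI p * gammaI q = gammaI (p + q) *
   \int[mu]_(s in `]0%R, +oo[) ((1 + s) `^ (- (p + q)) * s `^ (p - 1))%:E)%E.
Proof.
move=> p0 q0.
have fin r : 0 < r -> gammaI r = (fine (gammaI r))%:E.
  by move=> r0; rewrite fineK// ge0_fin_numE ?gammaI_lty// gammaI_ge0.
have g0 r : 0 <= fine (gammaI r) by apply: fine_ge0; exact: gammaI_ge0.
have inner s k : 0 < k -> 0 < s ->
    (\int[mu]_(t in `]0%R, +oo[) (t `^ (s - 1) * expR (- (k * t)))%:E =
     (k `^ (- s) * fine (gammaI s))%:E)%E.
  move=> k0 s0; rewrite EFinM -fin// (gammaI_scale s k0) muleA -EFinM -powRD_gt0//.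
  by rewrite addNr powRr0 mul1e.
pose f (s t : R) := s `^ (p - 1) * (t `^ (p + q - 1) * expR (- ((1 + s) * t))).
have f0 (s t : R) : 0 <= f s t by rewrite !mulr_ge0 ?powR_ge0 ?expR_ge0.
have mf : measurable_fun setT (fun z : measurableTypeR R * measurableTypeR R => f z.1 z.2).
  apply: measurable_funM.
    by apply: (@measurableT_comp _ _ _ _ _ _ (@powR R ^~ (p - 1))) => //; exact: measurable_powR.
  apply: measurable_funM.
    by apply: (@measurableT_comp _ _ _ _ _ _ (@powR R ^~ (p + q - 1))) => //; exact: measurable_powR.
  apply: measurableT_comp => //; apply: measurableT_comp => //.
  by apply: measurable_funM => //; exact: measurable_funD.
have mI : measurable (`]0, +oo[ : set R) by exact: measurable_itv.
have := tonelli_square mI mf f0.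
have -> : (\int[mu]_(s in `]0%R, +oo[) \int[mu]_(t in `]0%R, +oo[) (f s t)%:E =
   gammaI (p + q) * \int[mu]_(s in `]0%R, +oo[) ((1 + s) `^ (- (p + q)) * s `^ (p - 1))%:E)%E.
  rewrite fin ?addr_gt0// -ge0_integralZl_EFin//; last 2 first.
  - by move=> s _; rewrite lee_fin mulr_ge0 ?powR_ge0.
  - apply/measurable_EFinP; apply: measurable_funTS.
    by apply: measurable_funM; [exact: measurable_powRD|exact: measurable_powR].
  apply: eq_integral => s; rewrite inE/= in_itv/= andbT => s0.
  transitivity ((s `^ (p - 1))%:E * \int[mu]_(t in `]0%R, +oo[) (t `^ (p + q - 1) * expR (- ((1 + s) * t)))%:E)%E.
    rewrite -ge0_integralZl_EFin//; last 3 first.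
    - by move=> t _; rewrite lee_fin mulr_ge0 ?powR_ge0 ?expR_ge0.
    - apply/measurable_EFinP; apply: measurable_funTS.
      apply: measurable_funM; first exact: measurable_powR.
      by apply: measurableT_comp => //; apply: measurableT_comp => //; exact: measurable_funM.
    - exact: powR_ge0.
  rewrite inner; [|lra|lra]; rewrite -!EFinM; congr EFin; ring.
move=> ->.
transitivity (\int[mu]_(t in `]0%R, +oo[) ((fine (gammaI p))%:E * (t `^ (q - 1) * expR (- t))%:E))%E.
  rewrite ge0_integralZl_EFin//; last 2 first.
  - by move=> t _; exact: gamma_integrand_ge0.
  - exact: measurable_gammaI.
  by rewrite -fin.
apply: eq_integral => t; rewrite inE/= in_itv/= andbT => t0.
transitivity ((t `^ (p + q - 1) * expR (- t))%:E *
    \int[mu]_(s in `]0%R, +oo[) (s `^ (p - 1) * expR (- (t * s)))%:E)%E.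
  rewrite inner// -!EFinM; congr EFin.
  have -> : p + q - 1 = p + (q - 1) by ring.
  rewrite (powRD_gt0 p (q - 1) t0).
  have h : t `^ p * t `^ (- p) = 1 by rewrite -powRD_gt0// subrr powRr0.
  transitivity (fine (gammaI p) * (t `^ (q - 1) * expR (- t)) * (t `^ p * t `^ (- p))).
    by rewrite h mulr1.
  by ring.
rewrite -ge0_integralZl_EFin//; last 3 first.
- by move=> s _; rewrite lee_fin mulr_ge0 ?powR_ge0 ?expR_ge0.
- apply/measurable_EFinP; apply: measurable_funTS.
  apply: measurable_funM; first exact: measurable_powR.
  by apply: measurableT_comp => //; apply: measurableT_comp => //; exact: measurable_funM.
- by rewrite mulr_ge0 ?powR_ge0 ?expR_ge0.
apply: eq_integral => s _; rewrite -EFinM; congr EFin.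
rewrite /f mulrDl mul1r opprD expRD (mulrC t s); ring.
Qed.

Lemma GammaE s : 0 < s -> Gamma s = fine (gammaI s).
Proof.
by move=> s0; rewrite /Gamma /Gamma_shift s0 big_ord0 divr1 addr0.
Qed.

Lemma Gamma_neg1 s : -1 < s < 0 -> Gamma s = fine (gammaI (s + 1)) / s.
Proof.
move=> /andP[s1 s0]; rewrite /Gamma /Gamma_shift ltNge (ltW s0)/=.
(* Since 0 < - s < 1, the shift is exactly 1 and the product has the single factor s. *)
have -> : Num.floor (- s) = 0.
  by apply/eqP; rewrite floor_eq; apply/andP; split; [lra|rewrite add0r; lra].
by rewrite big_ord1 addr0.
Qed.

Let gammaI_beta_eq p q r u v : 0 < p -> 0 < q -> p + q = r -> - (p + q) = u -> p - 1 = v ->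
  (gammaI p * gammaI q = gammaI r *
   \int[mu]_(s in `]0%R, +oo[) ((1 + s) `^ u * s `^ v)%:E)%E.
Proof. by move=> p0 q0 <- <- <-; exact: gammaI_beta. Qed.

Let gamma_quotient (a n g1 g2 g3 : R) : a - 1 != 0 -> 1 - a != 0 -> g3 != 0 ->
  (n - 1) / (a - 1) * (g1 * g2 / g3) = - ((n - 1) * (g1 / (1 - a) * g2) / g3).
Proof. by move=> a1 a1' g30; field; rewrite g30 a1 a1'. Qed.

(** Beta in terms of Gamma with p = 2 - alpha and q = alpha - nu. The continuation Gamma (1 - alpha)
    = Gamma (2 - alpha) / (1 - alpha) supplies the denominator and the minus sign. *)
Lemma betaJ_Gamma (alpha nu : R) : 1 < alpha < 2 -> nu < 2 -> nu < alpha ->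
  betaJ alpha nu = - ((nu - 1) * (Gamma (1 - alpha) * Gamma (alpha - nu)) / Gamma (2 - nu)).
Proof.
move=> al12 nu2 nua; have /andP[al1 al2] := al12.
have a1 : alpha - 1 != 0 by rewrite gt_eqF//; lra.
have a2 : 1 - alpha != 0 by rewrite lt_eqF//; lra.
have p0 : 0 < 2 - alpha by lra.
have q0 : 0 < alpha - nu by lra.
have pq0 : 0 < 2 - nu by lra.
have pq : 2 - alpha + (alpha - nu) = 2 - nu by ring.
have u2 : - (2 - alpha + (alpha - nu)) = nu - 2 by ring.
have v1 : 2 - alpha - 1 = 1 - alpha by ring.
have -> : Gamma (1 - alpha) = fine (gammaI (2 - alpha)) / (1 - alpha).
  rewrite Gamma_neg1; last lra.
  by have -> : 1 - alpha + 1 = 2 - alpha by ring.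
rewrite (GammaE q0) (GammaE pq0).
have fin r : 0 < r -> gammaI r \is a fin_num.
  by move=> r0; rewrite ge0_fin_numE ?gammaI_lty// gammaI_ge0.
have fB : betaI alpha nu \is a fin_num by rewrite ge0_fin_numE ?betaI_lty// betaI_ge0.
have h := etrans (esym (fineM (fin _ p0) (fin _ q0)))
  (etrans (congr1 fine (gammaI_beta_eq p0 q0 pq u2 v1)) (fineM (fin _ pq0) fB)).
have g0 : fine (gammaI (2 - nu)) != 0.
  by rewrite gt_eqF//; apply: fine_gt0; rewrite gammaI_gt0// gammaI_lty.
rewrite -gamma_quotient//; congr (_ * _).
by rewrite h mulrAC mulfV// mul1r.
Qed.

End gamma_beta.

(** * Survival probabilities and hitting moments *)

Section survival.
Context {R : realType} (K : R.-pker R ~> R) (a : R).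

Lemma kernel_setT x : K x setT = 1%E.
Proof. exact: prob_kernel. Qed.

Lemma surv_ge0 n x : (0 <= surv K a n x)%E.
Proof.
elim: n x => [|n ih] x /=; case: ifPn => // _.
exact: integral_ge0.
Qed.

Lemma surv_out n x : x <= a -> surv K a n x = 0%E.
Proof. by case: n => [|n] /=; rewrite ltNge => ->. Qed.

Lemma measurable_surv n : measurable_fun setT (surv K a n).
Proof.
elim: n => [|n ih] /=.
  apply: measurable_fun_ifT => //; exact: measurable_fun_ltr.
apply: measurable_fun_ifT => //; first exact: measurable_fun_ltr.
apply: measurable_fun_integral_kernel => //.
- exact: measurable_kernel.
- by move=> z; exact: surv_ge0.
Qed.

Lemma surv_nincr n x : (surv K a n.+1 x <= surv K a n x)%E.
Proof.
elim: n x => [|n ih] x; last first.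
  rewrite [X in (X <= _)%E]/= [X in (_ <= X)%E]/=; case: ifPn => // ax.
  apply: ge0_le_integral => //.
  - by move=> *; exact: (surv_ge0 n.+1).
  - exact: (measurable_surv n.+1).
  - exact: measurable_surv.
  - by move=> z _; exact: (ih z).
rewrite /=; case: ifPn => // ax.
apply: (@le_trans _ _ (\int[K x]_y (cst 1%E y))%E).
  apply: ge0_le_integral => //.
  - by move=> *; exact: (surv_ge0 0).
  - exact: (measurable_surv 0).
  - by move=> z _; case: ifPn.
by rewrite integral_cst// mul1e kernel_setT.
Qed.

Lemma surv_le1 n x : (surv K a n x <= 1)%E.
Proof.
elim: n => [|n ih]; last exact: le_trans (surv_nincr _ _) ih.
by rewrite /=; case: ifPn.
Qed.

Definition survr n x : R := fine (surv K a n x).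

Lemma survrE n x : surv K a n x = (survr n x)%:E.
Proof.
rewrite fineK//; apply/fin_numPlt.
rewrite (lt_le_trans _ (surv_ge0 _ _))//=.
by rewrite (le_lt_trans (surv_le1 _ _))// ltry.
Qed.

Lemma survr_ge0 n x : 0 <= survr n x.
Proof. by rewrite -lee_fin -survrE surv_ge0. Qed.

Lemma survr_le1 n x : survr n x <= 1.
Proof. by rewrite -lee_fin -survrE surv_le1. Qed.

Lemma survr_nincr n m x : (n <= m)%N -> survr m x <= survr n x.
Proof.
elim: m => [|m ih]; first by rewrite leqn0 => /eqP ->.
rewrite leq_eqVlt => /predU1P[->//|]; rewrite ltnS => /ih; apply: le_trans.
by rewrite -lee_fin -!survrE surv_nincr.
Qed.

Lemma survr_out n x : x <= a -> survr n x = 0.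
Proof. by move=> xa; rewrite /survr surv_out. Qed.

Lemma survr0 x : a < x -> survr 0 x = 1.
Proof. by move=> ax; rewrite /survr /= ax. Qed.

Lemma measurable_survr n : measurable_fun setT (survr n).
Proof. by apply/measurable_EFinP; apply: eq_measurable_fun (measurable_surv n) => x _; rewrite survrE. Qed.

Lemma survrS n x : a < x -> (\int[K x]_y (survr n y)%:E)%E = (survr n.+1 x)%:E.
Proof.
move=> ax; rewrite -survrE /= ax.
by apply: eq_integral => y _; rewrite survrE.
Qed.

End survival.

(** * Moments of the hitting time from survival bounds *)

Section hitting_moments.
Context {R : realType} (K : R.-pker R ~> R) (a q x : R).
Hypotheses (q0 : 0 < q) (ax : a < x).
Let s n := survr K a n x.

Let s_anti n : s n.+1 <= s n. Proof. exact: survr_nincr. Qed.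

Let term n := (((n%:R : R) `^ q)%:E * hit_prob K a n x)%E.

Let P n := \sum_(k < n) ((k.+1%:R : R) `^ q * (s k - s k.+1)).

Let termS n : term n.+1 = ((n.+1%:R : R) `^ q * (s n - s n.+1))%:E.
Proof. by rewrite /term /hit_prob !survrE -EFinB -EFinM. Qed.

Let term0 : term 0 = 0%E.
Proof. by rewrite /term powR0 ?gt_eqF// mul0e. Qed.

Let sum_term n : (\sum_(0 <= k < n.+1) term k)%E = (P n)%:E.
Proof.
rewrite big_nat_recl// term0 add0e /P -sumEFin big_mkord.
by apply: eq_bigr => i _; rewrite termS.
Qed.

Let term_ge0 n : (0 <= term n)%E.
Proof.
case: n => [|n]; first by rewrite term0.
by rewrite termS lee_fin mulr_ge0 ?powR_ge0// subr_ge0.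
Qed.

(** Over a block of times (m, n] the weights lie between m^q and n^q, and the probabilities
    telescope; [P_ge] is the matching lower estimate. *)
Let P_le m n : (m <= n)%N -> P n <= P m + n%:R `^ q * (s m - s n).
Proof.
elim: n => [|n ih]; first by rewrite leqn0 => /eqP ->; rewrite subrr mulr0 addr0.
rewrite leq_eqVlt => /predU1P[->|]; first by rewrite subrr mulr0 addr0.
rewrite ltnS => mn; rewrite {1}/P big_ord_recr/= -/(P n).
have h1 : (n%:R : R) `^ q <= n.+1%:R `^ q by apply: ge0_ler_powR; rewrite ?nnegrE// ?ltW// ltr_nat.
have h2 : 0 <= s m - s n by rewrite subr_ge0; exact: survr_nincr.
have := ih mn; have := powR_ge0 (n%:R : R) q; nra.
Qed.

Let P_ge m n : (m <= n)%N -> P m + m%:R `^ q * (s m - s n) <= P n.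
Proof.
elim: n => [|n ih]; first by rewrite leqn0 => /eqP ->; rewrite subrr mulr0 addr0.
rewrite leq_eqVlt => /predU1P[->|]; first by rewrite subrr mulr0 addr0.
rewrite ltnS => mn; rewrite {2}/P big_ord_recr/= -/(P n).
have h1 : (m%:R : R) `^ q <= n.+1%:R `^ q.
  by apply: ge0_ler_powR; rewrite ?nnegrE// ?ltW// ltr_nat ltnS.
have h2 : 0 <= s n - s n.+1 by rewrite subr_ge0.
have := ih mn; nra.
Qed.

Let P_incr m n : (m <= n)%N -> P m <= P n.
Proof.
move=> mn; apply: le_trans (P_ge mn); rewrite lerDl mulr_ge0 ?powR_ge0// subr_ge0.
exact: survr_nincr.
Qed.

Let surv_lim_le n : (never_hit_prob K a x <= (s n)%:E)%E.
Proof.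
apply: lime_le.
  by apply: ereal_nonincreasing_is_cvgn; apply/nonincreasing_seqP => k; exact: surv_nincr.
near=> k; rewrite survrE lee_fin; apply: survr_nincr; near: k; exact: nbhs_infty_ge.
Unshelve. all: end_near. Qed.

Let never_ge0 : (0 <= never_hit_prob K a x)%E.
Proof.
apply: lime_ge; last by apply: nearW => n; exact: surv_ge0.
by apply: ereal_nonincreasing_is_cvgn; apply/nonincreasing_seqP => k; exact: surv_nincr.
Qed.

(** Dyadic times suffice: the block from 2^J to 2^(J+1) contributes at most a constant times (2^(q -
    p))^J, a convergent geometric series. *)
Lemma hit_moment_fin (C p : R) : 0 <= C -> q < p ->
  (forall j, survr K a (2 ^ j) x <= C * 2 `^ (- (j%:R * p))) ->
  (hit_moment K a q x < +oo)%E.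
Proof.
move=> C0 qp hs.
pose r : R := 2 `^ (q - p).
have r0 : 0 <= r by exact: powR_ge0.
have r1 : r < 1.
  rewrite /r powR_expR_ln// -[ltRHS]expR0 ltr_expR.
  have : 0 < ln (2 : R) by rewrite ln_gt0// ltr1n.
  nra.
(* Survival tends to 0 along dyadic times, so the summand [+oo * never_hit_prob] is [+oo * 0], which
   is 0 by convention. *)
have cvg0 (e : R) : 0 < e -> exists j, C * 2 `^ (- (j%:R * p)) <= e.
  move=> e0; have p0 : 0 < p by exact: lt_trans qp.
  have c1 : 0 < C + 1 by rewrite ltr_wpDl.
  have [j hj] : exists j : nat, (ln ((C + 1) / e) / ln 2) / p < j%:R.
    by exists (Num.truncn ((ln ((C + 1) / e) / ln 2) / p)).+1; exact: truncnS_gt.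
  exists j.
  have l2 : 0 < ln (2 : R) by rewrite ln_gt0// ltr1n.
  have hj2 : ln ((C + 1) / e) < j%:R * p * ln 2.
    by rewrite -ltr_pdivrMr// -ltr_pdivrMr.
  have : (C + 1) / e < 2 `^ (j%:R * p).
    rewrite /powR pnatr_eq0/= -[ltLHS]lnK ?ltr_expR// posrE divr_gt0//.
  rewrite ltr_pdivrMr// => h; rewrite powRN ler_pdivrMr ?powR_gt0//.
  by rewrite mulrC; apply: ltW; apply: le_lt_trans h; rewrite lerDl.
have never0 : never_hit_prob K a x = 0%E.
  apply/eqP; rewrite eq_le never_ge0 andbT.
  apply/lee_addgt0Pr => e e0; rewrite add0e.
  have [j hj] := cvg0 e e0.
  by apply: (le_trans (surv_lim_le (2 ^ j))); rewrite lee_fin (le_trans (hs j)).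
rewrite /hit_moment never0 mule0 adde0.
pose B := 1 + 2 `^ q * C / (1 - r).
have PJ J : P (2 ^ J) <= 1 + 2 `^ q * C * \sum_(j < J) r ^+ j.
  elim: J => [|J ih].
    rewrite big_ord0 mulr0 addr0 expn0 /P big_ord_recr big_ord0/= add0r powR1 mul1r.
    by have := survr_le1 K a 0 x; have := survr_ge0 K a 1 x; rewrite /s; lra.
  have := @P_le (2 ^ J) (2 ^ J.+1); rewrite leq_exp2l// leqnSn => /(_ isT) h.
  apply: (le_trans h); rewrite big_ord_recr/= [2 `^ q * C * (_ + _)]mulrDr addrA; apply: lerD => //.
  apply: (@le_trans _ _ ((2 ^ J.+1)%:R `^ q * (C * 2 `^ (- (J%:R * p))))).
    rewrite ler_wpM2l ?powR_ge0//; apply: le_trans (hs J); rewrite gerBl; exact: survr_ge0.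
  rewrite natrX -[in leLHS]powR_mulrn// -powRrM -[r ^+ J]powR_mulrn// /r -powRrM.
  rewrite mulrCA mulrAC [leLHS]mulrC ler_wpM2r// -!powRD ?pnatr_eq0 ?implybT//.
  by rewrite le_eqVlt; apply/orP; left; apply/eqP; congr (_ `^ _); rewrite -natr1; ring.
have geom J : \sum_(j < J) r ^+ j <= (1 - r)^-1.
  rewrite -[leRHS]mul1r ler_pdivlMr; last lra.
  elim: J => [|J ih]; first by rewrite big_ord0 mul0r.
  suff : (\sum_(j < J.+1) r ^+ j) * (1 - r) = 1 - r ^+ J.+1.
    by move=> ->; rewrite gerBl exprn_ge0.
  clear ih; elim: J => [|J ih]; first by rewrite big_ord_recr big_ord0/= expr1 add0r expr0 mul1r.
  by rewrite big_ord_recr/= mulrDl ih [r ^+ J.+2]exprS; ring.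
have PB n : P n <= B.
  apply: (@le_trans _ _ (P (2 ^ n))); first by apply: P_incr; exact/ltnW/ltn_expl.
  apply: (le_trans (PJ n)); rewrite /B lerD2l ler_wpM2l ?mulr_ge0 ?powR_ge0//.
change (\sum_(0 <= n <oo) term n < +oo)%E.
apply: (@le_lt_trans _ _ B%:E); last exact: ltry.
apply: lime_le; first exact: is_cvg_nneseries.
apply: nearW => n; apply: (@le_trans _ _ (\sum_(0 <= k < n.+1) term k)%E).
  by rewrite big_nat_recr//= leeDl.
by rewrite sum_term lee_fin.
Qed.

(** If the moment were finite, the tails of the series would tend to 0; but the tail beyond n
    dominates n^q P(tau > n), which stays above [dl] along a sequence. *)
Lemma hit_moment_infty (dl : R) : 0 < dl ->
  (forall m, exists n, (m <= n)%N /\ dl <= (n%:R : R) `^ q * survr K a n x) ->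
  hit_moment K a q x = +oo%E.
Proof.
move=> dl0 hs; apply/eqP; rewrite -leye_eq leNgt; apply/negP => hfin.
have series_ge0 : (0 <= \sum_(0 <= n <oo) term n)%E by exact: nneseries_ge0.
have never0 : never_hit_prob K a x = 0%E.
  apply/eqP; rewrite eq_le never_ge0 andbT leNgt; apply/negP => h.
  move: hfin; rewrite /hit_moment gt0_mulye// addey// -ltNye.
  exact: lt_le_trans series_ge0.
move: hfin; rewrite /hit_moment never0 mule0 adde0 => hfin.
have lim0 (e : R) : 0 < e -> exists n, s n <= e.
  move=> e0; apply: contrapT => hn.
  have : (e%:E <= never_hit_prob K a x)%E.
    apply: lime_ge.
      by apply: ereal_nonincreasing_is_cvgn; apply/nonincreasing_seqP => k; exact: surv_nincr.
    apply: nearW => n; rewrite survrE lee_fin leNgt; apply/negP => h; apply: hn.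
    by exists n; exact: ltW.
  by rewrite never0 lee_fin leNgt e0.
have [B PB] : exists B, (\sum_(0 <= n <oo) term n)%E = B%:E.
  exists (fine (\sum_(0 <= n <oo) term n)%E); rewrite fineK//.
  by rewrite ge0_fin_numE.
have PleB n : P n <= B.
  rewrite -lee_fin -PB -sum_term; exact: nneseries_lim_ge.
(* Budget: the partial sums are within dl / 4 of their limit, the block after n adds at least dl,
   and stopping the block at a finite time loses at most dl / 2. The total exceeds B. *)
have [m hm] : exists m, B - dl / 4 <= P m.
  apply: contrapT => hn.
  have : (\sum_(0 <= n <oo) term n <= (B - dl / 4)%:E)%E.
    apply: lime_le; first exact: is_cvg_nneseries.
    apply: nearW => n; apply: (@le_trans _ _ (\sum_(0 <= k < n.+1) term k)%E).
      by rewrite big_nat_recr//= leeDl.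
    rewrite sum_term lee_fin leNgt; apply/negP => h; apply: hn; exists n; exact: ltW.
  by rewrite PB lee_fin; lra.
have [n [mn hn]] := hs (maxn m 1).
have n0 : (0 < (n%:R : R) `^ q).
  by rewrite powR_gt0// ltr0n; apply: leq_trans mn; rewrite leq_maxr.
have [k hk] := lim0 (dl / 2 / n%:R `^ q) (divr_gt0 (divr_gt0 dl0 (ltr0n _ 2)) n0).
have hk2 : (n%:R : R) `^ q * s (maxn n k) <= dl / 2.
  rewrite mulrC -ler_pdivlMr//; apply: le_trans hk; apply: survr_nincr; exact: leq_maxr.
have h1 := P_ge (leq_maxl n k).
have h2 := PleB (maxn n k).
have h3 : P m <= P n by apply: P_incr; apply: leq_trans mn; exact: leq_maxl.
move: h1; rewrite mulrBr => h1; rewrite -/(s n) in hn; lra.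
Qed.

End hitting_moments.

(** * Survival inequalities from one-step drift conditions *)

Section drift_survival.
Context {R : realType} (X : set R) (K : R.-pker R ~> R).
Hypotheses (mX : measurable X) (KX : forall x, X x -> K x X = 1%E).

Lemma kernel_setC x : X x -> K x (~` X) = 0%E.
Proof.
move=> Xx; have h : (K x setT = K x X + K x (~` X))%E.
  by rewrite -(setUv X); apply: measureU => //; [exact: measurableC|exact: setICr].
move: h; rewrite kernel_setT KX//; case: (K x (~` X)) => [r| |] // -[/eqP].
by rewrite eq_sym addrC -subr_eq0 addrK => /eqP ->.
Qed.

Lemma kernel_le_integral x (f g : R -> \bar R) : X x ->
  measurable_fun setT f -> measurable_fun setT g ->
  (forall z, 0 <= f z)%E -> (forall z, 0 <= g z)%E ->
  (forall z, X z -> f z <= g z)%E ->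
  (\int[K x]_z f z <= \int[K x]_z g z)%E.
Proof.
move=> Xx mf mg f0 g0 fg; apply: ae_ge0_le_integral => //.
exists (~` X); split; [exact: measurableC|exact: kernel_setC|].
by move=> z h Xz; apply: h => _; exact: fg.
Qed.

Lemma kernel_integral_le2 x (f g1 g2 : R -> R) (c1 c2 d r1 r2 : R) : X x ->
  measurable_fun setT f -> measurable_fun setT g1 -> measurable_fun setT g2 ->
  (forall z, 0 <= f z) -> (forall z, 0 <= g1 z) -> (forall z, 0 <= g2 z) ->
  0 <= c1 -> 0 <= c2 -> 0 <= d ->
  (forall z, X z -> f z <= c1 * g1 z + c2 * g2 z + d) ->
  (\int[K x]_z (g1 z)%:E <= r1%:E)%E -> (\int[K x]_z (g2 z)%:E <= r2%:E)%E ->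
  (\int[K x]_z (f z)%:E <= (c1 * r1 + c2 * r2 + d)%:E)%E.
Proof.
move=> Xx mf mg1 mg2 f0 g10 g20 c10 c20 d0 fg r1P r2P.
have m1 : measurable_fun setT (fun z => (c1 * g1 z)%:E).
  by apply/measurable_EFinP; exact: measurable_funM.
have m2 : measurable_fun setT (fun z => (c2 * g2 z)%:E).
  by apply/measurable_EFinP; exact: measurable_funM.
apply: (@le_trans _ _ (\int[K x]_z ((c1 * g1 z)%:E + (c2 * g2 z)%:E + d%:E))%E).
  apply: kernel_le_integral => //.
  - exact/measurable_EFinP.
  - by apply: emeasurable_funD => //; exact: emeasurable_funD.
  - by move=> z; rewrite -!EFinD lee_fin !addr_ge0 ?mulr_ge0.
rewrite ge0_integralD//; last 2 first.
- by move=> z _; rewrite -!EFinD lee_fin !addr_ge0 ?mulr_ge0.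
- exact: emeasurable_funD.
rewrite ge0_integralD//; last 2 first.
- by move=> z _; rewrite lee_fin mulr_ge0.
- by move=> z _; rewrite lee_fin mulr_ge0.
rewrite integral_cst// kernel_setT mule1 !EFinD.
apply: leeD => //; apply: leeD.
- under eq_integral do rewrite EFinM.
  rewrite ge0_integralZl_EFin//; last 2 first.
    by move=> z _; rewrite lee_fin.
    exact/measurable_EFinP.
  by rewrite EFinM lee_wpmul2l.
- under eq_integral do rewrite EFinM.
  rewrite ge0_integralZl_EFin//; last 2 first.
    by move=> z _; rewrite lee_fin.
    exact/measurable_EFinP.
  by rewrite EFinM lee_wpmul2l.
Qed.

Lemma kernel_integral_le x (f g : R -> R) (c d r : R) : X x ->
  measurable_fun setT f -> measurable_fun setT g ->
  (forall z, 0 <= f z) -> (forall z, 0 <= g z) -> 0 <= c -> 0 <= d ->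
  (forall z, X z -> f z <= c * g z + d) ->
  (\int[K x]_z (g z)%:E <= r%:E)%E ->
  (\int[K x]_z (f z)%:E <= (c * r + d)%:E)%E.
Proof.
move=> Xx mf mg f0 g0 c0 d0 fg gr.
rewrite -[c * r](addr0) -[X in _ + X + d](mul0r 0).
apply: (@kernel_integral_le2 x f g (cst 0)) => //.
- by move=> z Xz; rewrite mul0r addr0; exact: fg.
- by rewrite integral0.
Qed.

Variable a : R.
Local Notation s := (survr K a).

(** Divided by lam k, the bound reads V / (lam k) + V / N. The first term is Markov's inequality for
    the time spent in (a, M), the second bounds the probability of passing [M] before hitting. One
    induction proves both together, so no exit time has to be defined. *)
Lemma survr_capped (V : R -> R) (M N lam : R) :
  measurable_fun setT V -> (forall z, 0 <= V z) -> 0 < N -> 0 <= lam ->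
  (forall x, X x -> M <= x -> N <= V x) ->
  (forall x, X x -> a < x -> x < M -> (\int[K x]_z (V z)%:E <= (V x - lam)%:E)%E) ->
  forall k x, X x -> lam * k%:R * s k x <= (1 + lam * k%:R / N) * V x.
Proof.
move=> mV V0 N0 lam0 VM dV; elim=> [|k ih] x Xx.
  by rewrite !mulr0 !mul0r addr0 mul1r.
have lk n : 0 <= lam * n%:R by rewrite mulr_ge0.
have lkN n : 0 <= lam * n%:R / N by rewrite divr_ge0// ltW.
have [xa|ax] := leP x a.
  by rewrite survr_out// mulr0 mulr_ge0// addr_ge0.
have [Mx|xM] := leP M x.
  apply: (@le_trans _ _ (lam * k.+1%:R)); first by rewrite ler_piMr// survr_le1.
  rewrite mulrDl mul1r -[leLHS]add0r lerD// -mulrA ler_peMr//.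
  by rewrite mulrC ler_pdivlMr// mul1r VM.
have := @kernel_integral_le x (fun z => lam * k%:R * s k z) V (1 + lam * k%:R / N) 0
   (V x - lam) Xx.
move=> /(_ _ _ _ _ _ _ _ _)/wrap[].
- by apply: measurable_funM => //; exact: measurable_survr.
- exact: mV.
- by move=> z; rewrite mulr_ge0// survr_ge0.
- exact: V0.
- by rewrite addr_ge0.
- by [].
- by move=> z Xz; rewrite addr0; exact: ih.
- exact: dV.
under eq_integral do rewrite EFinM.
rewrite ge0_integralZl_EFin//; last 2 first.
- by move=> z _; rewrite lee_fin survr_ge0.
- by apply/measurable_EFinP; exact: measurable_survr.
rewrite survrS// -EFinM lee_fin addr0 => h.
have s1 := survr_le1 K a k.+1 x.
have h1 : lam * s k.+1 x <= lam by rewrite ler_piMr.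
have h2 : lam * k%:R / N * V x <= lam * k.+1%:R / N * V x.
  by rewrite ler_wpM2r// ler_wpM2r ?invr_ge0 ?(ltW N0)// ler_wpM2l// ler_nat.
have h3 : 0 <= lam * k%:R / N * lam by rewrite mulr_ge0.
rewrite -natr1 in h2 *.
by move: h; rewrite mulrBr !mulrDl !mul1r !mulrDr mulr1 mulrDl in h2 * ; lra.
Qed.

(** The expected sum of g along the path before hitting is at most V x. Each of the first j times
    contributes to it at least s (k + j) / A, by the survival bound for k further steps. *)
Lemma survr_shifted (V g : R -> R) (A : R) (k : nat) :
  measurable_fun setT V -> (forall z, 0 <= V z) -> 0 <= A ->
  (forall x, X x -> a < x -> s k x <= A * g x) ->
  (forall x, X x -> a < x -> (\int[K x]_z (V z)%:E <= (V x - g x)%:E)%E) ->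
  forall j x, X x -> j%:R * s (k + j) x <= A * V x.
Proof.
move=> mV V0 A0 sg dV; elim=> [|j ih] x Xx; first by rewrite mul0r mulr_ge0.
have [xa|ax] := leP x a; first by rewrite survr_out// mulr0 mulr_ge0.
have := @kernel_integral_le x (fun z => j%:R * s (k + j) z) V A 0 (V x - g x) Xx.
move=> /(_ _ _ _ _ _ _ _ _)/wrap[].
- by apply: measurable_funM => //; exact: measurable_survr.
- exact: mV.
- by move=> z; rewrite mulr_ge0// survr_ge0.
- exact: V0.
- by [].
- by [].
- by move=> z Xz; rewrite addr0; exact: ih.
- exact: dV.
under eq_integral do rewrite EFinM.
rewrite ge0_integralZl_EFin//; last 2 first.
- by move=> z _; rewrite lee_fin survr_ge0.
- by apply/measurable_EFinP; exact: measurable_survr.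
rewrite survrS// -EFinM lee_fin addr0 addnS -natr1 => h.
have h1 := sg x Xx ax.
have h2 : s (k + j).+1 x <= s k x by apply: survr_nincr; rewrite -addnS leq_addr.
by move: h; rewrite mulrBr mulrDl mul1r; lra.
Qed.

(** Optional stopping as an induction: paths already at or below [a] account for at most [A0], all
    others for at most [kap]. States beyond [M] are settled by hypothesis for every horizon up to
    [n], so the submartingale property is used only below [M]. *)
Lemma survr_lower (phi : R -> R) (M kap A0 : R) (n : nat) :
  measurable_fun setT phi -> (forall z, 0 <= phi z) -> 0 <= kap -> 0 <= A0 ->
  (forall x, X x -> a < x -> x < M -> phi x <= kap) ->
  (forall x, X x -> a < x -> x < M -> ((phi x)%:E <= \int[K x]_z (phi z)%:E)%E) ->
  (forall x, X x -> x <= a -> phi x <= A0) ->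
  (forall x, X x -> M <= x -> forall m, (m <= n)%N -> phi x <= kap * s m x + A0) ->
  forall m x, (m <= n)%N -> X x -> phi x <= kap * s m x + A0.
Proof.
move=> mphi phi0 kap0 A00 phik dphi phia phiM; elim=> [|m ih] x mn Xx.
  have [xa|ax] := leP x a.
    by rewrite survr_out// mulr0 add0r phia.
  have [Mx|xM] := leP M x; first exact: phiM.
  by rewrite survr0// mulr1; have := phik x Xx ax xM; lra.
have [xa|ax] := leP x a; first by rewrite survr_out// mulr0 add0r phia.
have [Mx|xM] := leP M x; first exact: phiM.
rewrite -lee_fin; apply: (le_trans (dphi x Xx ax xM)).
apply: (@kernel_integral_le x phi (s m)) => //.
- exact: measurable_survr.
- by move=> z; exact: survr_ge0.
- by move=> z Xz; apply: ih => //; exact: ltnW.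
- by rewrite survrS.
Qed.

(** Markov's inequality for psi at the hitting time: psi is at least 1 there, while its mean has
    grown by at most n eta. *)
Lemma survr_slow (psi : R -> R) (eta : R) :
  measurable_fun setT psi -> (forall z, 0 <= psi z) -> 0 <= eta ->
  (forall x, X x -> x <= a -> 1 <= psi x) ->
  (forall x, X x -> a < x -> (\int[K x]_z (psi z)%:E <= (psi x + eta)%:E)%E) ->
  forall n x, X x -> 1 <= s n x + psi x + n%:R * eta.
Proof.
move=> mpsi psi0 eta0 psia dpsi; elim=> [|n ih] x Xx.
  have [xa|ax] := leP x a.
    by rewrite survr_out// mul0r add0r addr0 psia.
  by rewrite survr0// mul0r addr0 lerDl.
have ne k : 0 <= k%:R * eta by rewrite mulr_ge0.
have [xa|ax] := leP x a.
  by rewrite survr_out// add0r ler_wpDr// psia.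
have := @kernel_integral_le2 x (cst 1) (s n) psi 1 1 (n%:R * eta) (s n.+1 x) (psi x + eta) Xx.
move=> /(_ _ _ _ _ _ _ _ _ _ _ _ _)/wrap[] => //.
- exact: measurable_survr.
- by move=> z; exact: survr_ge0.
- by move=> z Xz; rewrite !mul1r; exact: ih.
- by rewrite survrS.
- exact: dpsi.
have -> : (\int[K x]_z (cst 1 z)%:E = 1)%E.
  transitivity (\int[K x]_(z in setT) (cst 1%E z))%E; first by [].
  by rewrite integral_cst// mul1e kernel_setT.
rewrite lee_fin -natr1 !mul1r => h.
by rewrite mulrDl mul1r; lra.
Qed.

End drift_survival.

(** * Drift of power functions under heavy-tailed jumps *)

Lemma powR_decay (R : realType) (B e p x : R) : 0 <= B -> 0 < e -> 0 < p -> 0 < x ->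
  (2 * B / e) `^ p^-1 <= x -> B * x `^ (- p) <= e / 2.
Proof.
move=> B0 e0 p0 x0 hx; rewrite powRN ler_pdivrMr ?powR_gt0//.
have BE0 : 0 <= 2 * B / e by rewrite !mulr_ge0// invr_ge0 ltW.
have : (2 * B / e) `^ p^-1 `^ p <= x `^ p.
  by apply: ge0_ler_powR; rewrite ?nnegrE ?powR_ge0 ?(ltW p0) ?(ltW x0).
rewrite -powRrM mulVf ?gt_eqF// powRr1// ler_pdivrMr//; lra.
Qed.

Section jumps.
Context {R : realType} (K : R.-pker R ~> R).
Let mu : {measure set _ -> \bar R} := @lebesgue_measure R.

Lemma pos_part_ge0 (y : R) : 0 <= pos_part y.
Proof. by rewrite /pos_part; case: ifP. Qed.

Lemma neg_part_ge0 (y : R) : 0 <= neg_part y.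
Proof. by rewrite /neg_part; case: ifP => // /ltW; rewrite oppr_ge0. Qed.

Lemma pos_part_id (y : R) : 0 <= y -> pos_part y = y.
Proof. by rewrite /pos_part => ->. Qed.

Lemma pos_part_neg (y : R) : y < 0 -> pos_part y = 0.
Proof. by rewrite /pos_part ltNge; case: leP. Qed.

Lemma neg_part_neg (y : R) : y < 0 -> neg_part y = - y.
Proof. by rewrite /neg_part => ->. Qed.

Lemma measurable_pos_part x : measurable_fun setT (fun z : R => pos_part (z - x)).
Proof.
apply: measurable_fun_ifT => //.
- by apply: measurable_fun_ler => //; exact: measurable_funB.
- exact: measurable_funB.
Qed.

Lemma measurable_neg_part x : measurable_fun setT (fun z : R => neg_part (z - x)).
Proof.
apply: measurable_fun_ifT => //.
- by apply: measurable_fun_ltr => //; exact: measurable_funB.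
- by apply: measurableT_comp => //; exact: measurable_funB.
Qed.

Lemma measurable_jump_gt (x t : R) : measurable [set z : R | t < pos_part (z - x)].
Proof.
rewrite [X in measurable X](_ : _ = (fun z => t < pos_part (z - x)) @^-1` [set true]); last first.
  by apply/seteqP; split.
have : measurable_fun setT (fun z : R => t < pos_part (z - x)).
  by apply: measurable_fun_ltr => //; exact: measurable_pos_part.
by move=> /(_ measurableT [set true]); rewrite setTI; exact.
Qed.

Lemma kernel_le1 x (A : set R) : measurable A -> (K x A <= 1)%E.
Proof. by move=> mA; rewrite -(kernel_setT K x); apply: le_measure; rewrite ?inE. Qed.

Lemma jump_tailE x t : K x [set z | t < pos_part (z - x)] = (jump_tail K x t)%:E.
Proof.
rewrite /jump_tail fineK// ge0_fin_numE//.
by apply: le_lt_trans (kernel_le1 _ (measurable_jump_gt x t)) _; exact: ltry.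
Qed.

Lemma jump_tail_ge0 x t : 0 <= jump_tail K x t.
Proof. by rewrite -lee_fin -jump_tailE. Qed.

Lemma jump_tail_le1 x t : jump_tail K x t <= 1.
Proof. by rewrite -lee_fin -jump_tailE kernel_le1//; exact: measurable_jump_gt. Qed.

Lemma measurable_jump_tail x : measurable_fun setT (jump_tail K x).
Proof.
apply: nonincreasing_measurable => // t t' tt'.
rewrite -lee_fin -!jump_tailE; apply: le_measure; rewrite ?inE; [exact: measurable_jump_gt..|].
by move=> z /=; exact: le_lt_trans.
Qed.

(** An alias of [K x] on which the probability structure is declared; Tonelli and the integrability
    of constants are applied through it. *)
Definition step_law (x : R) : set R -> \bar R := K x.

HB.instance Definition _ x := Measure.copy (step_law x) (K x).

HB.instance Definition _ x := Measure_isProbability.Build _ _ _ (step_law x) (kernel_setT K x).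

Lemma layer_cake x (w : R -> R) : measurable_fun setT w -> (forall t, 0 <= w t) ->
  (\int[K x]_z (\int[mu]_(t in `]0%R, pos_part (z - x)[) (w t)%:E) =
   \int[mu]_(t in `]0%R, +oo[) (w t * jump_tail K x t)%:E)%E.
Proof.
move=> mw w0.
have := @tonelli_tail _ _ R (step_law x) (fun=> 1) (fun z => pos_part (z - x)) w
  (measurable_cst _) (measurable_pos_part x) mw (fun=> ler01) w0.
move=> h; transitivity (\int[step_law x]_z (1 * \int[mu]_(t in `]0%R, pos_part (z - x)[) (w t)%:E))%E.
  by apply: eq_integral => z _; rewrite mul1e.
rewrite h; apply: eq_integral => t _.
rewrite (_ : (\int[K x]_(z in _) _)%E = (jump_tail K x t)%:E) ?EFinM//.
transitivity (\int[K x]_(z in [set z | (t < pos_part (z - x))%R]) (cst 1%E z))%E; first by [].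
by rewrite integral_cst ?mul1e ?jump_tailE//; exact: measurable_jump_gt.
Qed.

Lemma integral_powR_primitive (p g : R) : 0 < p -> 0 <= g ->
  (\int[mu]_(t in `]0%R, g[) (p * t `^ (p - 1))%:E = (g `^ p)%:E)%E.
Proof.
move=> p0; rewrite le_eqVlt => /predU1P[<-|g0].
  by rewrite set_itvoo0 integral_set0 powR0// gt_eqF.
rewrite -(@integral_itv_bndoo _ 0 g _ false false); last first.
  apply/measurable_EFinP; apply: measurable_funTS; exact: measurable_funM.
under eq_integral do rewrite EFinM.
rewrite ge0_integralZl_EFin ?(ltW p0)//; last 2 first.
- by move=> *; rewrite lee_fin powR_ge0.
- by apply/measurable_EFinP; apply: measurable_funTS; exact: measurable_powR.
rewrite integral_powR_0 ?subrK//; last lra.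
by rewrite -EFinM mulrCA mulfV ?mulr1// gt_eqF.
Qed.

Definition taylor_rest (nu x y : R) : R := (x + y) `^ nu - x `^ nu - nu * x `^ (nu - 1) * y.

(** The absolute value of the derivative in t of [taylor_rest nu x t]; the derivative itself has the
    sign of [nu - 1]. *)
Definition rest_weight (nu x t : R) : R := nu * `|(x + t) `^ (nu - 1) - x `^ (nu - 1)|.

Lemma powRD_scale (p x t : R) : 0 < x -> 0 <= t ->
  (x + t) `^ p = x `^ p * (1 + t / x) `^ p.
Proof.
move=> x0 t0; rewrite -powRM ?ltW// ?ltr_wpDr// ?divr_ge0// ?ltW//.
by congr (_ `^ _); field; lra.
Qed.

Lemma measurable_rest_weight nu x : measurable_fun setT (rest_weight nu x).
Proof.
apply: measurable_funM => //; apply: measurableT_comp => //.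
by apply: measurable_funB => //; exact: measurable_powRD.
Qed.

Lemma rest_weight_ge0 nu x t : 0 <= nu -> 0 <= rest_weight nu x t.
Proof. by move=> n0; rewrite mulr_ge0. Qed.

Lemma rest_weightE nu x t : 0 < x -> 0 <= t ->
  rest_weight nu x t = nu * x `^ (nu - 1) * `|(1 + t / x) `^ (nu - 1) - 1|.
Proof.
move=> x0 t0; rewrite /rest_weight powRD_scale// -[X in _ - X]mulr1 -mulrBr normrM.
by rewrite (ger0_norm (powR_ge0 _ _)) mulrA.
Qed.

Lemma rest_weight_sg nu x t : 0 < x -> 0 <= t ->
  rest_weight nu x t = nu * (Num.sg (nu - 1) * ((x + t) `^ (nu - 1) - x `^ (nu - 1))).
Proof.
move=> x0 t0; rewrite rest_weightE// -sgr_powR1D_sub1 ?divr_ge0// ?ltW//.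
rewrite (powRD_scale (nu - 1) x0 t0); ring.
Qed.

(** Since |nu - 1| <= 1, Bernoulli gives |(1 + u)^(nu - 1) - 1| <= u. This controls jumps too small
    for the tail asymptotics: they contribute O(x^(nu - 2)), negligible against x^(nu - alpha). *)
Lemma rest_weight_le nu x t : 0 < nu < 2 -> 0 < x -> 0 <= t ->
  rest_weight nu x t <= nu * x `^ (nu - 2) * t.
Proof.
move=> /andP[n0 n2] x0 t0; rewrite rest_weightE//.
have u0 : 0 <= t / x by rewrite divr_ge0// ltW.
have -> : nu * x `^ (nu - 2) * t = nu * x `^ (nu - 1) * (t / x).
  have -> : x `^ (nu - 1) = x `^ (nu - 2) * x.
    by rewrite -[X in _ * X]powRr1 ?ltW// -powRD_gt0//; congr (_ `^ _); ring.
  by field; lra.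
apply: ler_wpM2l; first by rewrite mulr_ge0 ?powR_ge0// ltW.
rewrite -sgr_powR1D_sub1//; have [n1|n1] := leP 1 nu.
  have h := @bernoulli_le _ (nu - 1) (t / x).
  have {}h : (1 + t / x) `^ (nu - 1) <= 1 + (nu - 1) * (t / x) by apply: h; lra.
  have [->|n11] := eqVneq nu 1; first by rewrite subrr sgr0 mul0r.
  rewrite gtr0_sg; last by rewrite subr_gt0 lt_neqAle eq_sym n11.
  nra.
have h := @bernoulli_ge_neg _ (nu - 1) (t / x).
have {}h : 1 + (nu - 1) * (t / x) <= (1 + t / x) `^ (nu - 1) by apply: h; lra.
by rewrite ltr0_sg ?subr_lt0//; nra.
Qed.

Lemma integral_rest_weight nu x g : 0 < x -> 0 <= g ->
  (\int[mu]_(t in `]0%R, g[) (rest_weight nu x t)%:E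
    = (Num.sg (nu - 1) * taylor_rest nu x g)%:E)%E.
Proof.
move=> x0; rewrite le_eqVlt => /predU1P[<-|g0].
  by rewrite set_itvoo0 integral_set0 /taylor_rest addr0 subrr mulr0 subrr mulr0.
pose F t := Num.sg (nu - 1) * ((x + t) `^ nu - nu * x `^ (nu - 1) * t).
have -> : Num.sg (nu - 1) * taylor_rest nu x g = F g - F 0.
  by rewrite /F /taylor_rest addr0; ring.
apply: integral_FTC_oo => //.
- exact: measurable_rest_weight.
- move=> t /andP[t0 _]; have xt : 0 < x + t by rewrite ltr_wpDr.
  have d1 := is_derive_powRD nu xt.
  have d2 : is_derive t 1 (fun t => nu * x `^ (nu - 1) * t) (nu * x `^ (nu - 1) *: 1).
    exact: (@is_deriveZ _ _ _ (@id R)).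
  have d3 := is_deriveB d1 d2.
  have d4 := @is_deriveZ _ _ _ _ (Num.sg (nu - 1)) _ _ _ d3.
  rewrite rest_weight_sg//; apply: is_derive_eq.
  by rewrite /GRing.scale/=; ring.
- move=> t /andP[t0 _]; have xt : 0 < x + t by rewrite ltr_wpDr.
  apply: cvgM; first exact: cvg_cst.
  apply: cvg_norm; apply: cvgB; last exact: cvg_cst.
  exact: continuous_powRD.
Qed.

Lemma integral_rest_weight_tail alpha nu x : 1 < alpha < 2 -> 0 < nu < alpha -> 0 < x ->
  (\int[mu]_(t in `]0%R, +oo[) (rest_weight nu x t * t `^ (- alpha))%:E
    = (nu * `|betaJ alpha nu| * x `^ (nu - alpha))%:E)%E.
Proof.
move=> a12 /andP[n0 na] x0.
have h := @integral_subst_monomial R x 0 (fun t => rest_weight nu x t * t `^ (- alpha)) x0.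
rewrite h; last 2 first.
- move=> t t0; have xt : 0 < x + t by lra.
  apply: cvgM; last exact: continuous_powR_pt.
  apply: cvgM; first exact: cvg_cst.
  apply: cvg_norm; apply: cvgB; last exact: cvg_cst.
  exact: continuous_powRD.
- by move=> t t0; rewrite mulr_ge0 ?powR_ge0// rest_weight_ge0// ltW.
transitivity (\int[mu]_(t in `]0%R, +oo[) ((nu * x `^ (nu - alpha))%:E *
  (`|(1 + t) `^ (nu - 1) - 1| * t `^ (- alpha))%:E))%E.
  apply: eq_integral => t; rewrite inE/= in_itv/= andbT => t0.
  rewrite expr1 expr0 !mulr1 -EFinM; congr EFin.
  have xt : 0 <= x * t by rewrite mulr_ge0// ltW.
  rewrite rest_weightE// powRM ?ltW//.
  have -> : x * t / x = t by field; lra.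
  have -> : nu - alpha = (nu - 1) + (- alpha + 1) by ring.
  rewrite !(powRD_gt0 _ _ x0) powRr1 ?ltW//.
  ring.
rewrite ge0_integralZl_EFin//; last 3 first.
- by move=> t _; rewrite lee_fin mulr_ge0 ?powR_ge0.
- apply/measurable_EFinP; apply: measurable_funTS; apply: measurable_funM; last exact: measurable_powR.
  by apply: measurableT_comp => //; apply: measurable_funB => //; exact: measurable_powRD.
- by rewrite mulr_ge0 ?powR_ge0// ltW.
rewrite integral_norm_powR1D_sub1// -EFinM; congr EFin; ring.
Qed.

End jumps.

(** * Moments of the jumps and the drift expansion of x^nu *)

Section heavy_tail.
Context {R : realType} (X : set R) (K : R.-pker R ~> R) (alpha beta c x0 M : R).
Hypotheses (mX : measurable X) (X0 : forall x, X x -> 0 <= x)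
  (KX : forall x, X x -> K x X = 1%E).
Hypotheses (alpha12 : 1 < alpha < 2) (alphabeta : alpha < beta) (c0 : 0 < c).
Hypothesis tailK : forall e : R, 0 < e -> exists Y : R, forall y : R, Y <= y ->
  forall x, X x -> x0 <= x -> `| y `^ alpha * jump_tail K x y - c | <= e.
Hypothesis negK : forall x, X x -> x0 <= x -> (neg_jump_moment K beta x <= M%:E)%E.
Let mu : {measure set _ -> \bar R} := @lebesgue_measure R.

Let hyps : [/\ 0 < c, alpha < beta & 1 < alpha < 2].
Proof. by []. Qed.

Lemma jump_tail_bounds (e : R) : 0 < e -> exists2 Y : R, 1 <= Y &
  forall y, Y <= y -> forall x, X x -> x0 <= x ->
    (c - e) * y `^ (- alpha) <= jump_tail K x y <= (c + e) * y `^ (- alpha).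
Proof.
move=> /tailK[Y hY]; exists (Num.max 1 Y); first by rewrite le_max lexx.
move=> y; rewrite ge_max => /andP[y1 yY] x Xx xx0.
have y0 : 0 < y by lra.
have p0 : 0 < y `^ alpha by exact: powR_gt0.
have := hY y yY x Xx xx0; rewrite ler_norml => /andP[h1 h2].
rewrite powRN ler_pdivrMr// ler_pdivlMr// [_ * y `^ alpha]mulrC.
by apply/andP; split; lra.
Qed.

Lemma le_weighted_tail (w : R -> R) (Y B x : R) : measurable_fun setT w ->
  (forall t, 0 <= w t) -> 0 < Y -> X x -> x0 <= x -> 0 <= B ->
  (forall t, Y <= t -> jump_tail K x t <= B * t `^ (- alpha)) ->
  (\int[mu]_(t in `]0%R, +oo[) (w t * jump_tail K x t)%:E <=
   \int[mu]_(t in `]0%R, Y]) (w t)%:E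
   + B%:E * \int[mu]_(t in `[Y, +oo[) (w t * t `^ (- alpha))%:E)%E.
Proof.
move=> mw w0 Y0 Xx xx0 B0 hT.
have mwT : measurable_fun setT (fun t => w t * jump_tail K x t).
  by apply: measurable_funM => //; exact: measurable_jump_tail.
have mwp : measurable_fun setT (fun t => w t * t `^ (- alpha)).
  by apply: measurable_funM => //; exact: measurable_powR.
rewrite (@integral_0y_split _ _ Y)//; last 2 first.
- exact/measurable_EFinP.
- by move=> t; rewrite lee_fin mulr_ge0// jump_tail_ge0.
rewrite -ge0_integralZl_EFin//; last 2 first.
- by move=> t _; rewrite lee_fin mulr_ge0// powR_ge0.
- by apply/measurable_EFinP; exact: measurable_funTS.
apply: leeD; apply: ge0_le_integral => //.
- by move=> t _; rewrite lee_fin mulr_ge0// jump_tail_ge0.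
- by apply/measurable_EFinP; exact: measurable_funTS.
- by apply/measurable_EFinP; exact: measurable_funTS.
- by move=> t _; rewrite lee_fin ler_piMr// jump_tail_le1.
- by move=> t _; rewrite lee_fin mulr_ge0// jump_tail_ge0.
- by apply/measurable_EFinP; exact: measurable_funTS.
- apply/measurable_EFinP; apply: measurable_funTS; apply: measurable_funM => //.
- move=> t; rewrite /= in_itv/= andbT => Yt; rewrite -EFinM lee_fin mulrCA.
  by apply: ler_wpM2l => //; exact: hT.
Qed.

Lemma pos_jump_moment p : 0 < p < alpha -> exists2 C, 0 <= C &
  forall x, X x -> x0 <= x -> (\int[K x]_z (pos_part (z - x) `^ p)%:E <= C%:E)%E.
Proof.
have [c0' ab' a12'] := hyps.
move=> /andP[p0 pa]; have [Y Y1 hY] := jump_tail_bounds ltr01.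
have Y0 : 0 < Y by lra.
exists (Y `^ p + (c + 1) * (p * (Y `^ (p - alpha) / (alpha - p)))).
  have h1 : 0 <= c + 1 by lra.
  have h2 : 0 <= alpha - p by lra.
  by rewrite addr_ge0 ?powR_ge0// !mulr_ge0 ?invr_ge0 ?powR_ge0// ltW.
move=> x Xx xx0.
pose w t := p * t `^ (p - 1).
have mw : measurable_fun setT w by apply: measurable_funM => //; exact: measurable_powR.
have w0 t : 0 <= w t by rewrite mulr_ge0 ?powR_ge0// ltW.
have -> : (\int[K x]_z (pos_part (z - x) `^ p)%:E =
    \int[mu]_(t in `]0%R, +oo[) (w t * jump_tail K x t)%:E)%E.
  rewrite -layer_cake//; apply: eq_integral => z _.
  by rewrite integral_powR_primitive// pos_part_ge0.
apply: (le_trans (le_weighted_tail (Y := Y) (B := c + 1) mw w0 Y0 Xx xx0 _ _)).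
- lra.
- by move=> t Yt; have /andP[] := hY t Yt x Xx xx0.
rewrite [leRHS]EFinD; apply: leeD.
  rewrite -integral_powR_primitive ?(ltW Y0)//.
  rewrite -(@integral_itv_bndoo _ 0 Y _ false false)//.
  by apply/measurable_EFinP; exact: measurable_funTS.
rewrite EFinM lee_wpmul2l ?lee_fin//; first lra.
under eq_integral => t.
  rewrite inE/= in_itv/= andbT => Yt.
  rewrite /w -mulrA -powRD_gt0; last lra.
  rewrite EFinM; over.
rewrite /= ge0_integralZl_EFin//; last 3 first.
- by move=> t _; rewrite lee_fin powR_ge0.
- by apply/measurable_EFinP; apply: measurable_funTS; exact: measurable_powR.
- exact: ltW.
rewrite integral_powR_y//; last lra.
rewrite -EFinM lee_fin le_eqVlt; apply/orP; left; apply/eqP.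
by congr (_ * (_ `^ _ / _)); ring.
Qed.

Lemma neg_jump_moment_le p x : 0 <= p <= beta -> X x -> x0 <= x ->
  (\int[K x]_z (neg_part (z - x) `^ p)%:E <= (1 + M)%:E)%E.
Proof.
move=> /andP[p0 pb] Xx xx0; rewrite addrC -[M](mul1r).
have mn (r : R) : measurable_fun setT (fun z : R => neg_part (z - x) `^ r).
  apply: (@measurableT_comp _ _ _ _ _ _ (@powR R ^~ r)); first exact: measurable_powR.
  exact: measurable_neg_part.
apply: (@kernel_integral_le _ X K mX KX x _ (fun z => neg_part (z - x) `^ beta)) => //.
- by move=> z; exact: powR_ge0.
- by move=> z; exact: powR_ge0.
- move=> z Xz; rewrite mul1r; have [n1|n1] := leP 1 (neg_part (z - x)).
    by rewrite ler_wpDr// ler_powR.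
  rewrite ler_wpDl ?powR_ge0//.
  have [->|n0] := eqVneq (neg_part (z - x)) 0.
    by rewrite /powR eqxx; case: (p == 0) => //=.
  rewrite -(powRr0 (neg_part (z - x))) ger_powR// ltW// andbT lt_neqAle eq_sym n0.
  exact: neg_part_ge0.
- exact: negK.
Qed.

Lemma M_ge0 x : X x -> x0 <= x -> 0 <= M.
Proof.
move=> Xx xx0; rewrite -lee_fin; apply: le_trans (negK Xx xx0).
by apply: integral_ge0 => z _; rewrite lee_fin powR_ge0.
Qed.

Lemma abs_jump_moment p : 0 < p < alpha -> exists2 C, 0 <= C &
  forall x, X x -> x0 <= x -> (\int[K x]_z (`|z - x| `^ p)%:E <= C%:E)%E.
Proof.
have [c0' ab' a12'] := hyps.
move=> /[dup] p0a /andP[p0 pa]; have [C C0 hC] := pos_jump_moment p0a.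
exists (C + (1 + Num.max 0 M)).
  by rewrite !addr_ge0// le_max lexx.
move=> x Xx xx0.
have -> : C + (1 + Num.max 0 M) = 1 * C + 1 * (1 + Num.max 0 M) + 0 by ring.
have mpow (f : R -> R) : measurable_fun setT f -> measurable_fun setT (fun z => f z `^ p).
  by move=> mf; apply: (@measurableT_comp _ _ _ _ _ _ (@powR R ^~ p)) => //; exact: measurable_powR.
apply: (@kernel_integral_le2 _ X K mX KX x _ (fun z => pos_part (z - x) `^ p)
  (fun z => neg_part (z - x) `^ p)) => //.
- by apply: mpow; apply: measurableT_comp => //; exact: measurable_funB.
- by apply: mpow; exact: measurable_pos_part.
- by apply: mpow; exact: measurable_neg_part.
- by move=> z; exact: powR_ge0.
- by move=> z; exact: powR_ge0.
- move=> z _; rewrite !mul1r addr0; have [z0|z0] := leP 0 (z - x).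
    by rewrite ger0_norm// pos_part_id// lerDl powR_ge0.
  by rewrite ltr0_norm// neg_part_neg// lerDr powR_ge0.
- exact: hC.
- apply: (le_trans (@neg_jump_moment_le p x _ Xx xx0)); first lra.
  by rewrite lee_fin lerD2l le_max lexx orbT.
Qed.

Lemma overshoot_moment nu : 0 < nu < alpha -> exists C Y : R, [/\ 0 <= C, 1 <= Y &
  forall (m x : R), Y <= m -> X x -> x0 <= x ->
  (\int[K x]_z (if (m < pos_part (z - x))%R then pos_part (z - x) `^ nu else 0%R)%:E
    <= (C * m `^ (nu - alpha))%:E)%E].
Proof.
have [c0' ab' a12'] := hyps.
move=> /andP[n0 na]; have [Y Y1 hY] := jump_tail_bounds ltr01.
exists ((c + 1) * (nu / (alpha - nu)) + (c + 1)), Y; split => //.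
  have h1 : 0 <= c + 1 by lra.
  have h2 : 0 <= alpha - nu by lra.
  by rewrite addr_ge0// !mulr_ge0 ?invr_ge0// ltW.
move=> m x Ym Xx xx0.
have m0 : 0 < m by lra.
pose w t := if m < t then nu * t `^ (nu - 1) else 0.
have mw : measurable_fun setT w.
  apply: measurable_fun_ifT => //; first exact: measurable_fun_ltr.
  by apply: measurable_funM => //; exact: measurable_powR.
have w0 t : 0 <= w t by rewrite /w; case: ifP => // _; rewrite mulr_ge0 ?powR_ge0// ltW.
(* The layer cake sees only the excess g^nu - m^nu above the threshold. The missing m^nu is restored
   as m^nu times P(jump > m), of the same order m^(nu - alpha). *)
pose G (g : R) : R := if m < g then g `^ nu - m `^ nu else 0.
have wG g : 0 <= g -> (\int[mu]_(t in `]0%R, g[) (w t)%:E = (G g)%:E)%E.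
  move=> g0; rewrite /G; case: ltP => [mg|gm]; last first.
    apply: integral0_eq => t; rewrite /= in_itv/= => /andP[_ tg].
    by rewrite /w ltNge (le_trans (ltW tg) gm).
  transitivity (\int[mu]_(t in `]m, g[) (nu * t `^ (nu - 1))%:E)%E.
    rewrite integral_mkcond [RHS]integral_mkcond; apply: eq_integral => t _.
    rewrite !patchE; case: ifPn => [|]; rewrite ?inE ?notin_setE/= in_itv/=.
      move=> /andP[t0 tg]; rewrite /w; case: ltP => mt.
        by rewrite mem_set//= in_itv/= mt tg.
      by rewrite memNset//= in_itv/= ltNge mt.
    move=> h; rewrite memNset//= in_itv/= => /andP[mt tg]; apply: h.
    by rewrite (lt_trans m0 mt) tg.
  apply: (@integral_FTC_oo _ _ (@powR R ^~ nu) _ _ mg).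
  - by apply: measurable_funM => //; exact: measurable_powR.
  - move=> t /andP[mt _]; apply: is_derive1_powR; exact: lt_le_trans mt.
  - move=> t /andP[mt _]; apply: cvgM; first exact: cvg_cst.
    apply: continuous_powR_pt; exact: lt_le_trans mt.
have mpos := measurable_pos_part x.
have mif (f : R -> R) : measurable_fun setT f ->
    measurable_fun setT (fun z : R => if m < pos_part (z - x) then f z else 0).
  by move=> mf; apply: measurable_fun_ifT => //; exact: measurable_fun_ltr.
have mpow : measurable_fun setT (fun z : R => pos_part (z - x) `^ nu).
  by apply: (@measurableT_comp _ _ _ _ _ _ (@powR R ^~ nu)) => //; exact: measurable_powR.
have G0 g : 0 <= G g.
  rewrite /G; case: ifP => // mg; rewrite subr_ge0; apply: ge0_ler_powR; rewrite ?nnegrE; lra.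
have intG : (\int[K x]_z (G (pos_part (z - x)))%:E
    <= ((c + 1) * (nu / (alpha - nu)) * m `^ (nu - alpha))%:E)%E.
  have -> : (\int[K x]_z (G (pos_part (z - x)))%:E =
    \int[mu]_(t in `]0%R, +oo[) (w t * jump_tail K x t)%:E)%E.
    rewrite -layer_cake//; apply: eq_integral => z _.
    by rewrite wG// pos_part_ge0.
  apply: (le_trans (le_weighted_tail (Y := m) (B := c + 1) mw w0 m0 Xx xx0 _ _)).
  - lra.
  - by move=> t mt; have /andP[] := hY t (le_trans Ym mt) x Xx xx0.
  rewrite (_ : (\int[mu]_(t in _) _)%E = 0%E) ?add0e; last first.
    by apply: integral0_eq => t; rewrite /= in_itv/= => /andP[_ tm]; rewrite /w ltNge tm.
  rewrite -mulrA EFinM lee_wpmul2l ?lee_fin//; first lra.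
  rewrite -integral_itv_obnd_cbnd; last first.
    apply/measurable_EFinP; apply: measurable_funTS; exact: measurable_funM.
  under eq_integral => t.
    rewrite inE/= in_itv/= andbT => mt.
    rewrite /w mt -mulrA -powRD_gt0; last lra.
    rewrite EFinM; over.
  rewrite /= ge0_integralZl_EFin//; last 3 first.
  - by move=> t _; rewrite lee_fin powR_ge0.
  - by apply/measurable_EFinP; apply: measurable_funTS; exact: measurable_powR.
  - exact: ltW.
  rewrite integral_itv_obnd_cbnd; last first.
    by apply/measurable_EFinP; apply: measurable_funTS; exact: measurable_powR.
  rewrite integral_powR_y//; last lra.
  rewrite -EFinM lee_fin le_eqVlt; apply/orP; left; apply/eqP.
  have -> : nu - 1 - alpha + 1 = nu - alpha by ring.
  by field; lra.
have -> : ((c + 1) * (nu / (alpha - nu)) + (c + 1)) * m `^ (nu - alpha) =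
   1 * ((c + 1) * (nu / (alpha - nu)) * m `^ (nu - alpha)) + m `^ nu * ((c + 1) * m `^ (- alpha)) + 0.
  have -> : m `^ nu * ((c + 1) * m `^ (- alpha)) = (c + 1) * m `^ (nu - alpha).
    by rewrite powRD_gt0//; ring.
  ring.
apply: (@kernel_integral_le2 _ X K mX KX x _ (fun z => G (pos_part (z - x)))
  (fun z => if m < pos_part (z - x) then 1 else 0)) => //.
- exact: mif.
- by apply: mif; apply: measurable_funB.
- by apply: mif.
- by move=> z; case: ifP => // _; exact: powR_ge0.
- by move=> z; case: ifP.
- exact: powR_ge0.
- move=> z _; rewrite /G; case: ifP => _; last by rewrite !mulr0 !addr0.
  by rewrite mul1r mulr1 addr0 subrK.
- rewrite (_ : (\int[K x]_z _)%E = (jump_tail K x m)%:E).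
    by rewrite lee_fin; have /andP[] := hY m Ym x Xx xx0.
  rewrite -jump_tailE -[X in K x X]setIT -integral_indic//; last exact: measurable_jump_gt.
  apply: eq_integral => z _; rewrite indicE; congr EFin.
  by case: ifPn => h; [rewrite mem_set|rewrite memNset//; exact/negP].
Qed.

(** Beyond a fixed [Y] the tail lies between (c - d) t^(- alpha) and (c + d) t^(- alpha), uniformly
    in the starting point; the part below [Y] is O(x^(nu - 2)). The choice of [d] and the size of x
    each spend e / 2. *)
Lemma pos_rest_asymp nu (e : R) : 0 < nu < alpha -> 0 < e ->
  exists2 A : R, 1 <= A & forall x, X x -> x0 <= x -> A <= x ->
    exists2 r : R, `|r| <= e &
    (\int[K x]_z (Num.sg (nu - 1) * taylor_rest nu x (pos_part (z - x)))%:E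
      = (x `^ (nu - alpha) * (c * (nu * `|betaJ alpha nu|) + r))%:E)%E.
Proof.
have [c0' ab' /[dup] a12' /andP[al1 al2]] := hyps.
move=> /[dup] nua /andP[n0 na] e0.
pose J := nu * `|betaJ alpha nu|.
have J0 : 0 <= J by rewrite mulr_ge0// ltW.
have [d [d0 dc dJ]] : exists d, [/\ 0 < d, d <= c & d * J <= e / 2].
  have J1 : 0 < J + 1 by rewrite ltr_wpDl.
  pose d := Num.min c (e / 2 / (J + 1)).
  have d0 : 0 < d by rewrite lt_min c0' !divr_gt0.
  exists d; split => //; first by rewrite ge_min lexx.
  apply: (@le_trans _ _ (d * (J + 1))); first by rewrite ler_pM2l// lerDl.
  by rewrite -ler_pdivlMr// ge_min lexx orbT.
have [Y Y1 hY] := jump_tail_bounds d0.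
have Y0 : 0 < Y by lra.
have a2 : 0 < 2 - alpha by lra.
have [B [B0 nuY_B cnuY_B]] : exists B, [/\ 0 <= B, nu * Y ^+ 2 <= B &
    c * (nu * (Y `^ (2 - alpha) / (2 - alpha))) <= B].
  have h1 : 0 <= nu * Y ^+ 2 by rewrite mulr_ge0 ?exprn_ge0// ltW.
  have h2 : 0 <= c * (nu * (Y `^ (2 - alpha) / (2 - alpha))).
    by rewrite !mulr_ge0 ?powR_ge0 ?invr_ge0// ltW.
  by exists (nu * Y ^+ 2 + c * (nu * (Y `^ (2 - alpha) / (2 - alpha)))); rewrite addr_ge0// lerDl lerDr.
pose A := Num.max 1 ((2 * B / e) `^ (2 - alpha)^-1).
exists A; first by rewrite le_max lexx.
move=> x Xx xx0; rewrite ge_max => /andP[x1 xA].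
have x0' : 0 < x by lra.
have xB : B * x `^ (alpha - 2) <= e / 2 by rewrite -opprB; exact: powR_decay.
have w0 t : 0 <= rest_weight nu x t by rewrite rest_weight_ge0// ltW.
have mw := measurable_rest_weight nu x.
have nu2 : 0 < nu < 2 by lra.
rewrite (_ : (\int[K x]_z _)%E = (\int[mu]_(t in `]0%R, +oo[) (rest_weight nu x t * jump_tail K x t)%:E)%E); last first.
  rewrite -layer_cake//; apply: eq_integral => z _.
  by rewrite integral_rest_weight// pos_part_ge0.
pose S := (\int[mu]_(t in `]0%R, +oo[) (rest_weight nu x t * jump_tail K x t)%:E)%E.
have mwp : measurable_fun setT (fun t => rest_weight nu x t * t `^ (- alpha)).
  by apply: measurable_funM => //; exact: measurable_powR.
have xs : x `^ (nu - 2) = x `^ (nu - alpha) * x `^ (alpha - 2).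
  by rewrite -powRD_gt0//; congr (_ `^ _); ring.
have full := integral_rest_weight_tail a12' nua x0'.
have Sle : (S <= (x `^ (nu - alpha) * (c * J + e))%:E)%E.
  apply: (le_trans (le_weighted_tail (Y := Y) (B := c + d) mw w0 Y0 Xx xx0 _ _)).
  - lra.
  - by move=> t Yt; have /andP[] := hY t Yt x Xx xx0.
  have h1 : (\int[mu]_(t in `]0%R, Y]) (rest_weight nu x t)%:E <= (nu * x `^ (nu - 2) * Y ^+ 2)%:E)%E.
    apply: (@le_trans _ _ (\int[mu]_(t in `]0%R, Y]) (cst (nu * x `^ (nu - 2) * Y)%:E t))%E); last first.
      rewrite integral_cst// [X in (_ * X)%E]lebesgue_measure_itv/= lte_fin Y0 -EFinB -EFinM subr0.
      by rewrite expr2 mulrA.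
    apply: ge0_le_integral => //.
    - by move=> t _; rewrite lee_fin.
    - by apply/measurable_EFinP; exact: measurable_funTS.
    - move=> t; rewrite /= in_itv/= => /andP[t0 tY]; rewrite lee_fin.
      apply: (le_trans (rest_weight_le nu2 x0' (ltW t0))).
      by rewrite ler_wpM2l// mulr_ge0 ?powR_ge0// ltW.
  have h2 : (\int[mu]_(t in `[Y, +oo[) (rest_weight nu x t * t `^ (- alpha))%:E <= (J * x `^ (nu - alpha))%:E)%E.
    rewrite -full; apply: ge0_subset_integral => //.
    - by apply/measurable_EFinP; exact: measurable_funTS.
    - by move=> t _; rewrite lee_fin mulr_ge0// powR_ge0.
    - by move=> t; rewrite /= !in_itv/= !andbT; exact: lt_le_trans.
  apply: (@le_trans _ _ ((nu * x `^ (nu - 2) * Y ^+ 2)%:E + (c + d)%:E * (J * x `^ (nu - alpha))%:E)%E).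
    by apply: leeD => //; apply: lee_wpmul2l => //; rewrite lee_fin; lra.
  rewrite -EFinM -EFinD lee_fin xs.
  have p0 : 0 <= x `^ (nu - alpha) by exact: powR_ge0.
  have q0 : 0 <= x `^ (alpha - 2) by exact: powR_ge0.
  have -> : nu * (x `^ (nu - alpha) * x `^ (alpha - 2)) * Y ^+ 2 + (c + d) * (J * x `^ (nu - alpha))
     = x `^ (nu - alpha) * (nu * Y ^+ 2 * x `^ (alpha - 2) + (c * J + d * J)) by ring.
  apply: ler_wpM2l => //.
  have : nu * Y ^+ 2 * x `^ (alpha - 2) <= B * x `^ (alpha - 2).
    exact: ler_wpM2r.
  lra.
have Sge : ((x `^ (nu - alpha) * (c * J - e))%:E <= S)%E.
  have h1 : (\int[mu]_(t in `]0%R, Y]) (rest_weight nu x t * t `^ (- alpha))%:E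
      <= (nu * x `^ (nu - 2) * (Y `^ (2 - alpha) / (2 - alpha)))%:E)%E.
    apply: (@le_trans _ _ (\int[mu]_(t in `]0%R, Y]) ((nu * x `^ (nu - 2))%:E * (t `^ (1 - alpha))%:E))%E); last first.
      rewrite ge0_integralZl_EFin//; last 3 first.
      - by move=> t _; rewrite lee_fin powR_ge0.
      - by apply/measurable_EFinP; apply: measurable_funTS; exact: measurable_powR.
      - by rewrite mulr_ge0 ?powR_ge0// ltW.
      rewrite integral_powR_0//; last lra.
      by have -> : 1 - alpha + 1 = 2 - alpha by ring.
    apply: ge0_le_integral => //.
    - by move=> t _; rewrite lee_fin mulr_ge0// powR_ge0.
    - by apply/measurable_EFinP; exact: measurable_funTS.
    - apply/measurable_EFinP; apply: measurable_funTS; apply: measurable_funM => //; exact: measurable_powR.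
    - move=> t; rewrite /= in_itv/= => /andP[t0 tY]; rewrite -EFinM lee_fin.
      have -> : t `^ (1 - alpha) = t * t `^ (- alpha).
        by rewrite -[X in X * _]powRr1 ?ltW// -powRD_gt0.
      rewrite mulrA ler_wpM2r ?powR_ge0//.
      exact: rest_weight_le nu2 x0' (ltW t0).
  (* The integral over (0, Y], absent from the tail estimate, is added on the right instead of
     subtracted on the left, since finiteness of [S] is not yet known. *)
  have h2 : ((c - d)%:E * (J * x `^ (nu - alpha))%:E <=
      S + c%:E * (nu * x `^ (nu - 2) * (Y `^ (2 - alpha) / (2 - alpha)))%:E)%E.
    apply: (@le_trans _ _ (S + c%:E * \int[mu]_(t in `]0%R, Y]) (rest_weight nu x t * t `^ (- alpha))%:E)%E); last first.
      by rewrite leeD2l// lee_wpmul2l// lee_fin ltW.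
    rewrite -full -!ge0_integralZl_EFin//; last 6 first.
    - by move=> t _; rewrite lee_fin mulr_ge0// powR_ge0.
    - by apply/measurable_EFinP; exact: measurable_funTS.
    - by rewrite ltW.
    - by move=> t _; rewrite lee_fin mulr_ge0// powR_ge0.
    - by apply/measurable_EFinP; exact: measurable_funTS.
    - by lra.
    rewrite (_ : (\int[mu]_(t in `]0%R, Y]) _)%E =
      (\int[mu]_(t in `]0%R, +oo[) (if t <= Y then c * (rest_weight nu x t * t `^ (- alpha)) else 0)%:E)%E); last first.
      rewrite integral_mkcond [RHS]integral_mkcond; apply: eq_integral => t _.
      rewrite !patchE; case: ifPn => [|]; rewrite ?inE ?notin_setE/= in_itv/=.
        by move=> /andP[t0 tY]; rewrite mem_set/= ?in_itv/= ?t0// tY EFinM.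
      case: ifPn => //; rewrite inE/= in_itv/= andbT => t0; rewrite t0/=.
      by move=> /negP/negbTE ->.
    rewrite /S -ge0_integralD//; last 4 first.
    - by move=> t _; rewrite lee_fin mulr_ge0// jump_tail_ge0.
    - apply/measurable_EFinP; apply: measurable_funTS; apply: measurable_funM => //; exact: measurable_jump_tail.
    - by move=> t _; rewrite lee_fin; case: ifP => // _; rewrite !mulr_ge0 ?powR_ge0// ltW.
    - apply/measurable_EFinP; apply: measurable_funTS; apply: measurable_fun_ifT => //.
        exact: measurable_fun_ler.
      exact: measurable_funM.
    apply: ge0_le_integral => //.
    - by move=> t _; rewrite -EFinM lee_fin mulr_ge0 ?subr_ge0// mulr_ge0 ?powR_ge0.
    - apply/measurable_EFinP; apply: measurable_funTS; exact: measurable_funM.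
    - apply: emeasurable_funD; apply/measurable_EFinP; apply: measurable_funTS.
        by apply: measurable_funM => //; exact: measurable_jump_tail.
      apply: measurable_fun_ifT => //; first exact: measurable_fun_ler.
      exact: measurable_funM.
    - move=> t; rewrite /= in_itv/= andbT => t0; rewrite -EFinM -EFinD lee_fin.
      have wp : 0 <= rest_weight nu x t * t `^ (- alpha) by rewrite mulr_ge0// powR_ge0.
      have wj : 0 <= rest_weight nu x t * jump_tail K x t by rewrite mulr_ge0// jump_tail_ge0.
      case: ifPn => [tY|]; first by rewrite mulrBl; nra.
      rewrite -ltNge addr0 mulrCA => Yt; apply: ler_wpM2l => //.
      by have /andP[] := hY t (ltW Yt) x Xx xx0.
  rewrite -(@leeD2rE _ (c * (nu * x `^ (nu - 2) * (Y `^ (2 - alpha) / (2 - alpha))))%:E)//.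
  move: h2; rewrite -!EFinM; apply: le_trans; rewrite -EFinD lee_fin xs.
  have p0 : 0 <= x `^ (nu - alpha) by exact: powR_ge0.
  have q0 : 0 <= x `^ (alpha - 2) by exact: powR_ge0.
  set D := Y `^ (2 - alpha) / (2 - alpha).
  have -> : x `^ (nu - alpha) * (c * J - e) + c * (nu * (x `^ (nu - alpha) * x `^ (alpha - 2)) * D)
     = x `^ (nu - alpha) * (c * J - e + c * (nu * D) * x `^ (alpha - 2)) by ring.
  have -> : (c - d) * (J * x `^ (nu - alpha)) = x `^ (nu - alpha) * (c * J - d * J) by ring.
  apply: ler_wpM2l => //.
  have : c * (nu * D) * x `^ (alpha - 2) <= B * x `^ (alpha - 2).
    exact: ler_wpM2r.
  lra.
have Sfin : S = (fine S)%:E.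
  rewrite fineK//; apply/fin_numPlt; rewrite (lt_le_trans _ Sge) ?ltNyr//.
  by rewrite (le_lt_trans Sle)// ltry.
have pg : 0 < x `^ (nu - alpha) by exact: powR_gt0.
exists (fine S / x `^ (nu - alpha) - c * J).
  rewrite Sfin !lee_fin in Sle Sge.
  rewrite ler_norml; apply/andP; split.
    by rewrite lerBrDl ler_pdivlMr// mulrC.
  by rewrite lerBlDl ler_pdivrMr// mulrC.
rewrite -/S Sfin; congr EFin.
by rewrite -/J /= [X in _ * X]addrC subrK mulrC divfK// gt_eqF.
Qed.

(** For an upward jump the two remainders coincide. For a downward one the relative size v = (x - z)
    / x is at most 1 because z >= 0, and the quadratic estimate v^2 <= v^kap applies. *)
Lemma taylor_rest_neg (nu kap x z : R) : 0 < nu < 2 -> 0 < kap <= 2 -> 0 < x -> 0 <= z ->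
  `|z `^ nu - x `^ nu - nu * x `^ (nu - 1) * (z - x) - taylor_rest nu x (pos_part (z - x))|
    <= x `^ (nu - kap) * neg_part (z - x) `^ kap.
Proof.
move=> /andP[n0 n2] /andP[k0 k2] xp z0; have [xz|zx] := leP 0 (z - x).
  rewrite pos_part_id// /taylor_rest.
  have -> : x + (z - x) = z by ring.
  by rewrite subrr normr0 mulr_ge0 ?powR_ge0.
rewrite pos_part_neg// neg_part_neg// /taylor_rest addr0 mulr0 !subr0 subrr subr0.
pose v := (x - z) / x.
have v0 : 0 < v by rewrite divr_gt0// -oppr_lt0 opprB.
have v1 : v <= 1 by rewrite ler_pdivrMr// mul1r; lra.
have zE : z = x * (1 - v) by rewrite /v; field; lra.
have -> : z `^ nu - x `^ nu - nu * x `^ (nu - 1) * (z - x) = x `^ nu * ((1 - v) `^ nu - 1 + nu * v).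
  rewrite {1}zE powRM; [|lra|lra].
  rewrite -[nu * x `^ (nu - 1) * (z - x)]mulrA; have -> : x `^ (nu - 1) * (z - x) = - (x `^ nu * v).
    have -> : z - x = - (x * v) by rewrite {1}zE; ring.
    rewrite mulrN mulrA; congr (- (_ * _)).
    by rewrite -[X in _ * X]powRr1 ?ltW// -powRD_gt0// subrK.
  ring.
rewrite normrM (ger0_norm (powR_ge0 _ _)).
have -> : x `^ (nu - kap) * (- (z - x)) `^ kap = x `^ nu * v `^ kap.
  rewrite opprB powRD_gt0// -mulrA; congr (_ * _).
  have -> : x - z = x * v by rewrite {1}zE; ring.
  rewrite powRM ?(ltW xp) ?(ltW v0)// mulrA -powRD_gt0//.
  by rewrite addNr powRr0 mul1r.
apply: ler_wpM2l; first exact: powR_ge0.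
have h := @powR1B_quad _ nu v.
have {}h : `|(1 - v) `^ nu - 1 + nu * v| <= v ^+ 2 by apply: h; lra.
apply: (le_trans h); rewrite -powR_mulrn ?(ltW v0)//.
by apply: ger_powR => //; rewrite v0.
Qed.

Lemma drift_asymp nu (e : R) : 0 < nu < alpha -> 0 < e ->
  exists2 A : R, 1 <= A & forall x, X x -> x0 <= x -> A <= x ->
    exists2 r : R, `|r| <= e &
    (\int[K x]_z (z `^ nu)%:E = (x `^ nu + nu * x `^ (nu - 1) * drift K x
       + x `^ (nu - alpha) * (c * (nu * betaJ alpha nu) + r))%:E)%E.
Proof.
have [c0' ab' /[dup] a12' /andP[al1 al2]] := hyps.
move=> /[dup] nua /andP[n0 na] e0.
(* Above [alpha], so x^(nu - kap) is of lower order than x^(nu - alpha); at most [beta], so the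
   moment exists; at most 2, as the quadratic estimate demands. *)
pose kap := Num.min beta 2.
have ka : alpha < kap by rewrite lt_min ab'.
have k2 : kap <= 2 by rewrite ge_min lexx orbT.
have kb : kap <= beta by rewrite ge_min lexx.
have e20 : 0 < e / 2 by rewrite divr_gt0.
have [A1 A11 hA1] := pos_rest_asymp nua e20.
have [B B0 BE] : exists2 B, 0 < B & B = 1 + `|M| by exists (1 + `|M|) => //; rewrite ltr_pwDl.
pose A2 := (2 * B / e) `^ (kap - alpha)^-1.
exists (Num.max A1 A2); first by rewrite le_max A11.
move=> x Xx xx0; rewrite ge_max => /andP[xA1 xA2].
have xp : 0 < x by lra.
have [r1 r1e hr1] := hA1 x Xx xx0 xA1.
pose s := Num.sg (nu - 1).
pose f1 (z : R) := z - x.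
pose f2 (z : R) := taylor_rest nu x (pos_part (z - x)).
pose g2 (z : R) := s * f2 z.
pose f3 (z : R) := z `^ nu - x `^ nu - nu * x `^ (nu - 1) * (z - x) - f2 z.
have mf1 : measurable_fun setT f1 by exact: measurable_funB.
have mpos := measurable_pos_part x.
have mpow p (f : R -> R) : measurable_fun setT f -> measurable_fun setT (fun z => f z `^ p).
  by move=> mf; apply: (@measurableT_comp _ _ _ _ _ _ (@powR R ^~ p)) => //; exact: measurable_powR.
have mf2 : measurable_fun setT f2.
  apply: measurable_funB; last exact: measurable_funM.
  by apply: measurable_funB => //; apply: mpow; exact: measurable_funD.
have mg2 : measurable_fun setT g2 by exact: measurable_funM.
have mf3 : measurable_fun setT f3.
  apply: measurable_funB => //; apply: measurable_funB; last exact: measurable_funM.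
  by apply: measurable_funB => //; exact: measurable_powR.
have nu2 : 0 < nu < 2 by lra.
have g20 z : 0 <= g2 z.
  rewrite -lee_fin /g2 /f2 -integral_rest_weight// ?pos_part_ge0//.
  by apply: integral_ge0 => t _; rewrite lee_fin rest_weight_ge0// ltW.
(* The sign squares to 1 except at nu = 1, where it is 0; there the remainder itself vanishes, so
   the identity survives. *)
have f2E z : f2 z = s * g2 z.
  rewrite /g2 mulrA -expr2 sqr_sg subr_eq0; have [nu1|_] := eqVneq nu 1; last by rewrite mul1r.
  rewrite mul0r /f2 nu1 /taylor_rest !powRr1 ?ltW ?ltr_wpDr ?pos_part_ge0// subrr powRr0.
  by ring.
have i1 : (K x).-integrable setT (EFin \o f1).
  have a1 : (0 : R) < 1 < alpha by rewrite ltr01.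
  have [C C0 hC] := abs_jump_moment a1.
  apply/integrableP; split; first exact/measurable_EFinP.
  apply: (@le_lt_trans _ _ C%:E); last exact: ltry.
  apply: le_trans (hC x Xx xx0); rewrite le_eqVlt; apply/orP; left; apply/eqP.
  by apply: eq_integral => z _; rewrite powRr1.
have ig2 : (K x).-integrable setT (EFin \o g2).
  apply/integrableP; split; first exact/measurable_EFinP.
  have -> : (\int[K x]_z `|(EFin \o g2) z| = \int[K x]_z (g2 z)%:E)%E; last by rewrite hr1 ltry.
  by apply: eq_integral => z _ /=; rewrite ger0_norm.
have I2 : (\int[K x]_z (f2 z)%:E = (x `^ (nu - alpha) * (c * (nu * betaJ alpha nu) + s * r1))%:E)%E.
  under eq_integral do rewrite f2E EFinM.
  rewrite integralZl// hr1 -EFinM; congr EFin.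
  rewrite -[in RHS](sgr_betaJ a12' na) -/s; ring.
have i2 : (K x).-integrable setT (EFin \o f2).
  apply: (@eq_integrable _ _ _ _ _ _ (fun z => s%:E * (EFin \o g2) z)%E) => //.
    by move=> z _ /=; rewrite -EFinM f2E.
  exact: integrableZl.
have I3 : (\int[K x]_z (`|f3 z|)%:E <= (x `^ (nu - kap) * (1 + M))%:E)%E.
  rewrite -[x `^ (nu - kap) * (1 + M)]addr0.
  apply: (@kernel_integral_le _ X K mX KX x _ (fun z => neg_part (z - x) `^ kap)) => //.
  - exact: measurableT_comp.
  - by apply: mpow; exact: measurable_neg_part.
  - by move=> z; exact: powR_ge0.
  - exact: powR_ge0.
  - move=> z Xz; rewrite addr0; apply: taylor_rest_neg => //; last exact: X0.
    by rewrite k2 andbT; lra.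
  - by apply: neg_jump_moment_le => //; rewrite kb andbT; lra.
have i3 : (K x).-integrable setT (EFin \o f3).
  apply/integrableP; split; first exact/measurable_EFinP.
  by apply: le_lt_trans I3 _; exact: ltry.
have M0 := M_ge0 Xx xx0.
have I3b : (\int[K x]_z (f3 z)%:E)%E \is a fin_num by exact: integrable_fin_num.
pose y3 := fine (\int[K x]_z (f3 z)%:E)%E.
have y3b : `|y3| <= x `^ (nu - kap) * B.
  rewrite -lee_fin BE (ger0_norm M0); apply: le_trans I3.
  have -> : (`|y3|%:E = `| \int[K x]_z (f3 z)%:E |)%E by rewrite -(fineK I3b).
  by apply: le_abse_integral => //; exact/measurable_EFinP.
have pg : 0 < x `^ (nu - alpha) by exact: powR_gt0.
have xB : x `^ (nu - kap) * B <= x `^ (nu - alpha) * (e / 2).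
  have -> : nu - kap = (nu - alpha) + (- (kap - alpha)) by ring.
  rewrite (powRD_gt0 (nu - alpha) _ xp) -mulrA ler_pM2l// mulrC.
  by apply: powR_decay => //; [exact: ltW|rewrite subr_gt0].
exists (s * r1 + y3 / x `^ (nu - alpha)).
  apply: le_trans (ler_normD _ _) _.
  have h1 : `|s * r1| <= e / 2.
    rewrite normrM; apply: le_trans r1e; rewrite ler_piMl//.
    by rewrite /s normr_sg; case: (nu - 1 != 0).
  have h2 : `|y3 / x `^ (nu - alpha)| <= e / 2.
    rewrite normrM normfV (gtr0_norm pg) ler_pdivrMr// [e / 2 * _]mulrC.
    exact: le_trans xB.
  by rewrite [leRHS]splitr lerD.
have ic : (K x).-integrable setT (fun _ : R => (x `^ nu)%:E).
  by apply: (@finite_measure_integrable_cst _ _ _ (step_law K x)).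
have i1c : (K x).-integrable setT (fun z => (nu * x `^ (nu - 1))%:E * (EFin \o f1) z)%E.
  exact: integrableZl.
transitivity (\int[K x]_z ((x `^ nu)%:E + (nu * x `^ (nu - 1))%:E * (EFin \o f1) z
   + (f2 z)%:E + (f3 z)%:E))%E.
  apply: eq_integral => z _; rewrite -!EFinM -!EFinD; congr EFin.
  by rewrite /f3 /f1; ring.
rewrite integralD//; last first.
  by apply: integrableD => //; apply: integrableD.
rewrite integralD//; last by apply: integrableD.
rewrite integralD// integral_cst// kernel_setT mule1 integralZl// I2.
have Id : (\int[K x]_z (EFin \o f1) z = (drift K x)%:E)%E.
  by rewrite /drift fineK//; exact: integrable_fin_num.
rewrite Id -(fineK I3b) -/y3 -EFinM -!EFinD; congr EFin.
by field; rewrite gt_eqF.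
Qed.

End heavy_tail.

(** * Survival bounds from Lyapunov functions *)

Section upper_tail.
Context {R : realType} (X : set R) (K : R.-pker R ~> R).
Hypotheses (mX : measurable X) (KX : forall x, X x -> K x X = 1%E).

Lemma survr_powR_le (a nu r e : R) : 1 <= a -> 0 < nu <= r -> 0 < e ->
  (forall x, X x -> a < x ->
     (\int[K x]_z (z `^ nu)%:E <= (x `^ nu - e * x `^ (nu - r))%:E)%E) ->
  forall n x, (0 < n)%N -> X x ->
    survr K a n x <= (1 + e) / e * x `^ nu * n%:R `^ (- (nu / r)).
Proof.
move=> a1 /andP[nu0 nur] e0 dV n x n0 Xx.
have nr0 : 0 < n%:R :> R by rewrite ltr0n.
have r0 : 0 < r by lra.
(* Time n corresponds to height n^(1/r). As nu <= r, the drift x^(nu - r) is weakest at the top, so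
   e M^(nu - r) serves on all of (a, M), and n times it equals e M^nu. *)
pose M := n%:R `^ r^-1 : R.
have M0 : 0 < M by exact: powR_gt0.
have MnuE : M `^ nu = n%:R `^ (nu / r) by rewrite /M -powRrM mulrC.
have h := @survr_capped _ X K mX KX a (@powR R ^~ nu) M (M `^ nu) (e * M `^ (nu - r)) .
have {}h := h (@measurable_powR R nu) (fun z => powR_ge0 z nu) (powR_gt0 nu M0).
have {}h := h _ _ _ n x Xx; move: h => /(_ _ _ _)/wrap[].
- by rewrite mulr_ge0 ?powR_ge0// ltW.
- move=> y Xy My; apply: ge0_ler_powR; rewrite ?nnegrE ?(ltW nu0) ?(ltW M0)//.
  by rewrite (le_trans _ My)// ltW.
- move=> y Xy ay yM; apply: (le_trans (dV y Xy ay)).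
  rewrite lee_fin lerD2l lerN2; apply: ler_wpM2l; first exact: ltW.
  by apply: le_powR_neg; lra.
have -> : e * M `^ (nu - r) * n%:R = e * M `^ nu.
  rewrite powRD_gt0// -!mulrA; congr (_ * _); rewrite /M -[in X in _ * X](powRrM n%:R).
  by rewrite mulrN mulVf ?gt_eqF// powR_inv1 ?ltW// mulVf ?mulr1// gt_eqF.
have Mn0 : 0 < M `^ nu by exact: powR_gt0.
rewrite mulfK ?gt_eqF// => h.
have -> : (1 + e) / e * x `^ nu * n%:R `^ (- (nu / r)) = (1 + e) * x `^ nu / (e * M `^ nu).
  by rewrite powRN MnuE; field; rewrite !gt_eqF// powR_gt0.
by rewrite ler_pdivlMr ?mulr_gt0// mulrC.
Qed.

(** For nu > r the drift is weakest near [a], and the cut-off argument gives too little. Instead the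
    exponent r gives s_k <= C y^r / k; as s_k <= 1 too, s_k is at most this ratio to the power nu /
    r - 1 in [0, 1], proportional to the drift y^(nu - r). A second block of k steps then yields
    k^(- nu / r). *)
Lemma survr_powR_le2 (a nu r e e' : R) : 1 <= a -> 0 < r -> r <= nu <= 2 * r -> 0 < e -> 0 < e' ->
  (forall x, X x -> a < x ->
     (\int[K x]_z (z `^ r)%:E <= (x `^ r - e')%:E)%E) ->
  (forall x, X x -> a < x ->
     (\int[K x]_z (z `^ nu)%:E <= (x `^ nu - e * x `^ (nu - r))%:E)%E) ->
  exists2 C : R, 0 <= C & forall k x, (0 < k)%N -> X x ->
    survr K a (k + k) x <= C * x `^ nu * k%:R `^ (- (nu / r)).
Proof.
move=> a1 r0 /andP[rnu nur] e0 e'0 dr dnu.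
have [C0 C00 C0E] : exists2 C, 0 < C & C = (1 + e') / e'.
  by exists ((1 + e') / e') => //; rewrite divr_gt0// addr_gt0.
exists (C0 `^ (nu / r - 1) / e); first by rewrite divr_ge0 ?powR_ge0// ltW.
move=> k x k0 Xx; have kr0 : 0 < k%:R :> R by rewrite ltr0n.
have p1 : 0 <= nu / r - 1 by rewrite subr_ge0 ler_pdivlMr// mul1r.
have p2 : nu / r - 1 <= 1 by rewrite lerBlDr ler_pdivrMr//; lra.
have sk y : X y -> a < y ->
    survr K a k y <= C0 `^ (nu / r - 1) / e * k%:R `^ (- (nu / r - 1)) * (e * y `^ (nu - r)).
  move=> Xy ay; have y0 : 0 < y by lra.
  have -> : C0 `^ (nu / r - 1) / e * k%:R `^ (- (nu / r - 1)) * (e * y `^ (nu - r))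
    = (C0 * y `^ r / k%:R) `^ (nu / r - 1).
    rewrite powRM ?mulr_ge0 ?powR_ge0 ?invr_ge0 ?(ltW C00)//.
    rewrite powRM ?powR_ge0 ?(ltW C00)// powR_inv_ge0// -(powRrM y).
    have -> : r * (nu / r - 1) = nu - r by field; rewrite gt_eqF.
    by field; rewrite gt_eqF.
  have hr : 0 < r <= r by rewrite r0 lexx.
  have := @survr_powR_le a r r e' a1 hr e'0 _ k y k0 Xy.
  move=> /(_ _)/wrap[].
    by move=> u Xu au; rewrite subrr powRr0 mulr1; exact: dr.
  rewrite divff ?gt_eqF// powR_inv1// -C0E; set t := C0 * _ / _ => h.
  have t0 : 0 < t.
    by apply: divr_gt0 => //; apply: mulr_gt0 => //; exact: powR_gt0.
  have [t1|t1] := leP 1 t.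
    apply: (le_trans (survr_le1 _ _ _ _)).
    exact: powR_ge1.
  apply: (le_trans h); rewrite -[leLHS]powRr1 ?(ltW t0)//.
  by apply: ger_powR => //; rewrite t0 ltW.
have := @survr_shifted _ X K mX KX a (@powR R ^~ nu) (fun y => e * y `^ (nu - r))
  (C0 `^ (nu / r - 1) / e * k%:R `^ (- (nu / r - 1))) k (@measurable_powR R nu)
  (fun z => powR_ge0 z nu) _ sk dnu k x Xx.
move=> /(_ _)/wrap[].
  by rewrite !mulr_ge0 ?powR_ge0// invr_ge0 ltW.
move=> h; rewrite -(ler_pM2l kr0); apply: (le_trans h).
have -> : k%:R * (C0 `^ (nu / r - 1) / e * x `^ nu * k%:R `^ (- (nu / r)))
  = C0 `^ (nu / r - 1) / e * (k%:R * k%:R `^ (- (nu / r))) * x `^ nu by ring.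
rewrite le_eqVlt; apply/orP; left; apply/eqP; congr (_ * _ * _).
by rewrite -[X in _ = X * _]powRr1// -powRD_gt0//; congr (_ `^ _); ring.
Qed.

Lemma hit_moment_lt_le (a nu r e q x : R) : 1 <= a -> 0 < nu <= r -> 0 < e -> 0 < q -> q < nu / r ->
  (forall x, X x -> a < x ->
     (\int[K x]_z (z `^ nu)%:E <= (x `^ nu - e * x `^ (nu - r))%:E)%E) ->
  X x -> a < x -> (hit_moment K a q x < +oo)%E.
Proof.
move=> a1 nur e0 q0 qp dV Xx ax.
apply: (@hit_moment_fin _ K a q x q0 ((1 + e) / e * x `^ nu) (nu / r)) => //.
  by rewrite mulr_ge0 ?powR_ge0// divr_ge0// ?addr_ge0// ltW.
move=> j; have := survr_powR_le a1 nur e0 dV (n := 2 ^ j) _ Xx.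
move=> /(_ _)/wrap[]; first by rewrite expn_gt0.
move=> /le_trans; apply.
by rewrite le_eqVlt natrX -powR_mulrn// -powRrM mulrN eqxx.
Qed.

Lemma hit_moment_lt_ge (a nu r e e' q x : R) : 1 <= a -> 0 < r -> r <= nu <= 2 * r ->
  0 < e -> 0 < e' -> 0 < q -> q < nu / r ->
  (forall x, X x -> a < x ->
     (\int[K x]_z (z `^ r)%:E <= (x `^ r - e')%:E)%E) ->
  (forall x, X x -> a < x ->
     (\int[K x]_z (z `^ nu)%:E <= (x `^ nu - e * x `^ (nu - r))%:E)%E) ->
  X x -> a < x -> (hit_moment K a q x < +oo)%E.
Proof.
move=> a1 r0 nur e0 e'0 q0 qp dr dV Xx ax.
have [C C0 hC] := survr_powR_le2 a1 r0 nur e0 e'0 dr dV.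
(* The summand 1 covers j = 0, where time 1 is not of the form k + k; the factor 2^(nu / r) accounts
   for 2^(j+1) = 2^j + 2^j. *)
apply: (@hit_moment_fin _ K a q x q0 (1 + C * x `^ nu * 2 `^ (nu / r)) (nu / r)) => //.
  by rewrite addr_ge0// !mulr_ge0 ?powR_ge0.
case=> [|j].
  rewrite mul0r oppr0 powRr0 mulr1; apply: (le_trans (survr_le1 _ _ _ _)).
  by rewrite lerDl !mulr_ge0 ?powR_ge0.
have := hC (2 ^ j)%N x; rewrite addnn -mul2n -expnS => /(_ _ Xx)/wrap[]; first by rewrite expn_gt0.
move=> /le_trans; apply; rewrite natrX -powR_mulrn// -powRrM.
have -> : 2 `^ (- (j.+1%:R * (nu / r))) = 2 `^ (- (nu / r)) * 2 `^ (j%:R * - (nu / r)) :> R.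
  by rewrite -powRD_gt0//; congr (_ `^ _); rewrite -natr1; ring.
rewrite mulrA; apply: ler_wpM2r; first exact: powR_ge0.
rewrite mulrDl mul1r -mulrA -powRD_gt0// subrr powRr0 mulr1.
by rewrite lerDr powR_ge0.
Qed.

End upper_tail.

(** * Slow descent from a high level *)

Section slow_descent.
Context {R : realType} (X : set R) (K : R.-pker R ~> R).
Hypotheses (mX : measurable X) (KX : forall x, X x -> K x X = 1%E).

(** A quadratic vanishing from B upward and capped at 1. The factor 16/9 = (3/4)^(-2) makes the cap
    take effect exactly at B / 4. *)
Definition barrier (B z : R) : R := Num.min 1 (16 / 9 * (Num.max 0 (1 - z / B)) ^+ 2).

Lemma barrier_ge0 B z : 0 <= barrier B z.
Proof. by rewrite le_min ler01 mulr_ge0// ?sqr_ge0// divr_ge0. Qed.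

Lemma barrier_le1 B z : barrier B z <= 1.
Proof. by rewrite ge_min lexx. Qed.

Lemma measurable_barrier B : measurable_fun setT (barrier B).
Proof.
apply: measurable_minr => //; apply: measurable_funM => //.
apply: measurable_funX; apply: measurable_maxr => //.
by apply: measurable_funB => //; exact: measurable_funM.
Qed.

Lemma barrier_low B z : 0 < B -> z <= B / 4 -> barrier B z = 1.
Proof.
move=> B0 zB; apply/min_idPl.
have h : z / B <= 1 / 4 by rewrite ler_pdivrMr//; lra.
have h2 : 3 / 4 <= Num.max 0 (1 - z / B) by rewrite le_max; apply/orP; right; lra.
by nra.
Qed.

Lemma barrier_high B z : 0 < B -> B <= z -> barrier B z = 0.
Proof.
move=> B0 Bz; rewrite /barrier.
have -> : Num.max 0 (1 - z / B) = 0.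
  by apply/max_idPl; rewrite subr_le0 ler_pdivlMr// mul1r.
by rewrite expr0n mulr0; apply/min_idPr.
Qed.

(** In units of B the error is at most quadratic for small increments and linear for large ones,
    hence bounded by the power p for p between 1 and 2. For x > B / 4 the cap is inactive at x, and
    at z it can only lower the left side. *)
Lemma barrier_taylor (B p x z : R) : 0 < B -> 1 <= p <= 2 -> B / 4 < x ->
  barrier B z <= barrier B x - 32 / 9 * Num.max 0 (1 - x / B) / B * (z - x)
    + 4 * B `^ (- p) * `|z - x| `^ p.
Proof.
move=> B0 /andP[p1 p2] xB.
have -> : 4 * B `^ (- p) * `|z - x| `^ p = 4 * `|(z - x) / B| `^ p.
  by rewrite normrM normfV (gtr0_norm B0) powRM// ?invr_ge0 ?(ltW B0)// powR_inv_ge0 ?(ltW B0)//; ring.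
have -> : 32 / 9 * Num.max 0 (1 - x / B) / B * (z - x)
   = 32 / 9 * Num.max 0 (1 - x / B) * ((z - x) / B) by ring.
have zxB : 1 - z / B = 1 - x / B - (z - x) / B by ring.
rewrite /barrier zxB; set u := (z - x) / B.
have v34 : 1 - x / B < 3 / 4.
  have : 1 / 4 < x / B by rewrite ltr_pdivlMr//; lra.
  lra.
set v := 1 - x / B in v34 *; set y := Num.max 0 v.
have y0 : 0 <= y by rewrite le_max lexx.
have y34 : y < 3 / 4 by rewrite gt_max v34 andbT divr_gt0.
have -> : Num.min 1 (16 / 9 * y ^+ 2) = 16 / 9 * y ^+ 2 by apply/min_idPr; nra.
have vy : v <= y by rewrite le_max lexx orbT.
have [u0|u0] := leP 0 u.
  rewrite ger0_norm//; rewrite ge_min; apply/orP; right.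
  have h1 : 16 / 9 * Num.max 0 (v - u) ^+ 2 <= 16 / 9 * y ^+ 2 - 32 / 9 * y * u + 16 / 9 * u ^+ 2.
    have : Num.max 0 (v - u) ^+ 2 <= (y - u) ^+ 2.
      by have [h|h] := leP (v - u) 0; [rewrite expr0n; exact: sqr_ge0|nra].
    by lra.
  have h2 : 16 / 9 * Num.max 0 (v - u) ^+ 2 <= 16 / 9 * y ^+ 2 - 32 / 9 * y * u + 32 / 9 * y * u.
    have : Num.max 0 (v - u) ^+ 2 <= y ^+ 2.
      by have [h|h] := leP (v - u) 0; [rewrite expr0n; exact: sqr_ge0|nra].
    by lra.
  have [u1|u1] := leP u 1.
    have [un|un0] := eqVneq u 0.
      by apply: (le_trans h2); rewrite lerD2l un mulr0 mulr_ge0 ?powR_ge0.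
    apply: (le_trans h1); rewrite lerD2l.
    have : u ^+ 2 <= u `^ p.
      rewrite -powR_mulrn//; apply: ger_powR => //.
      by rewrite u1 andbT lt_neqAle eq_sym un0.
    by have := powR_ge0 u p; nra.
  apply: (le_trans h2); rewrite lerD2l.
  have : u <= u `^ p by rewrite -[leLHS]powRr1//; apply: ler_powR => //; exact: ltW.
  by nra.
rewrite ltr0_norm//; set t := - u.
have t0 : 0 < t by rewrite oppr_gt0.
have -> : u = - t by rewrite opprK.
rewrite mulrN !opprK.
(* For a long downward move the trivial bound 1 is enough, as 4 (3/4)^2 >= 1. *)
have [t34|t34] := leP (3 / 4) t.
  apply: (@le_trans _ _ 1); first by rewrite ge_min lexx.
  have h1 : 9 / 16 <= t `^ p.
    apply: (@le_trans _ _ ((3 / 4) `^ p)).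
      apply: (@le_trans _ _ ((3 / 4) `^ 2%:R)).
        by rewrite powR_mulrn; lra.
      by apply: ger_powR => //; lra.
    by apply: ge0_ler_powR; rewrite ?nnegrE; lra.
  have h2 : 0 <= 32 / 9 * y * t by rewrite !mulr_ge0// ?(ltW t0)//; lra.
  have h3 : 0 <= 16 / 9 * y ^+ 2 by rewrite mulr_ge0 ?sqr_ge0//; lra.
  by lra.
rewrite ge_min; apply/orP; right.
have h1 : Num.max 0 (v + t) ^+ 2 <= (y + t) ^+ 2.
  by have [h|h] := leP (v + t) 0; [rewrite expr0n; exact: sqr_ge0|nra].
have h2 : t ^+ 2 <= t `^ p.
  rewrite -powR_mulrn ?(ltW t0)//; apply: ger_powR => //.
  by rewrite t0; lra.
have := powR_ge0 t p; nra.
Qed.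

(** The mean of the barrier grows by at most E B^(-p) per step: below B / 4 it is already maximal,
    and above B / 4 the drift term and the moment term are both of that order. The value dl = 1 / (2
    (E + 1)) keeps the total growth below 1/2, uniformly in [a] and [B]. *)
Lemma survr_slow_descent (A p D C : R) : 1 <= A -> 1 <= p <= 2 -> 0 <= D -> 0 <= C ->
  (forall x, X x -> A <= x -> (K x).-integrable setT (fun z => (z - x)%:E)) ->
  (forall x, X x -> A <= x -> `|drift K x| <= D * x `^ (1 - p)) ->
  (forall x, X x -> A <= x -> (\int[K x]_z (`|z - x| `^ p)%:E <= C%:E)%E) ->
  exists2 dl : R, 0 < dl & forall a B n x, A <= a -> 4 * a <= B -> n%:R <= dl * B `^ p ->
    X x -> B <= x -> 2^-1 <= survr K a n x.
Proof.
move=> A1 /[dup] p12 /andP[p1 p2] D0 C0 iK dK mK.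
pose E := 32 / 9 * (4 * D) + 4 * C.
have E0 : 0 <= E by rewrite addr_ge0// !mulr_ge0.
exists (2 * (E + 1))^-1; first by rewrite invr_gt0 mulr_gt0// ltr_wpDl.
move=> a B n x Aa aB nB Xx Bx.
have B0 : 0 < B by lra.
have np : 1 - p <= 0 by lra.
have p11 : p - 1 <= 1 by lra.
pose eta := E * B `^ (- p).
have eta0 : 0 <= eta by rewrite mulr_ge0 ?powR_ge0.
have Bp : 0 < B `^ p by exact: powR_gt0.
have := @survr_slow _ X K mX KX a (barrier B) eta (measurable_barrier B) (@barrier_ge0 B) eta0.
move=> /(_ _ _)/wrap[].
- by move=> y Xy ya; rewrite barrier_low//; lra.
- move=> y Xy ay.
  have [yB|yB] := leP y (B / 4).
    rewrite barrier_low//; apply: (@le_trans _ _ (\int[K y]_z (cst 1%E z))%E).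
      apply: ge0_le_integral => //.
      - by move=> z _; rewrite lee_fin barrier_ge0.
      - by apply/measurable_EFinP; exact: measurable_barrier.
      - by move=> z _; rewrite lee_fin barrier_le1.
    by rewrite integral_cst// kernel_setT mule1 lee_fin lerDl.
  have Ay : A <= y by lra.
  have y0 : 0 < y by lra.
  pose k1 := 32 / 9 * Num.max 0 (1 - y / B) / B.
  pose k2 := 4 * B `^ (- p).
  have k20 : 0 <= k2 by rewrite mulr_ge0 ?powR_ge0.
  have mp : measurable_fun setT (fun z : R => `|z - y| `^ p).
    apply: (@measurableT_comp _ _ _ _ _ _ (@powR R ^~ p)); first exact: measurable_powR.
    by apply: measurableT_comp => //; exact: measurable_funB.
  have ip : (K y).-integrable setT (fun z => (`|z - y| `^ p)%:E).
    apply/integrableP; split; first exact/measurable_EFinP.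
    apply: (@le_lt_trans _ _ C%:E); last exact: ltry.
    apply: le_trans (mK y Xy Ay); rewrite le_eqVlt; apply/orP; left; apply/eqP.
    by apply: eq_integral => z _ /=; rewrite ger0_norm// powR_ge0.
  have ib : (K y).-integrable setT (fun z => (barrier B z)%:E).
    apply/integrableP; split; first by apply/measurable_EFinP; exact: measurable_barrier.
    apply: (@le_lt_trans _ _ (\int[K y]_z (cst 1%E z))%E); last by rewrite integral_cst// kernel_setT mule1 ltry.
    apply: ge0_le_integral => //.
    - by apply/measurable_EFinP; apply: measurableT_comp => //; exact: measurable_barrier.
    - by move=> z _; rewrite lee_fin ger0_norm ?barrier_ge0// barrier_le1.
  have ic : (K y).-integrable setT (fun _ : R => (barrier B y)%:E).
    by apply: (@finite_measure_integrable_cst _ _ _ (step_law K y)).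
  have i1 : (K y).-integrable setT (fun z => (- k1)%:E * (z - y)%:E)%E.
    by apply: integrableZl => //; exact: iK.
  have i2 : (K y).-integrable setT (fun z => k2%:E * (`|z - y| `^ p)%:E)%E.
    exact: integrableZl.
  have h : (\int[K y]_z (barrier B z)%:E <=
     \int[K y]_z ((barrier B y)%:E + (- k1)%:E * (z - y)%:E + k2%:E * (`|z - y| `^ p)%:E))%E.
    apply: le_integral => //.
    - by apply: integrableD => //; apply: integrableD.
    - move=> z _; rewrite -!EFinM -!EFinD lee_fin.
      have := barrier_taylor z B0 p12 yB; rewrite -/k1 -/k2; lra.
  apply: (le_trans h).
  rewrite integralD//; last by apply: integrableD.
  rewrite integralD// integral_cst// kernel_setT mule1 !integralZl//; last exact: iK.
  have Id : (\int[K y]_z (z - y)%:E = (drift K y)%:E)%E.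
    by rewrite /drift fineK//; apply: integrable_fin_num => //; exact: iK.
  rewrite Id.
  apply: (@le_trans _ _ ((barrier B y)%:E + (- k1)%:E * (drift K y)%:E + k2%:E * C%:E)%E).
    by rewrite leeD2l// lee_wpmul2l//; exact: mK.
  rewrite -!EFinM -!EFinD lee_fin -addrA lerD2l /eta.
  have k1b : `|k1| <= 32 / 9 * B^-1.
    rewrite /k1 ger0_norm; last by rewrite !mulr_ge0 ?invr_ge0 ?(ltW B0)// le_max lexx.
    apply: ler_wpM2r; first by rewrite invr_ge0 ltW.
    rewrite -[leRHS]mulr1; apply: ler_wpM2l; first lra.
    rewrite ge_max ler01/=.
    have : 0 <= y / B by rewrite divr_ge0// ltW.
    lra.
  have db : `|drift K y| <= 4 * D * (B * B `^ (- p)).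
    apply: (le_trans (dK y Xy Ay)).
    have -> : 4 * D * (B * B `^ (- p)) = D * (4 * B `^ (1 - p)).
      by rewrite powRD_gt0// powRr1 ?(ltW B0)//; ring.
    apply: ler_wpM2l => //.
    apply: (@le_trans _ _ ((B / 4) `^ (1 - p))); first by apply: le_powR_neg => //; [exact: divr_gt0|exact: ltW].
    rewrite powRM ?(ltW B0)// mulrC; apply: ler_wpM2r; first exact: powR_ge0.
    by rewrite powR_inv_ge0// -[leRHS]powRr1// opprB; apply: ler_powR => //; rewrite ler1n.
  have : - k1 * drift K y <= 32 / 9 * (4 * D) * B `^ (- p).
    apply: le_trans (ler_norm _) _; rewrite normrM normrN.
    have -> : 32 / 9 * (4 * D) * B `^ (- p) = 32 / 9 / B * (4 * D * (B * B `^ (- p))).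
      by field; lra.
    by apply: ler_pM.
  rewrite /E /k2 mulrDl; nra.
move=> /(_ n x Xx); rewrite barrier_high// addr0 => h.
have : n%:R * eta <= 2^-1.
  apply: (@le_trans _ _ ((2 * (E + 1))^-1 * B `^ p * eta)); first by apply: ler_wpM2r.
  rewrite /eta powRN.
  have -> : (2 * (E + 1))^-1 * B `^ p * (E * (B `^ p)^-1) = E / (2 * (E + 1)).
    by field; rewrite gt_eqF//=; lra.
  rewrite ler_pdivrMr; lra.
lra.
Qed.

End slow_descent.

(** * Infinite moments, by one jump or by a climb *)

Section lower_bounds.
Context {R : realType} (X : set R) (K : R.-pker R ~> R).
Hypotheses (mX : measurable X) (X0 : forall x, X x -> 0 <= x) (KX : forall x, X x -> K x X = 1%E).

Lemma survr_ge_jump (a m x : R) (n : nat) : X x -> a < x -> 0 <= m ->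
  (forall z, X z -> m <= z -> 2^-1 <= survr K a n z) ->
  jump_tail K x m <= 2 * survr K a n.+1 x.
Proof.
move=> Xx ax m0 hs.
have mi : measurable_fun setT (fun z : R => if m < pos_part (z - x) then (1 : R) else 0).
  by apply: measurable_fun_ifT => //; apply: measurable_fun_ltr => //; exact: measurable_pos_part.
have := @kernel_integral_le _ X K mX KX x
  (fun z => if m < pos_part (z - x) then 1 else 0) (survr K a n) 2 0 (survr K a n.+1 x) Xx mi
  (@measurable_survr _ K a n) _ (@survr_ge0 _ K a n) (ler0n _ 2) (lexx 0).
move=> /(_ _ _ _)/wrap[].
- by move=> z; case: ifP.
- move=> z Xz; rewrite addr0; case: ifPn => [mz|_]; last by rewrite mulr_ge0// survr_ge0.
  have : 2^-1 <= survr K a n z.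
    apply: hs => //; move: mz; rewrite /pos_part; case: ifP => _; last by rewrite ltNge m0.
    by have := X0 Xx; lra.
  lra.
- by rewrite survrS.
rewrite addr0 -lee_fin => /(le_trans _); apply.
rewrite -jump_tailE -[X in (K x X <= _)%E]setIT -integral_indic//; last exact: measurable_jump_gt.
rewrite le_eqVlt; apply/orP; left; apply/eqP.
apply: eq_integral => z _; rewrite indicE; congr EFin.
by case: ifPn => h; [rewrite mem_set|rewrite memNset//; exact/negP].
Qed.

(** One jump above B ~ n^(1/p) has probability of order n^(- alpha / p), and the descent then lasts
    n steps with probability at least 1/2. Thus n^q P(tau > n) stays bounded below even at q = alpha
    / p. *)
Lemma hit_moment_infty_jump (a x q alpha p dl cc Y : R) : 0 < q -> 0 < p -> 0 < dl ->
  0 < cc -> 0 < alpha -> alpha / p <= q -> X x -> a < x ->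
  (forall m, Y <= m -> cc * m `^ (- alpha) <= jump_tail K x m) ->
  (forall B n z, 4 * a <= B -> n%:R <= dl * B `^ p -> X z -> B <= z ->
     2^-1 <= survr K a n z) ->
  hit_moment K a q x = +oo%E.
Proof.
move=> q0 p0 dl0 cc0 al0 apq Xx ax hT hs.
pose k := cc / 2 * dl `^ (alpha / p).
have k0 : 0 < k by rewrite mulr_gt0 ?powR_gt0// divr_gt0.
apply: (@hit_moment_infty _ K a q x q0 k k0) => m.
pose B0 := Num.max 1 (Num.max Y (4 * a)).
(* Large enough that the height B defined from it passes [B0], and at least [m], so that arbitrarily
   late times occur. The extra successor below is the jump itself. *)
pose n := (Num.truncn (dl * B0 `^ p) + m).+1.
have n0 : 0 < n%:R :> R by rewrite ltr0n.
have nB : dl * B0 `^ p <= n%:R.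
  apply: (le_trans (ltW (truncnS_gt _))).
  by rewrite ler_nat /n ltnS leq_addr.
exists n.+1; split; first by do 2 apply: leqW; exact: leq_addl.
pose B := (n%:R / dl) `^ p^-1.
have nd0 : 0 < n%:R / dl by rewrite divr_gt0.
have B00 : 0 < B0 by rewrite lt_max ltr01.
have Bp : B `^ p = n%:R / dl by rewrite /B -powRrM mulVf ?gt_eqF// powRr1// ltW.
have B0B : B0 <= B.
  have -> : B0 = (B0 `^ p) `^ p^-1 by rewrite -powRrM mulfV ?gt_eqF// powRr1// ltW.
  apply: ge0_ler_powR; rewrite ?nnegrE ?powR_ge0 ?invr_ge0 ?(ltW p0) ?(ltW nd0)//.
  by rewrite ler_pdivlMr// mulrC.
have YB : Y <= B by apply: le_trans B0B; rewrite !le_max lexx !orbT.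
have aB : 4 * a <= B by apply: le_trans B0B; rewrite !le_max lexx !orbT.
have Bpos : 0 < B by exact: lt_le_trans B0B.
have h := @survr_ge_jump a B x n Xx ax (ltW Bpos).
have {}h : jump_tail K x B <= 2 * survr K a n.+1 x.
  apply: h => z Xz Bz; apply: (hs B) => //.
  by rewrite Bp mulrC divfK ?gt_eqF.
have h2 := hT B YB.
have BaE : B `^ (- alpha) = dl `^ (alpha / p) * n%:R `^ (- (alpha / p)).
  rewrite /B -powRrM powRM ?invr_ge0 ?(ltW dl0)// powR_inv_ge0 ?(ltW dl0)// mulrC.
  by congr (_ `^ _ * _ `^ _); field; rewrite gt_eqF.
have h3 : n.+1%:R `^ q * n%:R `^ (- (alpha / p)) >= 1 :> R.
  rewrite powRN ler_pdivlMr ?powR_gt0// mul1r.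
  apply: (@le_trans _ _ (n%:R `^ q)).
    by apply: ler_powR => //; rewrite ler1n.
  by apply: ge0_ler_powR; rewrite ?nnegrE ?ler_nat// ltW.
have h4 : k * n%:R `^ (- (alpha / p)) <= survr K a n.+1 x.
  rewrite /k -mulrA -BaE; lra.
apply: (@le_trans _ _ (k * (n.+1%:R `^ q * n%:R `^ (- (alpha / p))))).
  by rewrite -[leLHS]mulr1 ler_pM2l.
by rewrite mulrCA; apply: ler_wpM2l => //; exact: powR_ge0.
Qed.

(* The step out of (a, M) may overshoot M by a factor with infinite variance, but
   heavy tails make the mean of z^nu beyond M comparable to M^nu P(z >= M). *)
Lemma overshoot_le (nu m x Cov Ct alpha : R) : 0 < nu -> X x -> 0 < m -> x < m ->
  0 < Ct -> 0 <= Cov ->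
  Ct * m `^ (- alpha) <= jump_tail K x m ->
  (\int[K x]_z (if (m < pos_part (z - x))%R then pos_part (z - x) `^ nu else 0%R)%:E
    <= (Cov * m `^ (nu - alpha))%:E)%E ->
  (\int[K x]_z (z `^ nu)%:E <= \int[K x]_z (if (z < m)%R then z `^ nu
      else 2 `^ nu * (1 + Cov / Ct) * m `^ nu)%:E)%E.
Proof.
move=> nu0 Xx m0 xm Ct0 Cov0 hT hov.
have x0 := X0 Xx.
have mpow : measurable_fun setT (@powR R ^~ nu) by exact: measurable_powR.
have mlt : measurable_fun setT (fun z : R => z < m) by exact: measurable_fun_ltr.
pose f1 (z : R) := if z < m then z `^ nu else 0.
pose f2 (z : R) := if z < m then 0 else 1 : R.
pose h (z : R) := if m < pos_part (z - x) then pos_part (z - x) `^ nu else 0.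
have mf1 : measurable_fun setT f1 by exact: measurable_fun_ifT.
have mf2 : measurable_fun setT f2 by exact: measurable_fun_ifT.
have mpos := measurable_pos_part x.
have mh : measurable_fun setT h.
  apply: measurable_fun_ifT => //; first exact: measurable_fun_ltr.
  by apply: (@measurableT_comp _ _ _ _ _ _ (@powR R ^~ nu)).
have f10 z : 0 <= f1 z by rewrite /f1; case: ifP => // _; exact: powR_ge0.
have f20 z : 0 <= f2 z by rewrite /f2; case: ifP.
have h0 z : 0 <= h z by rewrite /h; case: ifP => // _; exact: powR_ge0.
have mp0 : 0 < m `^ nu by exact: powR_gt0.
have tp0 : 0 < 2 `^ nu :> R by exact: powR_gt0.
pose D := 2 `^ nu * (1 + Cov / Ct) * m `^ nu.
have CC0 : 0 <= Cov / Ct by rewrite divr_ge0// ltW.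
have D0 : 0 <= D by rewrite !mulr_ge0 ?addr_ge0// ltW.
have -> : (\int[K x]_z (if (z < m)%R then z `^ nu else D)%:E
   = \int[K x]_z (f1 z)%:E + D%:E * \int[K x]_z (f2 z)%:E)%E.
  rewrite -ge0_integralZl_EFin//; last 2 first.
  - by move=> z _; rewrite lee_fin.
  - exact/measurable_EFinP.
  rewrite -ge0_integralD//; last 4 first.
  - by move=> z _; rewrite lee_fin.
  - exact/measurable_EFinP.
  - by move=> z _; rewrite -EFinM lee_fin mulr_ge0.
  - by apply/measurable_EFinP; exact: measurable_funM.
  apply: eq_integral => z _; rewrite -EFinM -EFinD /f1 /f2; congr EFin.
  by case: ifP => _; rewrite ?mulr0 ?addr0// mulr1 add0r.
have jf2 : ((jump_tail K x m)%:E <= \int[K x]_z (f2 z)%:E)%E.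
  rewrite -jump_tailE -[X in (K x X <= _)%E]setIT -integral_indic//; last exact: measurable_jump_gt.
  apply: (@kernel_le_integral _ X K mX KX x) => //.
  - apply/measurable_EFinP; apply: measurable_indic; exact: measurable_jump_gt.
  - exact/measurable_EFinP.
  - move=> z Xz; rewrite lee_fin indicE /f2; case: ifPn => [zm|_]; last first.
      by case: (_ \in _).
    rewrite memNset//= /pos_part; case: ifP => _; last by apply/negP; rewrite -leNgt ltW.
    by apply/negP; rewrite -leNgt; lra.
(* A landing point in [m, 2m] costs at most (2m)^nu. Beyond 2m the start x < m forces a jump larger
   than both m and z / 2, so z^nu is at most 2^nu times the jump to the power nu. *)
apply: (@le_trans _ _ (\int[K x]_z ((f1 z)%:E + (2 `^ nu * m `^ nu)%:E * (f2 z)%:E + (2 `^ nu)%:E * (h z)%:E))%E).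
  apply: (@kernel_le_integral _ X K mX KX x) => //.
  - exact/measurable_EFinP.
  - apply: emeasurable_funD; last by apply/measurable_EFinP; exact: measurable_funM.
    apply: emeasurable_funD; first exact/measurable_EFinP.
    by apply/measurable_EFinP; exact: measurable_funM.
  - by move=> z; rewrite lee_fin powR_ge0.
  - by move=> z; rewrite -!EFinM -!EFinD lee_fin !addr_ge0// !mulr_ge0// ltW.
  - move=> z Xz; rewrite -!EFinM -!EFinD lee_fin /f1 /f2; have z0 := X0 Xz.
    have hz := h0 z; case: ltP => zm; first by rewrite mulr0 addr0 lerDl mulr_ge0// ltW.
    rewrite add0r mulr1; have [z2|z2] := leP z (2 * m).
      apply: ler_wpDr; first by rewrite mulr_ge0// ltW.
      by rewrite -powRM ?(ltW m0)//; apply: ge0_ler_powR; rewrite ?nnegrE ?mulr_ge0 ?(ltW m0) ?(ltW nu0).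
    apply: ler_wpDl; first by rewrite mulr_ge0 ?ltW.
    rewrite /h pos_part_id; last lra.
    rewrite ifT; last lra.
    by rewrite -powRM//; [apply: ge0_ler_powR; rewrite ?nnegrE; lra|lra].
rewrite ge0_integralD//; last 4 first.
- by move=> z _; rewrite -EFinM -EFinD lee_fin addr_ge0// !mulr_ge0// ltW.
- apply: emeasurable_funD; first exact/measurable_EFinP.
  by apply/measurable_EFinP; exact: measurable_funM.
- by move=> z _; rewrite -EFinM lee_fin mulr_ge0// ltW.
- by apply/measurable_EFinP; exact: measurable_funM.
rewrite ge0_integralD//; last 4 first.
- by move=> z _; rewrite lee_fin.
- exact/measurable_EFinP.
- by move=> z _; rewrite -EFinM lee_fin !mulr_ge0// ltW.
- by apply/measurable_EFinP; exact: measurable_funM.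
rewrite -addeA; apply: leeD => //.
rewrite !ge0_integralZl_EFin//; last 5 first.
- by move=> z _; rewrite lee_fin.
- exact/measurable_EFinP.
- by move=> z _; rewrite lee_fin.
- exact/measurable_EFinP.
- by rewrite mulr_ge0// ltW.
have f2fin : (\int[K x]_z (f2 z)%:E)%E \is a fin_num.
  rewrite ge0_fin_numE; last by apply: integral_ge0 => z _; rewrite lee_fin.
  apply: (@le_lt_trans _ _ (\int[K x]_z (cst 1%E z))%E); last by rewrite integral_cst// kernel_setT mule1 ltry.
  apply: ge0_le_integral => //.
  - by move=> z _; rewrite lee_fin.
  - exact/measurable_EFinP.
  - by move=> z _; rewrite lee_fin /f2; case: ifP.
rewrite -(fineK f2fin) in jf2 *; rewrite lee_fin in jf2.
set P := fine _ in jf2 *.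
apply: (@le_trans _ _ ((2 `^ nu * m `^ nu)%:E * P%:E + (2 `^ nu)%:E * (Cov * m `^ (nu - alpha))%:E)%E).
  by rewrite leeD2l// lee_wpmul2l// lee_fin ltW.
rewrite -!EFinM -EFinD lee_fin /D.
have -> : 2 `^ nu * (1 + Cov / Ct) * m `^ nu * P = 2 `^ nu * m `^ nu * P + 2 `^ nu * (Cov / Ct * m `^ nu * P) by ring.
rewrite lerD2l ler_pM2l// powRD_gt0//.
have : m `^ (- alpha) <= P / Ct by rewrite ler_pdivlMr// mulrC (le_trans hT).
have -> : Cov / Ct * m `^ nu * P = Cov * m `^ nu * (P / Ct) by ring.
by rewrite mulrA; apply: ler_wpM2l; rewrite mulr_ge0// ltW.
Qed.

(** As z^nu is a submartingale above [a], the chain climbs to B before hitting with probability of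
    order (x^nu - a^nu) / B^nu. The descent then takes dl B^p steps, so survival up to n is of order
    n^(- nu / p). *)
Lemma hit_moment_infty_climb (a x q nu alpha p dl Ct Cov Y : R) : 0 < a ->
  0 < q -> 0 < nu -> 0 < p -> 0 < dl -> 0 < Ct -> 0 <= Cov -> nu / p <= q -> X x -> a < x ->
  (forall y m, X y -> a < y -> Y <= m -> Ct * m `^ (- alpha) <= jump_tail K y m) ->
  (forall y m, X y -> a < y -> Y <= m ->
    (\int[K y]_z (if (m < pos_part (z - y))%R then pos_part (z - y) `^ nu else 0%R)%:E
      <= (Cov * m `^ (nu - alpha))%:E)%E) ->
  (forall y, X y -> a < y -> ((y `^ nu)%:E <= \int[K y]_z (z `^ nu)%:E)%E) ->
  (forall B n z, 4 * a <= B -> n%:R <= dl * B `^ p -> X z -> B <= z ->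
     2^-1 <= survr K a n z) ->
  hit_moment K a q x = +oo%E.
Proof.
move=> a0 q0 nu0 p0 dl0 Ct0 Cov0 npq Xx ax hT hov sub hs.
pose C := 2 `^ nu * (1 + Cov / Ct).
have C1 : 1 <= C.
  rewrite -[leLHS]mulr1; apply: ler_pM => //.
    by apply: powR_ge1; [rewrite ler1n|exact: ltW].
  by rewrite lerDl divr_ge0// ltW.
have xa : 0 < x `^ nu - a `^ nu.
  by rewrite subr_gt0; apply: gt0_ltr_powR; rewrite ?nnegrE ?(ltW a0)// ltW// (lt_trans a0).
pose k := (x `^ nu - a `^ nu) / (2 * C) * dl `^ (nu / p).
have k0 : 0 < k by rewrite mulr_gt0 ?powR_gt0// divr_gt0// mulr_gt0//; lra.
apply: (@hit_moment_infty _ K a q x q0 k k0) => m.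
pose B0 := Num.max (x + 1) (Num.max Y (4 * a)).
pose n := (Num.truncn (dl * B0 `^ p) + m).+1.
have n0 : 0 < n%:R :> R by rewrite ltr0n.
have nB : dl * B0 `^ p <= n%:R.
  apply: (le_trans (ltW (truncnS_gt _))).
  by rewrite ler_nat /n ltnS leq_addr.
exists n; split; first by apply: leqW; exact: leq_addl.
pose B := (n%:R / dl) `^ p^-1.
have nd0 : 0 < n%:R / dl by rewrite divr_gt0.
have B00 : 0 < B0 by rewrite lt_max; apply/orP; left; have := X0 Xx; lra.
have Bp : B `^ p = n%:R / dl by rewrite /B -powRrM mulVf ?gt_eqF// powRr1// ltW.
have B0B : B0 <= B.
  have -> : B0 = (B0 `^ p) `^ p^-1 by rewrite -powRrM mulfV ?gt_eqF// powRr1// ltW.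
  apply: ge0_ler_powR; rewrite ?nnegrE ?powR_ge0 ?invr_ge0 ?(ltW p0) ?(ltW nd0)//.
  by rewrite ler_pdivlMr// mulrC.
have YB : Y <= B by apply: le_trans B0B; rewrite !le_max lexx !orbT.
have aB : 4 * a <= B by apply: le_trans B0B; rewrite !le_max lexx !orbT.
have xB : x < B.
  have : x + 1 <= B by apply: le_trans B0B; rewrite le_max lexx.
  lra.
have Bpos : 0 < B by exact: lt_le_trans B0B.
have Bnu0 : 0 < B `^ nu by exact: powR_gt0.
(* The plateau C B^nu replaces the unbounded overshoot, and by [overshoot_le] it is high enough to
   keep the submartingale inequality. The factor 2 in the coefficient of survival pays for the
   probability 1/2 of a slow descent. *)
pose phi (z : R) := if z < B then z `^ nu else C * B `^ nu.
have mphi : measurable_fun setT phi.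
  by apply: measurable_fun_ifT => //; exact: measurable_fun_ltr.
have C0 : 0 <= C by lra.
have phi0 z : 0 <= phi z.
  by rewrite /phi; case: ifP => _; rewrite ?powR_ge0// mulr_ge0// powR_ge0.
have D0 : 0 <= 2 * C * B `^ nu by apply: mulr_ge0; [exact: mulr_ge0|exact: powR_ge0].
have := @survr_lower _ X K mX KX a phi B (2 * C * B `^ nu) (a `^ nu) n mphi phi0.
move=> /(_ _ _ _ _ _ _ n x (leqnn n) Xx)/wrap[].
- exact: D0.
- exact: powR_ge0.
- move=> y Xy ay yB; rewrite /phi yB.
  apply: (@le_trans _ _ (1 * B `^ nu)).
    by rewrite mul1r; apply: ge0_ler_powR; rewrite ?nnegrE ?(ltW nu0) ?(ltW Bpos) ?(X0 Xy)// ltW.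
  by apply: ler_wpM2r; [exact: ltW|lra].
- move=> y Xy ay yB; rewrite {1}/phi yB; apply: (le_trans (sub y Xy ay)).
  by apply: (overshoot_le (alpha := alpha)) => //; [exact: hT|exact: hov].
- move=> y Xy ya; rewrite /phi ifT; last lra.
  by apply: ge0_ler_powR; rewrite ?nnegrE ?(ltW nu0) ?(ltW a0) ?(X0 Xy).
- move=> y Xy By j jn; rewrite /phi ltNge By/=.
  have hj : 2^-1 <= survr K a j y.
    apply: (hs B) => //; rewrite Bp mulrC divfK ?gt_eqF// ler_nat//.
  have -> : C * B `^ nu = 2 * C * B `^ nu * 2^-1 by field.
  apply: ler_wpDr; first exact: powR_ge0.
  exact: ler_wpM2l.
rewrite /phi xB => h.
have BaE : (B `^ nu)^-1 = dl `^ (nu / p) * n%:R `^ (- (nu / p)).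
  rewrite -powRN /B -powRrM powRM ?invr_ge0 ?(ltW dl0)// powR_inv_ge0 ?(ltW dl0)// mulrC.
  by congr (_ `^ _ * _ `^ _); field; rewrite gt_eqF.
have h3 : n%:R `^ q * n%:R `^ (- (nu / p)) >= 1 :> R.
  rewrite powRN ler_pdivlMr ?powR_gt0// mul1r.
  by apply: ler_powR => //; rewrite ler1n.
have h4 : k * n%:R `^ (- (nu / p)) <= survr K a n x.
  rewrite /k -mulrA -BaE -ler_pdivlMr ?invr_gt0// invrK ler_pdivrMr; last lra.
  rewrite (_ : survr K a n x * B `^ nu * (2 * C) = 2 * C * B `^ nu * survr K a n x); last ring.
  by rewrite lerBlDr.
apply: (@le_trans _ _ (k * (n%:R `^ q * n%:R `^ (- (nu / p))))).
  by rewrite -[leLHS]mulr1 ler_pM2l.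
by rewrite mulrCA; apply: ler_wpM2l => //; exact: powR_ge0.
Qed.

End lower_bounds.

(** * The three regimes *)

Lemma powR_neg_small (R : realType) (p e : R) : p < 0 -> 0 < e ->
  exists2 A : R, 1 <= A & forall x : R, A <= x -> x `^ p <= e.
Proof.
move=> p0 e0; exists (Num.max 1 (e `^ p^-1)); first by rewrite le_max lexx.
move=> x; rewrite ge_max => /andP[x1 xe].
have ep : 0 < e `^ p^-1 by exact: powR_gt0.
apply: (le_trans (le_powR_neg (ltW p0) ep xe)).
by rewrite -powRrM mulVf ?lt_eqF// powRr1// ltW.
Qed.

Lemma norm_near_le (R : realType) (v b : R) : `|v - b| <= 1 -> `|v| <= `|b| + 1.
Proof. by move=> h; have := ler_normD (v - b) b; rewrite subrK; lra. Qed.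

Section moments.
Context {R : realType} (X : set R) (K : R.-pker R ~> R) (alpha beta c x0 M : R).
Hypotheses (mX : measurable X) (X0 : forall x, X x -> 0 <= x)
  (KX : forall x, X x -> K x X = 1%E).
Hypotheses (alpha12 : 1 < alpha < 2) (alphabeta : alpha < beta) (c0 : 0 < c).
Hypothesis tailK : forall e : R, 0 < e -> exists Y : R, forall y : R, Y <= y ->
  forall x, X x -> x0 <= x -> `| y `^ alpha * jump_tail K x y - c | <= e.
Hypothesis negK : forall x, X x -> x0 <= x -> (neg_jump_moment K beta x <= M%:E)%E.

Lemma survr_slow_descent_heavy (p D A0 : R) : 1 <= p < alpha -> 0 <= D ->
  (forall x, X x -> A0 <= x -> `|drift K x| <= D * x `^ (1 - p)) ->
  exists A dl : R, [/\ 1 <= A, 0 < dl &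
    forall a B n x, A <= a -> 4 * a <= B -> n%:R <= dl * B `^ p ->
    X x -> B <= x -> 2^-1 <= survr K a n x].
Proof.
move=> /andP[p1 pa] D0 hD; have /andP[al1 al2] := alpha12.
pose A := Num.max 1 (Num.max A0 x0).
have A1 : 1 <= A by rewrite le_max lexx.
have AA0 x : A <= x -> A0 <= x /\ x0 <= x.
  by rewrite !ge_max => /and3P[].
have p01 : 0 < p < alpha by rewrite pa andbT; lra.
have [C C0 hC] := abs_jump_moment mX KX alpha12 alphabeta c0 tailK negK p01.
have one01 : 0 < (1 : R) < alpha by rewrite ltr01.
have [C1 C10 hC1] := abs_jump_moment mX KX alpha12 alphabeta c0 tailK negK one01.
have p12 : 1 <= p <= 2 by rewrite p1/=; lra.
have hint x : X x -> A <= x -> (K x).-integrable setT (fun z => (z - x)%:E).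
  move=> Xx /AA0[_ xx0]; apply/integrableP; split.
    by apply/measurable_EFinP; exact: measurable_funB.
  apply: le_lt_trans (ltry C1); apply: le_trans (hC1 x Xx xx0).
  rewrite le_eqVlt; apply/orP; left; apply/eqP; apply: eq_integral => z _.
  by rewrite powRr1.
have [|x Xx Ax|dl dl0 h] := survr_slow_descent mX KX A1 p12 D0 C0 hint.
- by move=> x Xx /AA0[h _]; exact: hD.
- by apply: hC => //; have [] := AA0 x Ax.
by exists A, dl.
Qed.

(** When x^(alpha - 1) mu(x) converges, the mean drift and the jump remainder have the same order
    x^(nu - alpha), and the sign of b + c J(nu) decides. The limit b = 0 covers a negligible
    drift. *)
Lemma power_drift_critical (b nu e : R) : 0 < nu < alpha -> 0 < e ->
  (forall e' : R, 0 < e' -> exists N : R, forall x, X x -> N <= x ->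
     `| x `^ (alpha - 1) * drift K x - b | <= e') ->
  exists A : R, [/\ 1 <= A, x0 <= A & forall x, X x -> A <= x ->
    exists2 r : R, `|r - nu * (b + c * betaJ alpha nu)| <= e &
      (\int[K x]_z (z `^ nu)%:E = (x `^ nu + x `^ (nu - alpha) * r)%:E)%E].
Proof.
move=> nu0a e0 hb; have /andP[nu0 nua] := nu0a.
have nu1 : 0 < nu + 1 by rewrite addr_gt0.
have e1 : 0 < e / (nu + 1) by rewrite divr_gt0.
have [A A1 hA] := drift_asymp mX X0 KX alpha12 alphabeta c0 tailK negK nu0a e1.
have [N hN] := hb _ e1.
exists (Num.max A (Num.max N x0)); split.
- by rewrite le_max A1.
- by rewrite !le_max lexx !orbT.
move=> x Xx; rewrite !ge_max => /and3P[Ax Nx xx0].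
have [r hr ->] := hA x Xx xx0 Ax.
have x_gt0 : 0 < x := lt_le_trans (lt_le_trans ltr01 A1) Ax.
exists (nu * (x `^ (alpha - 1) * drift K x) + (c * (nu * betaJ alpha nu) + r)).
  have -> : nu * (x `^ (alpha - 1) * drift K x) + (c * (nu * betaJ alpha nu) + r) -
      nu * (b + c * betaJ alpha nu) = nu * (x `^ (alpha - 1) * drift K x - b) + r by ring.
  apply: (le_trans (ler_normD _ _)); rewrite normrM (gtr0_norm nu0).
  have -> : e = nu * (e / (nu + 1)) + e / (nu + 1).
    by rewrite -[X in _ + X]mul1r -mulrDl mulrCA mulfV ?gt_eqF// mulr1.
  by apply: lerD hr; rewrite ler_pM2l// hN.
congr EFin; have -> : nu - 1 = (nu - alpha) + (alpha - 1) by ring.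
by rewrite (powRD_gt0 (nu - alpha) (alpha - 1) x_gt0); ring.
Qed.

Lemma hit_moment_critical_fin (b q nus : R) : 0 < nus < alpha ->
  b + c * betaJ alpha nus = 0 ->
  (forall e : R, 0 < e -> exists N : R, forall x, X x -> N <= x ->
     `| x `^ (alpha - 1) * drift K x - b | <= e) ->
  0 < q -> q < nus / alpha ->
  exists A : R, forall a, A <= a -> forall x, X x -> a < x -> (hit_moment K a q x < +oo)%E.
Proof.
move=> /andP[nus0 nusa] bJ hb q0 q_nus.
have al0 : 0 < alpha := lt_trans nus0 nusa.
(* Any exponent strictly between q alpha and [nus]: monotonicity of J makes its drift negative while
   q < nu / alpha still holds. *)
have [nu [nu0a nu_nus q_nu]] : exists nu, [/\ 0 < nu < alpha, nu < nus & q < nu / alpha].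
  have : q * alpha < nus by rewrite -ltr_pdivlMr.
  have : 0 < q * alpha by rewrite mulr_gt0.
  move=> qa0 qa; exists ((q * alpha + nus) / 2).
  by rewrite [q < _]ltr_pdivlMr//; split; [apply/andP; split| |]; lra.
have /andP[nu0 nua] := nu0a.
have [k k0 kE] : exists2 k, 0 < k & nu * (b + c * betaJ alpha nu) = - k.
  exists (- (nu * (b + c * betaJ alpha nu))); last by rewrite opprK.
  by rewrite oppr_gt0 pmulr_rlt0// -bJ ltrD2l ltr_pM2l// betaJ_lt.
have k20 : 0 < k / 2 by rewrite divr_gt0.
have kk : - k + k / 2 = - (k / 2) by field.
have [A [A1 Ax0 hA]] := power_drift_critical nu0a k20 hb.
exists A => a Aa x Xx ax.
apply: (@hit_moment_lt_le _ X K mX KX a nu alpha (k / 2) q x) => //.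
- exact: le_trans Aa.
- by rewrite nu0 ltW.
move=> y Xy ay; have [r hr ->] := hA y Xy (le_trans Aa (ltW ay)).
rewrite lee_fin lerD2l -mulNr mulrC; apply: ler_wpM2r; first exact: powR_ge0.
by move: hr; rewrite kE ler_distl kk => /andP[].
Qed.

Lemma hit_moment_critical_infty (b q nus : R) : 0 < nus < alpha ->
  b + c * betaJ alpha nus = 0 ->
  (forall e : R, 0 < e -> exists N : R, forall x, X x -> N <= x ->
     `| x `^ (alpha - 1) * drift K x - b | <= e) ->
  nus / alpha < q ->
  exists A : R, forall a, A <= a -> forall x, X x -> a < x -> hit_moment K a q x = +oo%E.
Proof.
move=> /andP[nus0 nusa] bJ hb nus_q; have /andP[al1 al2] := alpha12.
have al0 : 0 < alpha := lt_trans nus0 nusa.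
have q0 : 0 < q by apply: lt_trans nus_q; rewrite divr_gt0.
have [nu [nu0a nus_nu nu_q]] : exists nu, [/\ 0 < nu < alpha, nus < nu & nu < q * alpha].
  have : nus < Num.min alpha (q * alpha) by rewrite lt_min nusa -ltr_pdivrMr.
  have [] : Num.min alpha (q * alpha) <= alpha /\ Num.min alpha (q * alpha) <= q * alpha.
    by rewrite !ge_min !lexx orbT.
  move: (Num.min _ _) => m ma mq nusm; exists ((nus + m) / 2).
  by split; [apply/andP; split| |]; lra.
have /andP[nu0 nua] := nu0a.
have [k k0 kE] : exists2 k, 0 < k & nu * (b + c * betaJ alpha nu) = k.
  exists (nu * (b + c * betaJ alpha nu)) => //.
  by rewrite mulr_gt0// -bJ ltrD2l ltr_pM2l// betaJ_lt.
have [A [A1 Ax0 hA]] := power_drift_critical nu0a k0 hb.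
(* The slack nu < q alpha allows p = max 1 (nu / q), strictly below [alpha] so that the jump moment
   of order p exists. *)
have [p p1a nupq] : exists2 p, 1 <= p < alpha & nu / p <= q.
  have p1 : 1 <= Num.max 1 (nu / q) by rewrite le_max lexx.
  exists (Num.max 1 (nu / q)).
    by rewrite p1 gt_max al1 ltr_pdivrMr// mulrC.
  rewrite ler_pdivrMr; last exact: lt_le_trans p1.
  by rewrite mulrC -ler_pdivrMr// le_max lexx orbT.
have /andP[p1 pa] := p1a; have p0 : 0 < p := lt_le_trans ltr01 p1.
have [N1 hN1] := hb 1 ltr01.
have D0 : 0 <= `|b| + 1 by rewrite addr_ge0.
have [|A2 [dl [A21 dl0 hdl]]] := @survr_slow_descent_heavy p (`|b| + 1) (Num.max 1 N1) p1a D0.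
  move=> x Xx; rewrite ge_max => /andP[x1 N1x].
  have x_gt0 : 0 < x := lt_le_trans ltr01 x1.
  have -> : drift K x = x `^ (1 - alpha) * (x `^ (alpha - 1) * drift K x).
    rewrite mulrA -powRD_gt0//; have -> : 1 - alpha + (alpha - 1) = 0 by ring.
    by rewrite powRr0 mul1r.
  rewrite normrM ger0_norm ?powR_ge0// mulrC; apply: ler_pM => //; first exact: powR_ge0.
    exact/norm_near_le/hN1.
  by apply: ler_powR => //; rewrite lerD2l lerN2 ltW.
have [Cov [Y1 [Cov0 Y11 hov]]] := overshoot_moment mX KX alpha12 alphabeta c0 tailK nu0a.
have c20 : 0 < c / 2 by rewrite divr_gt0.
have [Y2 Y21 htail] := jump_tail_bounds tailK c20.
exists (Num.max A A2) => a; rewrite ge_max => /andP[Aa A2a] x Xx ax.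
have ge_x0 y : a < y -> x0 <= y by move=> ay; exact: le_trans Ax0 (le_trans Aa (ltW ay)).
apply: (@hit_moment_infty_climb _ X K mX X0 KX a x q nu alpha p dl (c / 2) Cov (Num.max Y1 Y2)) => //.
- exact: lt_le_trans ltr01 (le_trans A1 Aa).
- move=> y n Xy ay; rewrite ge_max => /andP[_ Yn].
  have /andP[+ _] := htail n Yn y Xy (ge_x0 y ay).
  by have -> : c - c / 2 = c / 2 by field.
- move=> y n Xy ay; rewrite ge_max => /andP[Yn _].
  by apply: hov => //; exact: ge_x0.
- move=> y Xy ay; have [r hr ->] := hA y Xy (le_trans Aa (ltW ay)).
  rewrite lee_fin lerDl mulr_ge0 ?powR_ge0//.
  by move: hr; rewrite kE ler_norml => /andP[+ _]; rewrite lerBrDr addNr.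
- by move=> B n z aB; apply: hdl.
Qed.

Lemma hit_moment_critical (b q nus : R) : 0 < q -> 0 < nus < alpha ->
  b + c * betaJ alpha nus = 0 ->
  (forall e : R, 0 < e -> exists N : R, forall x, X x -> N <= x ->
     `| x `^ (alpha - 1) * drift K x - b | <= e) ->
  exists A : R, forall a, A <= a -> forall x, X x -> a < x ->
    (q < nus / alpha -> (hit_moment K a q x < +oo)%E) /\
    (nus / alpha < q -> hit_moment K a q x = +oo%E).
Proof.
move=> q0 nus0a bJ hb.
have [q_lt|q_gt|q_eq] := ltgtP q (nus / alpha).
- have [A hA] := hit_moment_critical_fin nus0a bJ hb q0 q_lt.
  by exists A => a Aa x Xx ax; split => // _; exact: hA.
- have [A hA] := hit_moment_critical_infty nus0a bJ hb q_gt.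
  by exists A => a Aa x Xx ax; split => // _; exact: hA.
- by exists 0.
Qed.

Lemma hit_moment_subcritical (b gamma q : R) : 0 < q -> 0 <= gamma < alpha - 1 -> b < 0 ->
  (forall e : R, 0 < e -> exists N : R, forall x, X x -> N <= x ->
     `| x `^ gamma * drift K x - b | <= e) ->
  exists A : R, forall a, A <= a -> forall x, X x -> a < x ->
    (q < alpha / (gamma + 1) -> (hit_moment K a q x < +oo)%E) /\
    (alpha / (gamma + 1) <= q -> hit_moment K a q x = +oo%E).
Proof.
move=> q0 /andP[ga0 ga1] b0 hb; have /andP[al1 al2] := alpha12.
set r := gamma + 1; have r1 : 1 <= r by rewrite /r; lra.
have ra : r < alpha by rewrite /r; lra.
have r0 : 0 < r by lra.
(* The mean drift has order x^(nu - r), while the jump remainder is smaller by x^(r - alpha). A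
   quarter of nu |b| is allowed for the convergence of the drift and a quarter for the remainder;
   half is left. *)
have lyap nu : 0 < nu < alpha -> exists A : R, [/\ 1 <= A, x0 <= A &
    forall x, X x -> A <= x ->
      (\int[K x]_z (z `^ nu)%:E <= (x `^ nu - (- nu * b / 2) * x `^ (nu - r))%:E)%E].
  move=> nu0a; have /andP[nu0 nua] := nu0a.
  have [A A1 hA] := drift_asymp mX X0 KX alpha12 alphabeta c0 tailK negK nu0a ltr01.
  have b4 : 0 < - b / 4 by lra.
  have [N hN] := hb _ b4.
  pose L := `|c * (nu * betaJ alpha nu)| + 1.
  have L0 : 0 < L by rewrite /L; have := normr_ge0 (c * (nu * betaJ alpha nu)); lra.
  have e0 : 0 < nu * (- b / 4) / L by rewrite divr_gt0// mulr_gt0.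
  have ra0 : r - alpha < 0 by lra.
  have [A' A'1 hA'] := powR_neg_small ra0 e0.
  exists (Num.max (Num.max A A') (Num.max N x0)); split.
  - by rewrite !le_max A1.
  - by rewrite !le_max lexx !orbT.
  move=> x Xx; rewrite !ge_max => /andP[/andP[Ax A'x] /andP[Nx xx0]].
  have [s hs ->] := hA x Xx xx0 Ax; have x_gt0 : 0 < x by lra.
  rewrite lee_fin -addrA lerD2l.
  have -> : nu - 1 = (nu - r) + gamma by rewrite /r; ring.
  have -> : nu - alpha = (nu - r) + (r - alpha) by ring.
  rewrite (powRD_gt0 (nu - r) gamma x_gt0) (powRD_gt0 (nu - r) (r - alpha) x_gt0).
  have -> : nu * (x `^ (nu - r) * x `^ gamma) * drift K x +
      x `^ (nu - r) * x `^ (r - alpha) * (c * (nu * betaJ alpha nu) + s) =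
      (nu * (x `^ gamma * drift K x) + x `^ (r - alpha) * (c * (nu * betaJ alpha nu) + s))
        * x `^ (nu - r) by ring.
  rewrite -mulNr; apply: ler_wpM2r; first exact: powR_ge0.
  have h1 : nu * (x `^ gamma * drift K x) <= nu * (b + - b / 4).
    by rewrite ler_pM2l//; have := hN x Xx Nx; rewrite ler_norml; lra.
  have h2 : x `^ (r - alpha) * (c * (nu * betaJ alpha nu) + s) <= nu * (- b / 4).
    apply: (@le_trans _ _ (x `^ (r - alpha) * L)).
      apply: ler_wpM2l; first exact: powR_ge0.
      by apply: (le_trans (ler_norm _)); apply: (le_trans (ler_normD _ _)); rewrite /L lerD2l.
    by rewrite -ler_pdivlMr// hA'.
  by lra.
have [qlt|qge] := ltP q (alpha / r).
  have qr : q * r < alpha by rewrite -ltr_pdivlMr.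
  have qr0 : 0 < q * r by rewrite mulr_gt0.
  (* Since r < alpha, this exponent may fall on either side of r, and each side has its own survival
     bound. *)
  pose nu := (q * r + alpha) / 2.
  have [nu1 nu2] : q * r < nu /\ nu < alpha by rewrite /nu; split; lra.
  have nu0 : 0 < nu by lra.
  have nu0a : 0 < nu < alpha by rewrite nu0.
  have r0a : 0 < r < alpha by rewrite r0.
  have q_nu : q < nu / r by rewrite ltr_pdivlMr.
  have e0 : 0 < - nu * b / 2 by rewrite mulNr -mulrN divr_gt0// mulr_gt0// oppr_gt0.
  have e0' : 0 < - r * b / 2 by rewrite mulNr -mulrN divr_gt0// mulr_gt0// oppr_gt0.
  have [A [A1 Ax0 hA]] := lyap nu nu0a.
  have [A' [A'1 A'x0 hA']] := lyap r r0a.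
  exists (Num.max A A') => a; rewrite ge_max => /andP[Aa A'a] x Xx ax.
  split => // _.
  have a1 : 1 <= a by lra.
  have [nur|rnu] := leP nu r.
    apply: (@hit_moment_lt_le _ X K mX KX a nu r (- nu * b / 2) q x) => //.
      by rewrite nu0.
    by move=> y Xy ay; apply: hA => //; lra.
  apply: (@hit_moment_lt_ge _ X K mX KX a nu r (- nu * b / 2) (- r * b / 2) q x) => //.
  - by rewrite ltW//=; lra.
  - move=> y Xy ay; have A'y : A' <= y by lra.
    by have := hA' y Xy A'y; rewrite subrr powRr0 mulr1.
  - by move=> y Xy ay; apply: hA => //; lra.
have [N1 hN1] := hb 1 ltr01.
have D0 : 0 <= `|b| + 1 by have := normr_ge0 b; lra.
have r1a : 1 <= r < alpha by rewrite r1.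
have [|A2 [dl [A21 dl0 hdl]]] := @survr_slow_descent_heavy r (`|b| + 1) (Num.max 1 N1) r1a D0.
  move=> x Xx; rewrite ge_max => /andP[x1 N1x].
  have x_gt0 : 0 < x by lra.
  have -> : drift K x = x `^ (1 - r) * (x `^ gamma * drift K x).
    rewrite mulrA -powRD_gt0//; have -> : 1 - r + gamma = 0 by rewrite /r; ring.
    by rewrite powRr0 mul1r.
  rewrite normrM ger0_norm ?powR_ge0// mulrC; apply: ler_wpM2r; first exact: powR_ge0.
  exact/norm_near_le/hN1.
have c20 : 0 < c / 2 by rewrite divr_gt0.
have [Y Y1 htail] := jump_tail_bounds tailK c20.
exists (Num.max x0 A2) => a; rewrite ge_max => /andP[x0a A2a] x Xx ax.
split => // _; apply: (@hit_moment_infty_jump _ X K mX X0 KX a x q alpha r dl (c / 2) Y) => //.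
- lra.
- move=> n Yn; have x0x : x0 <= x by lra.
  have /andP[+ _] := htail n Yn x Xx x0x.
  by have -> : c - c / 2 = c / 2 by field.
- by move=> B n z aB; apply: hdl.
Qed.

End moments.

Lemma nu_star_eqE (R : realType) (alpha b c nu : R) : 1 < alpha < 2 ->
  nu_star_eq alpha b c nu <-> 0 < nu < alpha /\ b / c = - betaJ alpha nu.
Proof.
move=> al12; have /andP[al1 al2] := al12.
split=> -[/andP[nu0 nua] h]; split; rewrite ?nu0//.
  by rewrite betaJ_Gamma//; [rewrite opprK|lra].
by rewrite h betaJ_Gamma//; [rewrite opprK|lra].
Qed.

Theorem theorem2p2 (R : realType) (X : set R) (K : R.-pker R ~> R)
  (alpha beta c gamma b : R) :
  measurable X ->
  (forall x, X x -> 0 <= x) ->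
  infinite_set X ->
  (forall M : R, exists2 x, X x & M < x) ->
  (forall x, X x -> K x X = 1%E) ->
  cond_T X K alpha beta c ->
  cond_D X K gamma b ->
  forall q : R, 0 < q ->
  exists A : R, forall a : R, A <= a -> forall x : R, X x -> a < x ->
    [/\ (alpha - 1 < gamma ->
           (q < 1 / alpha -> (hit_moment K a q x < +oo)%E) /\
           (1 / alpha < q -> hit_moment K a q x = +oo%E)),
        (gamma = alpha - 1 -> b < c * pi * `| (sin (pi * alpha))^-1 | ->
           exists nu : R, nu_star_eq alpha b c nu /\
             (forall nu' : R, nu_star_eq alpha b c nu' -> nu' = nu) /\
             (q < nu / alpha -> (hit_moment K a q x < +oo)%E) /\
             (nu / alpha < q -> hit_moment K a q x = +oo%E)) &
        (gamma < alpha - 1 -> b < 0 ->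
           (q < alpha / (gamma + 1) -> (hit_moment K a q x < +oo)%E) /\
           (alpha / (gamma + 1) <= q -> hit_moment K a q x = +oo%E))].
Proof.
move=> mX X0 _ _ KX [al12 ab c0 [x0 [_ [tailK [M negK]]]]] [ga0 hb] q q0.
have /andP[al1 al2] := al12.
have [gt|lt|eq] := ltgtP (alpha - 1) gamma.
(* Case (i) is the critical case with b = 0: multiplied by x^(alpha - 1) the drift tends to 0, and
   J(1) = 0 makes the exponent 1. *)
- have [|||A hA] := @hit_moment_critical _ X K alpha beta c x0 M mX X0 KX al12 ab c0 tailK negK 0 q 1 q0.
  + by rewrite ltr01.
  + by rewrite /betaJ subrr !mul0r mulr0 addr0.
  + move=> e e0; have [N1 hN1] := hb 1 ltr01.
    have D0 : 0 < `|b| + 1 by have := normr_ge0 b; lra.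
    have d0 : alpha - 1 - gamma < 0 by lra.
    have [N2 N21 hN2] := powR_neg_small d0 (divr_gt0 e0 D0).
    exists (Num.max N1 N2) => x Xx; rewrite ge_max => /andP[N1x N2x].
    have x_gt0 : 0 < x by lra.
    have -> : x `^ (alpha - 1) * drift K x - 0 =
        x `^ (alpha - 1 - gamma) * (x `^ gamma * drift K x).
      by rewrite subr0 mulrA -powRD_gt0// subrK.
    rewrite normrM ger0_norm ?powR_ge0//.
    have -> : e = e / (`|b| + 1) * (`|b| + 1) by rewrite divfK// gt_eqF.
    apply: ler_pM => //; [exact: powR_ge0|exact: hN2|].
    exact/norm_near_le/hN1.
  by exists A => a Aa x Xx ax; split => // [_|h _]; [exact: hA|lra].
- have ga : 0 <= gamma < alpha - 1 by rewrite ga0.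
  have [b0|b0] := ltP b 0; last first.
    by exists 0 => a _ x _ _; split => // h _; lra.
  have [A hA] := @hit_moment_subcritical _ X K alpha beta c x0 M mX X0 KX al12 ab c0 tailK negK
    b gamma q q0 ga b0 hb.
  by exists A => a Aa x Xx ax; split => // [h _|_ _]; [lra|exact: hA].
- have [bl|bl] := ltP b (c * pi * `| (sin (pi * alpha))^-1 |); last first.
    by exists 0 => a _ x _ _; split => // _ h; move: (le_lt_trans bl h); rewrite ltxx.
  (* The hypothesis on b says exactly that J(0) < - b / c. *)
  have [|nu nu0a Jnu] := @betaJ_surj _ _ al12 (- (b / c)).
    by rewrite betaJ0// ltrN2 ltr_pdivrMr// mulrC mulrA.
  have /andP[nu0 nua] := nu0a.
  have [||A hA] := @hit_moment_critical _ X K alpha beta c x0 M mX X0 KX al12 ab c0 tailK negK b q nu q0 nu0a.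
  + by rewrite Jnu mulrN mulrCA mulfV ?gt_eqF// mulr1 subrr.
  + by rewrite eq.
  exists A => a Aa x Xx ax; split => // _ _.
  exists nu; split; first by apply/nu_star_eqE => //; rewrite Jnu opprK.
  split; last exact: hA.
  move=> nu' /(nu_star_eqE _ _ _ al12)[/andP[_ nu'a] h].
  have JJ : betaJ alpha nu' = betaJ alpha nu by rewrite Jnu h opprK.
  apply/eqP; rewrite eq_le !leNgt; apply/andP; split; apply/negP => hlt.
    by have := betaJ_lt al12 hlt nu'a; rewrite JJ ltxx.
  by have := betaJ_lt al12 hlt nua; rewrite JJ ltxx.
Qed.
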